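(* Let $M\in\mathcal{W}_k^{\ast}(d)$, i.e. $M\in\mathcal{W}_k(d)$ is $(k+1)$-neighbourly, where $k\ge 2$ and $d\ge 2k+2$. Suppose $M$ is not a $\mathbb{Z}$-homology sphere. Then $M$ has the same integral homology groups as the connected sum of $\beta$ copies of $S^{k}\times S^{d-k}$, where the positive integer $\beta$ is given in terms of the number $m$ of vertices of $M$ by the formula $$\beta=\binom{m+k-d-2}{k+1}\Big/\binom{d+2}{k+1}.$$ In consequence, $m\ge 2d+4-k$ and $\binom{d+2}{k+1}$ divides $\binom{m+k-d-2}{k+1}$.
   Context: All simplicial complexes are finite and abstract, with the empty set as a face. For a finite set $\alpha$, $\overline{\alpha}$ is the complex of all subsets of $\alpha$ and $\partial\alpha$ the complex of all proper subsets. The join $X\ast Y$ (disjoint vertex sets) has as faces the disjoint unions of a face of $X$ and a face of $Y$. The standard sphere $S^d_{d+2}$ is $\partial\alpha$ with $\#\alpha=d+2$. Complexes are identified up to isomorphism. Bistellar moves: if $X$ is $d$-dimensional and $\alpha,\beta$ are disjoint nonempty sets with $\dim\alpha+\dim\beta=d$ (where $\dim\alpha=\#\alpha-1$) such that the set of faces of $X$ contained in $\alpha\sqcup\beta$ is exactly $\overline{\alpha}\ast\partial\beta$, then $Y=(X\setminus(\overline\alpha\ast\partial\beta))\cup(\partial\alpha\ast\overline\beta)$ is obtained from $X$ by the bistellar move $\alpha\mapsto\beta$, of index $\dim\beta$ (if $\beta$ is a single vertex, it is a new vertex). For $0\le k\le d+1$, a $d$-dimensional complex is $k$-stellated if it is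 obtained from $S^d_{d+2}$ by a finite sequence of bistellar moves, each of index $<k$ ($S^d_{d+2}$ is the only $0$-stellated one). The link of a vertex $x$ in $X$ is $\{\alpha\in X: x\notin\alpha,\ \alpha\sqcup\{x\}\in X\}$. For $0\le k\le d$, $\mathcal{W}_k(d)$ is the class of connected $d$-dimensional simplicial complexes all of whose vertex links are $k$-stellated $(d-1)$-spheres. $X$ is $l$-neighbourly if any $l$ vertices of $X$ form a face. *)

(* Defs.v *)
From HB Require Import structures.
From mathcomp Require Import all_boot all_order all_algebra.
From mathcomp Require Import finmap boolp.

Set Implicit Arguments.
Unset Strict Implicit.
Unset Printing Implicit Defensive.

Import Order.TTheory GRing.Theory Num.Theory.

Local Open Scope fset_scope.

(* A family of faces.  Being a simplicial complex is the separate predicate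
   [is_complex], so that joins, links, etc. are plain operations on families. *)
Definition cplx (V : choiceType) : Type := {fset {fset V}}.

Section Complexes.
Variable V : choiceType.
Implicit Types (X Y : cplx V) (s t alpha beta : {fset V}).

Definition is_complex X : Prop :=
  fset0 \in X /\ forall s t, s \in X -> t `<=` s -> t \in X.

Definition vertices X : {fset V} := fcover X.

Definition full_complex alpha : cplx V := fpowerset alpha.

Definition bdry_complex alpha : cplx V := fpowerset alpha `\ alpha.

(* Only used for families on disjoint vertex sets. *)
Definition join X Y : cplx V := [fset s `|` t | s in X, t in Y].

Definition link X (x : V) : cplx V :=
  [fset s in X | (x \notin s) && (x |` s \in X)].

(* The maximal size of a face is d + 1; this excludes d = -1. *)
Definition dimension_is (d : nat) X : Prop :=
  \max_(s <- enum_fset X) #|` s| = d.+1.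

Definition edge_rel X : rel V := fun x y => [fset x; y] \in X.

Definition connected X : Prop :=
  forall x y, x \in vertices X -> y \in vertices X ->
    exists2 p : seq V, path (edge_rel X) x p & last x p = y.

Definition neighbourly (l : nat) X : Prop :=
  forall s, s `<=` vertices X -> #|` s| = l -> s \in X.

(* The hypotheses under which alpha |-> beta is a bistellar move on X.  When
   beta = {v} the second equality forces v not to be a vertex of X. *)
Definition bistellar_admissible (d : nat) X alpha beta : Prop :=
  [/\ dimension_is d X, alpha != fset0, beta != fset0, [disjoint alpha & beta] &
      (#|` alpha|.-1 + #|` beta|.-1 = d)%N] /\
  [fset s in X | s `<=` alpha `|` beta] =
    join (full_complex alpha) (bdry_complex beta).

Definition bistellar_move X alpha beta : cplx V :=
  (X `\` join (full_complex alpha) (bdry_complex beta))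
    `|` join (bdry_complex alpha) (full_complex beta).

End Complexes.

Definition isomorphic (V W : choiceType) (X : cplx V) (Y : cplx W) : Prop :=
  exists2 f : V -> W, {in vertices X &, injective f} &
    Y = [fset f @` s | s : {fset V} in X].

(* Complexes are considered up to isomorphism; from here on their vertices are
   natural numbers, which leaves room for the new vertices of bistellar moves
   and orders the vertices of each face. *)

Definition standard_sphere (d : nat) : cplx nat :=
  bdry_complex [fset i | i in iota 0 d.+2].

(* Starting from every boundary of a (d+1)-simplex makes this predicate
   invariant under renaming of the vertices. *)
Inductive stellated (k d : nat) : cplx nat -> Prop :=
| stellated_sphere (alpha : {fset nat}) :
    #|` alpha| = d.+2 -> stellated k d (bdry_complex alpha)
| stellated_move (X : cplx nat) (alpha beta : {fset nat}) :
    stellated k d X -> bistellar_admissible d X alpha beta ->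
    (#|` beta|.-1 < k)%N -> stellated k d (bistellar_move X alpha beta).

Definition classW (k d : nat) (M : cplx nat) : Prop :=
  [/\ is_complex M, dimension_is d M, connected M &
      forall x, x \in vertices M -> stellated k d.-1 (link M x)].

Definition classWstar (k d : nat) (M : cplx nat) : Prop :=
  classW k d M /\ neighbourly k.+1 M.

(* The staircase triangulation of |X| x |Y|: faces are the chains, for the
   componentwise order, which project onto a face of X and a face of Y. *)
Definition prod_le (p q : nat * nat) : bool := (p.1 <= q.1)%N && (p.2 <= q.2)%N.

Definition prod_complex (X Y : cplx nat) : cplx (nat * nat)%type :=
  [fset s in fpowerset (vertices X `*` vertices Y) |
    [&& all (fun p => all (fun q => prod_le p q || prod_le q p) (enum_fset s))
          (enum_fset s),
        [fset p.1 | p in s] \in X & [fset p.2 | p in s] \in Y]].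

(* Z is a connected sum of n >= 1 copies of the d-dimensional complex P.  The
   sum of X and Y along facets identified by a bijection of their vertices is
   written with X and Y already glued, i.e. meeting exactly in the common
   closed facet, which is then removed.  For P a product of two spheres, which
   has an orientation-reversing symmetry, the homeomorphism type of Z does not
   depend on the facets and bijections chosen. *)
Inductive connected_sum (d : nat) (V : choiceType) (P : cplx V) :
    nat -> cplx nat -> Prop :=
| connected_sum_one (X : cplx nat) :
    isomorphic P X -> connected_sum d P 1 X
| connected_sum_succ (n : nat) (X Y : cplx nat) (s : {fset nat}) :
    connected_sum d P n X -> isomorphic P Y ->
    #|` s| = d.+1 -> X `&` Y = full_complex s ->
    connected_sum d P n.+1 ((X `|` Y) `\ s).

Section Homology.
Local Open Scope ring_scope.
Variable X : cplx nat.

Definition ifaces (i : nat) : cplx nat := [fset s in X | #|` s| == i.+1].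

Definition chain (i : nat) : Type := {ffun ifaces i -> int}.

HB.instance Definition _ i := GRing.Zmodule.on (chain i).

(* In the boundary of s, the face s \ v has sign (-1)^j when v is the j-th
   vertex of s (from 0) in increasing order. *)
Definition boundary (i : nat) (c : chain i.+1) : chain i :=
  [ffun t : ifaces i =>
     \sum_(s : ifaces i.+1) \sum_(v <- enum_fset (val s) | val s `\ v == val t)
       (-1) ^+ #|` [fset u in val s | (u < v)%N]| * c s].

(* Homology is not reduced: every 0-chain is a cycle. *)
Definition is_cycle (i : nat) : pred (chain i) :=
  match i with
  | 0%N => fun _ => true
  | j.+1 => fun c => boundary c == 0
  end.

Lemma boundaryB i : {morph @boundary i : c e / c - e}.
Proof.
move=> c e; apply/ffunP=> t; rewrite !ffunE -sumrB; apply: eq_bigr => s _.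
by rewrite -sumrB; apply: eq_bigr => v _; rewrite !ffunE mulrBr.
Qed.

Lemma boundary0 i : @boundary i 0 = 0.
Proof. by rewrite -(subrr 0) boundaryB subrr. Qed.

Lemma is_cycle_zmod_closed i : zmod_closed (@is_cycle i).
Proof.
case: i => [|i]; split => //; first by apply/eqP; exact: boundary0.
by move=> c e /eqP hc /eqP he; apply/eqP; rewrite boundaryB hc he subrr.
Qed.

HB.instance Definition _ i :=
  GRing.isZmodClosed.Build (chain i) (@is_cycle i) (is_cycle_zmod_closed i).

Record cycle (i : nat) := Cycle { cycle_chain : chain i; _ : is_cycle cycle_chain }.

HB.instance Definition _ i := [isSub for @cycle_chain i].
HB.instance Definition _ i := [Choice of cycle i by <:].
HB.instance Definition _ i := [SubChoice_isSubZmodule of cycle i by <:].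

Definition is_boundary (i : nat) : pred (cycle i) :=
  fun z => `[< exists c : chain i.+1, boundary c = cycle_chain z >].

Lemma is_boundary_zmod_closed i : zmod_closed (@is_boundary i).
Proof.
split; first by apply/asboolP; exists 0; rewrite boundary0.
move=> y z /asboolP[c hc] /asboolP[e he]; apply/asboolP; exists (c - e).
by rewrite boundaryB hc he.
Qed.

HB.instance Definition _ i :=
  GRing.isZmodClosed.Build (cycle i) (@is_boundary i) (is_boundary_zmod_closed i).

Definition homology (i : nat) : zmodType :=
  Quotient.quot (GRing.ZmodClosed.clone (cycle i) (@is_boundary i) _).

End Homology.

Definition same_homology (X Y : cplx nat) : Prop :=
  forall i, exists f : {additive homology X i -> homology Y i}, bijective f.

Definition homology_sphere (d : nat) (X : cplx nat) : Prop :=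
  same_homology X (standard_sphere d).

(* Main.v *)
(** Over a field, let D be the complex of all t whose faces of size at most k + 2
    lie in M.  Reversing the bistellar moves that produce the link of a vertex v
    shows this link to be the boundary of a shellable k-stellated ball, which is
    the link of v in D; hence D is a (d+1)-manifold with boundary M all of whose
    faces of dimension at most d - k lie in M.  Being (k+1)-neighbourly, D has
    no homology except a Betti number beta in dimension k, and a double complex
    indexed by the interior faces of D gives the Poincare-Lefschetz dual
    statement for D relative to M.  The exact sequence of the pair (D, M) then
    makes the reduced Betti numbers of M equal to beta in dimensions k and d - k
    and to 1 in dimension d.  Neighbourliness determines the face numbers of the
    shellings, so the Euler characteristic of D gives the formula for beta,
    which does not depend on the field.  When all Betti numbers are independent
    of the field, the Smith normal form shows that the integral homology is free
    with these ranks; the same argument applies to the connected sums. *)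

From HB Require Import structures.
From mathcomp Require Import finmap boolp.
From mathcomp Require Import all_boot all_order all_algebra.
From mathcomp Require Import zify ring.
Require Import Defs.

Set Implicit Arguments.
Unset Strict Implicit.
Unset Printing Implicit Defensive.

Import Order.TTheory GRing.Theory Num.Theory.

(** * Based chain complexes over a field *)

Section FunMatrix.
Variable F : fieldType.
Local Open Scope ring_scope.

(** Betti numbers are computed from ranks of submatrices of one incidence matrix, for any family of
    faces closed under passing to intermediate faces. Complexes, pairs, open stars and double
    complexes are then of one kind, and exact sequences become arithmetic of ranks. The bound
    [k + 2] on the tested faces comes from the shellings: a step adds a minimal new face of size at
    most [k], so a missing face of a link ball has size at most [k + 1], and the vertex itself makes
    [k + 2]; the condition d >= 2k + 2 keeps faces of such size on the boundary of the ball. Duality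
    is proved only below codimension [k], where the nerve of the vertex stars looks like that of a
    simplex because all sets of at most [k + 1] vertices are faces; the last Betti number of the
    interior, in codimension [k], follows by comparing the Euler characteristics of [D] and of its
    interior. For the formula, the Euler characteristic is distributed over the vertices, and each
    shelling step of a link contributes an integral of x^a (1-x)^N; the resulting sum telescopes.
    The connected sums are built with one facet left open, so that their Betti numbers simply
    add. *)

Definition fun_mx (A B : finType) (g : A -> B -> F) : 'M[F]_(#|A|, #|B|) :=
  \matrix_(i, j) g (enum_val i) (enum_val j).

Lemma fun_mx_mul (A B C : finType) (g : A -> B -> F) (h : B -> C -> F) :
  fun_mx g *m fun_mx h = fun_mx (fun a c => \sum_b g a b * h b c).
Proof.
apply/matrixP=> i j; rewrite !mxE [RHS](big_enum_val (fun b => g _ b * h b _)) /=.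
by apply: eq_bigr => l _; rewrite !mxE.
Qed.

Lemma eq_fun_mx (A B : finType) (g h : A -> B -> F) :
  (forall a b, g a b = h a b) -> fun_mx g = fun_mx h.
Proof. by move=> e; apply/matrixP=> i j; rewrite !mxE e. Qed.

Lemma fun_mx_tr (A B : finType) (g : A -> B -> F) :
  (fun_mx g)^T = fun_mx (fun b a => g a b).
Proof. by apply/matrixP=> i j; rewrite !mxE. Qed.

Lemma fun_mxD (A B : finType) (g h : A -> B -> F) :
  fun_mx g + fun_mx h = fun_mx (fun a b => g a b + h a b).
Proof. by apply/matrixP=> i j; rewrite !mxE. Qed.

(** Signed partial permutation matrices on both sides carry each matrix to the other, so each rank
    bounds the other. *)
Lemma rank_fun_mx_embed (A B A' B' : finType) (PA : pred A) (PB : pred B)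
    (g : A -> B -> F) (g' : A' -> B' -> F) (u : A -> A') (v : B -> B')
    (ea : A -> F) (eb : B -> F) :
    (forall a, ea a * ea a = 1) -> (forall b, eb b * eb b = 1) ->
    {in PA &, injective u} -> {in PB &, injective v} ->
    (forall a b, g a b != 0 -> PA a && PB b) ->
    (forall a' b', g' a' b' != 0 ->
       exists a b, [/\ PA a, PB b, a' = u a & b' = v b]) ->
    (forall a b, PA a -> PB b -> g' (u a) (v b) = ea a * g a b * eb b) ->
  \rank (fun_mx g') = \rank (fun_mx g).
Proof.
move=> ha hb iu iv h0 h0' hg.
pose qa := fun (a : A) (a' : A') => if PA a && (u a == a') then ea a else 0 : F.
pose qb := fun (b : B) (b' : B') => if PB b && (v b == b') then eb b else 0 : F.
have e1 : fun_mx g' = fun_mx (fun a' a => qa a a') *m fun_mx g *m fun_mx qb.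
  rewrite !fun_mx_mul; apply: eq_fun_mx => a' b'.
  case: (eqVneq (g' a' b') 0) => [z|/h0' [a [b [pa pb -> ->]]]].
    rewrite z; apply/esym/big1 => b _; rewrite /qb; case: ifP => [/andP[pb /eqP eb1]|_]; last by rewrite mulr0.
    rewrite big1 ?mul0r // => a _; rewrite /qa; case: ifP => [/andP[pa /eqP ea1]|_]; last by rewrite mul0r.
    have /eqP := hg a b pa pb; rewrite ea1 eb1 z eq_sym !mulf_eq0 => /orP[/orP[]|] /eqP e.
    - by have /eqP := ha a; rewrite e mulr0 eq_sym oner_eq0.
    - by rewrite e mulr0.
    - by have /eqP := hb b; rewrite e mulr0 eq_sym oner_eq0.
  rewrite hg // (bigD1 b) //= [X in _ = _ + X]big1 ?addr0; last first.
    move=> b1 hb1; rewrite /qb; case: ifP => [/andP[pb1 /eqP /iv e]|_]; last by rewrite mulr0.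
    by move: hb1; rewrite e ?eqxx.
  rewrite /qb pb eqxx /=; congr (_ * _).
  rewrite (bigD1 a) //= [X in _ = _ + X]big1 ?addr0; last first.
    move=> a1 ha1; rewrite /qa; case: ifP => [/andP[pa1 /eqP /iu e]|_]; last by rewrite mul0r.
    by move: ha1; rewrite e ?eqxx.
  by rewrite /qa pa eqxx.
have e2 : fun_mx g = fun_mx qa *m fun_mx g' *m fun_mx (fun b' b => qb b b').
  rewrite !fun_mx_mul; apply: eq_fun_mx => a b.
  case: (boolP (PA a && PB b)) => [/andP[pa pb]|np].
    rewrite (bigD1 (v b)) //= [X in _ = _ + X]big1 ?addr0; last first.
      by move=> b1 hb1; rewrite /qb eq_sym (negPf hb1) andbF mulr0.
    rewrite /qb pb eqxx /= (bigD1 (u a)) //= [X in _ = (_ + X) * _]big1 ?addr0; last first.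
      by move=> a1 ha1; rewrite /qa eq_sym (negPf ha1) andbF mul0r.
    by rewrite /qa pa eqxx /= hg // !mulrA ha mul1r -mulrA hb mulr1.
  have -> : g a b = 0 by apply/eqP; apply: contraNT np => /h0.
  apply/esym/big1 => b' _; rewrite /qb; case: (boolP (PB b)) => pb; last by rewrite mulr0.
  rewrite big1 ?mul0r // => a' _; rewrite /qa.
  by move: np; rewrite pb andbT => /negPf ->; rewrite mul0r.
apply/eqP; rewrite eqn_leq; apply/andP; split.
  by rewrite {1}e1; apply: leq_trans (mxrankM_maxl _ _) (mxrankM_maxr _ _).
by rewrite {1}e2; apply: leq_trans (mxrankM_maxl _ _) (mxrankM_maxr _ _).
Qed.

End FunMatrix.

Section BasedComplex.
Variables (F : fieldType) (C : finType) (inc : C -> C -> int) (deg : C -> nat).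
Hypothesis inc_deg : forall s t, inc s t != 0%R -> deg s = (deg t).+1.
Local Open Scope ring_scope.
Implicit Types X Y Q : {set C}.

Definition level X n : {set C} := [set s in X | deg s == n].

Let D : 'M[F]_#|C| := fun_mx (fun s t => (inc s t)%:~R).
Let P X : 'M[F]_#|C| := fun_mx (fun s t => ((s == t) && (s \in X))%:R).

(** Chains are row vectors, so this is the rank of the boundary from degree [n] to degree [n - 1]
    inside [X]. *)
Definition rk X n : nat := \rank (P (level X n) *m D *m P X).
(** The dimension of the homology in degree [n]; for a complex the subtractions do not truncate, by
    [bt_rk]. *)
Definition bt X n : nat := #|level X n| - rk X n - rk X n.+1.
Definition is_cpx X : Prop := P X *m D *m P X *m D *m P X = 0.
Definition closed_in X X' : Prop :=
  X' \subset X /\ forall s t, s \in X' -> t \in X -> inc s t != 0 -> t \in X'.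

Let PP X Y : P X *m P Y = P (X :&: Y).
Proof.
rewrite fun_mx_mul; apply: eq_fun_mx => s t; rewrite (bigD1 s) //= big1 ?addr0.
  by rewrite eqxx inE /=; case: (s == t); case: (s \in X); case: (s \in Y); rewrite /= ?mulr1 ?mulr0.
by move=> i hi; rewrite eq_sym (negPf hi) mul0r.
Qed.

Let PU X Y : [disjoint X & Y] -> P (X :|: Y) = P X + P Y.
Proof.
move=> dXY; rewrite fun_mxD; apply: eq_fun_mx => s t; rewrite inE.
case: (s == t) => /=; last by rewrite addr0.
case: (boolP (s \in X)) => [/(disjointFr dXY) ->|_]; first by rewrite addr0.
by rewrite add0r.
Qed.

Let entry X Y : P X *m D *m P Y =
  fun_mx (fun s t => if (s \in X) && (t \in Y) then (inc s t)%:~R else 0).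
Proof.
rewrite !fun_mx_mul; apply: eq_fun_mx => s t.
rewrite (bigD1 t) //= [X in _ + X = _]big1 ?addr0; last first.
  by move=> i hi; rewrite (negPf hi) mulr0.
rewrite (bigD1 s) //= [X in (_ + X) * _ = _]big1 ?addr0; last first.
  by move=> i hi; rewrite eq_sym (negPf hi) mul0r.
by rewrite !eqxx /=; do 2!case: (_ \in _); rewrite /= ?mulr1 ?mul1r ?mulr0 ?mul0r.
Qed.

Lemma rkE X n : rk X n =
  \rank (fun_mx (fun s t => if [&& s \in X, deg s == n & t \in X]
                            then (inc s t)%:~R else 0 : F)).
Proof.
by rewrite /rk entry; congr (\rank _); apply: eq_fun_mx => s t; rewrite inE andbA.
Qed.

Let PDP0 X Y : (forall s t, s \in X -> t \in Y -> inc s t = 0) -> P X *m D *m P Y = 0.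
Proof.
move=> h; rewrite entry; apply/matrixP=> i j; rewrite !mxE.
by case: ifP => // /andP[a b]; rewrite h.
Qed.

(** Upper bounds for [X] and for its complement suffice, since the two projections add up to the
    identity. *)
Let rank_P X : \rank (P X) = #|X|.
Proof.
have bnd Y : (\rank (P Y) <= #|Y|)%N.
  have -> : P Y = \sum_(s in Y) delta_mx (enum_rank s) (enum_rank s).
    apply/matrixP=> i j; rewrite summxE !mxE.
    case: (boolP (enum_val i \in Y)) => hi.
      rewrite (bigD1 (enum_val i)) //= [X in _ = _ + X]big1 ?addr0.
        by rewrite mxE enum_valK eqxx /= andbT (inj_eq enum_val_inj) eq_sym.
      move=> s /andP[_ hs]; rewrite mxE; case: eqP => // e; move: hs.
      by rewrite e enum_rankK eqxx.
    rewrite andbF big1 // => s hs; rewrite mxE; case: eqP => // e.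
    by move: hi; rewrite e enum_rankK hs.
  rewrite -[X in (_ <= X)%N]sum1_card.
  apply: (big_ind2 (fun A m => (\rank A <= m)%N)); first by rewrite mxrank0.
    by move=> A a B b hA hB; apply: leq_trans (mxrank_add _ _) (leq_add hA hB).
  by move=> s _; rewrite mxrank_delta.
have e : P X + P (~: X) = 1%:M.
  rewrite -PU; last by rewrite -setI_eq0 setICr.
  apply/matrixP=> i j; rewrite !mxE setUCr inE andbT.
  by rewrite (inj_eq enum_val_inj).
have := mxrank_add (P X) (P (~: X)); rewrite e mxrank1.
have := bnd X; have := bnd (~: X); have := cardsC X; have := cardsT C; lia.
Qed.

Let PDlev X Y n : P (level X n.+1) *m D *m P Y = P (level X n.+1) *m D *m P (level Y n).
Proof.
rewrite !entry; apply: eq_fun_mx => s t; rewrite !inE.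
case: (s \in X) => //=; case: eqP => //= e; case: (t \in Y) => //=.
case: eqP => // ne; case: (eqVneq (inc s t) 0) => [->//|/inc_deg].
by rewrite e => -[] /esym.
Qed.

Let lev_sub X n : level X n \subset X.
Proof. by apply/subsetP=> s; rewrite inE => /andP[]. Qed.

Lemma is_cpxP X :
    (forall s u, s \in X -> u \in X -> \sum_(t in X) inc s t * inc t u = 0) ->
  is_cpx X.
Proof.
move=> h; rewrite /is_cpx.
have -> : P X *m D *m P X *m D *m P X = P X *m D *m P X *m (P X *m D *m P X).
  by rewrite !mulmxA -(mulmxA _ (P X) (P X)) PP setIid.
rewrite entry fun_mx_mul; apply/matrixP=> i j; rewrite !mxE.
have [iX|] := boolP (enum_val i \in X); last by rewrite big1 // => t _; rewrite mul0r.
have [jX|] := boolP (enum_val j \in X); last first.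
  by rewrite big1 // => t _; rewrite andbF mulr0.
have /(congr1 (fun z : int => z%:~R : F)) := h _ _ iX jX.
rewrite rmorph_sum /= => e; rewrite -[RHS]e [RHS]big_mkcond /=.
by apply: eq_bigr => t _; case: (t \in X); rewrite /= ?mul0r // rmorphM.
Qed.

Lemma rk0 X : rk X 0 = 0%N.
Proof.
rewrite /rk PDP0 ?mxrank0 // => s t; rewrite !inE => /andP[_ /eqP e] _.
by apply/eqP; apply: contraT => /inc_deg; rewrite e.
Qed.

Let cpxA X : is_cpx X -> P X *m (D *m (P X *m (D *m P X))) = 0.
Proof. by rewrite !mulmxA. Qed.

Let rk_le X n : is_cpx X -> (rk X n + rk X n.+1 <= #|level X n|)%N.
Proof.
move=> cX; rewrite -rank_P -(mxrank_mul_ker (P (level X n)) (D *m P X)) mulmxA leq_add2l.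
apply/mxrankS; rewrite sub_capmx; apply/andP; split.
  by rewrite PDlev; apply: submxMl.
apply/sub_kermxP; rewrite !mulmxA.
rewrite -[P (level X n.+1)](_ : P (level X n.+1) *m P X = _); last by rewrite PP (setIidPl (lev_sub _ _)).
by rewrite -!mulmxA cpxA ?mulmx0.
Qed.

Lemma bt_rk X n : is_cpx X -> (bt X n + rk X n + rk X n.+1 = #|level X n|)%N.
Proof. by move=> /(rk_le n); rewrite /bt; lia. Qed.

(** * The long exact sequence of a subcomplex, as relations between ranks *)

Section LES.
Variables X X' : {set C}.
Hypotheses (cX : is_cpx X) (cl : closed_in X X').
Let Q := X :\: X'.
Let sub : X' \subset X. Proof. by case: cl. Qed.
Let XE : X = X' :|: Q. Proof. by apply/setP=> s; rewrite !inE; case: (boolP (s \in X')) => //= /(subsetP sub) ->. Qed.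
Let dXQ : [disjoint X' & Q]. Proof. by rewrite -setI_eq0; apply/eqP/setP=> s; rewrite !inE; case: (s \in X'). Qed.
Let PX : P X = P X' + P Q. Proof. by rewrite {1}XE PU. Qed.
Let clP : P X' *m D *m P Q = 0.
Proof.
apply: PDP0 => s t hs; rewrite inE => /andP[nt tX]; apply/eqP; apply: contraNT nt.
by case: cl => _; apply.
Qed.
Let clPA : P X' *m (D *m P Q) = 0.
Proof. by rewrite mulmxA clP. Qed.
Let clL n : P (level X' n) *m D *m P X = P (level X' n) *m D *m P X'.
Proof.
rewrite PX mulmxDr -[P (level X' n)](_ : P (level X' n) *m P X' = _); last by rewrite PP (setIidPl (lev_sub _ _)).
by rewrite -!mulmxA clPA mulmx0 addr0.
Qed.
Let clQ : P X *m D *m P Q = P Q *m D *m P Q.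
Proof. by rewrite PX !mulmxDl clP add0r. Qed.
Let levE n : P (level X n) = P (level X' n) + P (level Q n).
Proof.
rewrite -PU; last first.
  apply: disjointWl (lev_sub _ _) _; apply: disjointWr (lev_sub _ _) _; exact: dXQ.
congr P; apply/setP=> s; rewrite !inE; case: (boolP (s \in X')) => h //=.
  by rewrite (subsetP sub _ h) orbF.
Qed.
Let Plev Y n : P (level Y n) *m P Y = P (level Y n).
Proof. by rewrite PP (setIidPl (lev_sub _ _)). Qed.
Let levXQ n : P (level X n) *m D *m P Q = P (level Q n) *m D *m P Q.
Proof. by rewrite levE !mulmxDl -(Plev X') -!mulmxA clPA mulmx0 add0r. Qed.
Let PXQ : P X *m P Q = P Q.
Proof. by rewrite PP; congr P; apply/setIidPr/subsetDl. Qed.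

Lemma is_cpx_closed : is_cpx X'.
Proof.
rewrite /is_cpx; have e : P X' *m D *m P X' = P X' *m (P X *m D *m P X).
  rewrite PX !mulmxDr !mulmxDl !mulmxDr !mulmxA.
  have z : P X' *m P Q = 0.
    rewrite PP setIC; apply/matrixP=> i j; rewrite !mxE !inE.
    by case: (_ \in X'); rewrite ?andbF.
  by rewrite z !mul0mx !addr0 PP setIid clP addr0.
have := cX; rewrite /is_cpx => h.
have -> : P X' *m D *m P X' *m D *m P X' = P X' *m D *m P X' *m (P X' *m D *m P X').
  by rewrite !mulmxA -(mulmxA _ (P X') (P X')) PP setIid.
have -> : P X' *m D *m P X' *m (P X' *m D *m P X') = P X' *m (P X *m D *m P X) *m (P X *m D *m P X).
  rewrite -e -!mulmxA; congr (_ *m (_ *m _)); rewrite !mulmxA.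
  have -> : P X' *m P X = P X' by rewrite PP (setIidPl sub).
  by rewrite PP setIid PX mulmxDr clP addr0.
rewrite -!mulmxA (mulmxA (P X) (P X)) PP setIid !mulmxA.
by rewrite -!mulmxA cpxA ?mulmx0.
Qed.

Lemma is_cpx_open : is_cpx Q.
Proof.
have h := cX; rewrite /is_cpx in h *.
have : P X *m D *m P X *m D *m P X *m P Q = 0 by rewrite h mul0mx.
rewrite -mulmxA PXQ => e.
have <- : P X *m D *m (P X *m D *m P Q) = P Q *m D *m P Q *m D *m P Q.
  by rewrite clQ !mulmxA clQ.
by rewrite !mulmxA.
Qed.

(** The boundary of [X] is block triangular, and its diagonal blocks are the boundaries of [X'] and
    [Q]. *)
Let i1 n : (rk X' n + rk Q n <= rk X n)%N.
Proof.
rewrite /rk -(mxrank_mul_ker (P (level X n) *m D *m P X) (P Q)) addnC.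
rewrite -(mulmxA _ (P X) (P Q)) PXQ levXQ leq_add2l; apply/mxrankS; rewrite sub_capmx; apply/andP; split.
  rewrite -clL -[P (level X' n)](_ : P (level X' n) *m P (level X n) = _).
    by rewrite -!mulmxA submxMl.
  rewrite PP; congr P; apply/setIidPl/subsetP=> s; rewrite !inE => /andP[h ->].
  by rewrite (subsetP sub).
apply/sub_kermxP; rewrite -mulmxA PP.
by rewrite (_ : X' :&: Q = set0) ?PDP0 // => [s t _|]; [rewrite inE | apply/eqP; rewrite setI_eq0].
Qed.

(** Modulo the image of [X'] only the cells of [Q] contribute to the boundary of [X], and the
    boundaries of [Q] contribute nothing. *)
Let i2 n : (rk X n + rk Q n.+1 <= rk X' n + #|level Q n|)%N.
Proof.
set U := P (level X n) *m D *m P X; set U' := P (level X' n) *m D *m P X'.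
have e0 := mxrank_mul_ker U (cokermx U').
have e1 : (\rank (U :&: kermx (cokermx U')) <= \rank U')%N.
  apply/mxrankS; apply: submx_trans (capmxSr _ _) _.
  by rewrite submxE mulmx_ker.
have hK := mulmx_coker U'; move: (cokermx U') hK e0 e1 => K hK e0 e1.
have e2 : U *m K = P (level Q n) *m (D *m P X *m K).
  rewrite /U levE !mulmxDl clL -/U' hK add0r.
  by rewrite !mulmxA.
have e3 := mxrank_mul_ker (P (level Q n)) (D *m P X *m K).
rewrite -e2 rank_P in e3.
have e4 : (rk Q n.+1 <= \rank (P (level Q n) :&: kermx (D *m P X *m K)))%N.
  apply/mxrankS; rewrite sub_capmx; apply/andP; split.
    by rewrite PDlev submxMl.
  apply/sub_kermxP; rewrite !mulmxA.
  have z : P (level Q n.+1) *m D *m P X *m D *m P X = 0.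
    rewrite -(Plev Q) -[P Q](_ : P Q *m P X = _); last by rewrite PP (setIidPl (subsetDl _ _)).
    by rewrite -!mulmxA cpxA ?mulmx0.
  move: z; rewrite {1}PX mulmxDr !mulmxDl => /eqP; rewrite addrC addr_eq0 => /eqP ->.
  rewrite mulNmx PDlev -!mulmxA (mulmxA (P (level X' n))) (mulmxA (P (level X' n) *m D)) clL.
  by rewrite -/U' hK !mulmx0 oppr0.
rewrite /rk -/U -/U'; rewrite /rk in e4; lia.
Qed.

(** Boundaries of [X] without component in [Q] are cycles of [X']. *)
Let i3 n : (rk X n.+1 + rk X' n <= rk Q n.+1 + #|level X' n|)%N.
Proof.
set U := P (level X n.+1) *m D *m P X.
have e0 := mxrank_mul_ker U (P Q).
have e1 : U *m P Q = P (level Q n.+1) *m D *m P Q by rewrite /U -mulmxA PXQ levXQ.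
have e3 := mxrank_mul_ker (P (level X' n)) (D *m P X').
rewrite rank_P mulmxA in e3.
have e2 : (\rank (U :&: kermx (P Q)) <= \rank (P (level X' n) :&: kermx (D *m P X')))%N.
  apply/mxrankS/rV_subP=> v; rewrite !sub_capmx => /andP[vU /sub_kermxP vQ].
  have vX : v = v *m P (level X' n).
    have : v *m P (level X n) = v.
      by case/submxP: vU => y ->; rewrite /U PDlev -!mulmxA PP setIid.
    rewrite levE mulmxDr.
    suff -> : v *m P (level Q n) = 0 by rewrite addr0.
    rewrite -[P (level Q n)](_ : P Q *m P (level Q n) = _); first by rewrite mulmxA vQ mul0mx.
    by rewrite PP (setIidPr (lev_sub _ _)).
  apply/andP; split; first by rewrite vX submxMl.
  apply/sub_kermxP.
  have vX' : v *m P X' = v *m P X by rewrite PX mulmxDr vQ addr0.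
  rewrite mulmxA vX -(mulmxA v) -(mulmxA v) -clL !mulmxA -vX.
  case/submxP: vU => y ->; rewrite /U -(Plev X).
  by rewrite -!mulmxA cpxA ?mulmx0.
rewrite /rk -/U; rewrite /rk e1 in e0 *; lia.
Qed.

(** The number [c n] is the rank of the connecting map from degree [n] of the quotient to degree
    [n - 1] of the subcomplex, that is, the excess of the rank of [X] over its two diagonal blocks.
    By [i1] the excess is not truncated; [i2] and [i3] are the two bounds. *)
Lemma long_exact : exists c : nat -> nat, c 0 = 0%N /\ forall n,
  [/\ (c n <= bt Q n)%N, (c n.+1 <= bt X' n)%N &
      (bt X n + c n + c n.+1 = bt X' n + bt Q n)%N].
Proof.
exists (fun n => rk X n - rk X' n - rk Q n)%N; split; first by rewrite !rk0.
move=> n; have := i1 n; have := i1 n.+1; have := i2 n; have := i3 n.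
have := bt_rk n cX; have := bt_rk n is_cpx_closed; have := bt_rk n is_cpx_open.
have -> : #|level X n| = (#|level X' n| + #|level Q n|)%N.
  rewrite -(cardsID X' (level X n)); congr (_ + _)%N; apply: eq_card => s; rewrite !inE.
    by rewrite andbC andbA; case: (boolP (s \in X')) => //= /(subsetP sub) ->.
  by rewrite andbA.
by move=> *; split; lia.
Qed.

End LES.

(** * Complexes fibred over a ranked set *)

Section Patch.
Variables (I : finType) (phi : C -> I) (ro : I -> nat).

Definition fibre X i := [set s in X | phi s == i].

Variable X : {set C}.
Hypothesis cX : is_cpx X.
Hypothesis mono : forall s t, s \in X -> t \in X -> inc s t != 0 ->
  phi t = phi s \/ (ro (phi t) < ro (phi s))%N.

Let XJ (J : {set I}) := [set s in X | phi s \in J].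

(** A fibre with maximal [ro] is the quotient by a subcomplex, so the long exact sequence splits it
    off. If the total vanishes in one of any two consecutive degrees, no connecting map can be
    nonzero and equality persists: the spectral sequence of the fibration degenerates. *)
Let patch (J : {set I}) : is_cpx (XJ J) -> forall n,
  (bt (XJ J) n <= \sum_(i in J) bt (fibre X i) n)%N /\
  ((forall n, \sum_(i in J) bt (fibre X i) n = 0 \/ \sum_(i in J) bt (fibre X i) n.+1 = 0)%N ->
    bt (XJ J) n = \sum_(i in J) bt (fibre X i) n)%N.
Proof.
elim: {J}_.+1 {-2}J (ltnSn #|J|) => // N IH J hJ cJ.
case: (set_0Vmem J) => [J0 n|[i0 hi0]].
  rewrite J0 big_set0; suff -> : bt (XJ set0) n = 0%N by [].
  have -> : XJ set0 = set0 by apply/setP=> s; rewrite !inE andbF.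
  rewrite /bt; have -> : level set0 n = set0 by apply/setP=> s; rewrite !inE.
  by rewrite cards0.
pose i := [arg max_(i > i0 in J) ro i].
have [iJ imax] : i \in J /\ forall j, j \in J -> (ro j <= ro i)%N.
  by rewrite /i; case: arg_maxnP.
have cl : closed_in (XJ J) (XJ (J :\ i)).
  split; first by apply/subsetP=> s; rewrite !inE => /and3P[-> _ ->].
  move=> s t; rewrite !inE => /and3P[sX si sJ] /andP[tX tJ] /(mono sX tX) h.
  rewrite tX tJ andbT /=; case: h => [->//|h].
  by apply/eqP=> e; move: h; rewrite e ltnNge imax.
have QE : XJ J :\: XJ (J :\ i) = fibre X i.
  apply/setP=> s; rewrite !inE; case: (s \in X) => //=.
  by case: eqP => [->|] //=; rewrite ?iJ // andNb.
have [c [c0 hc]] := long_exact cJ cl.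
have hJ' : (#|J :\ i| < N)%N by move: hJ; rewrite (cardsD1 i) iJ; lia.
have IH' := IH _ hJ' (is_cpx_closed cJ cl).
rewrite QE in hc.
have sE n : (\sum_(j in J) bt (fibre X j) n =
             bt (fibre X i) n + \sum_(j in J :\ i) bt (fibre X j) n)%N.
  rewrite (bigD1 i) //=; congr (_ + _)%N; apply: eq_bigl => j.
  by rewrite !inE andbC.
move=> n; split.
  by have [] := hc n; have [+ _] := IH' n; rewrite sE; lia.
move=> hs; have hs' n1 : (\sum_(j in J :\ i) bt (fibre X j) n1 = 0 \/ \sum_(j in J :\ i) bt (fibre X j) n1.+1 = 0)%N.
  by have := hs n1; rewrite !sE; lia.
have bE n1 := (IH' n1).2 hs'.
have cz n1 : c n1 = 0%N.
  case: n1 => [//|n1]; have [_ + _] := hc n1; have [+ _ _] := hc n1.+1.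
  by have := hs n1; rewrite !sE bE; lia.
by have [_ _] := hc n; rewrite !cz bE sE; lia.
Qed.

Let XJT : XJ setT = X. Proof. by apply/setP=> s; rewrite !inE andbT. Qed.

Lemma patchwork_le n : (bt X n <= \sum_i bt (fibre X i) n)%N.
Proof.
have := (@patch setT _ n).1; rewrite XJT => /(_ cX).
by rewrite (eq_bigl predT) // => i; rewrite inE.
Qed.

Lemma patchwork n :
  (forall n, \sum_i bt (fibre X i) n = 0 \/ \sum_i bt (fibre X i) n.+1 = 0)%N ->
  bt X n = (\sum_i bt (fibre X i) n)%N.
Proof.
have := (@patch setT _ n).2; rewrite XJT => /(_ cX).
have e n1 : (\sum_(i in [set: I]) bt (fibre X i) n1 = \sum_i bt (fibre X i) n1)%N.
  by apply: eq_bigl => i; rewrite inE.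
by rewrite e => h h1; apply: h => n1; rewrite !e.
Qed.

End Patch.

(** The homotopy writes the identity of a level as a sum of two products, one factoring through the
    boundary out of the level and one through the boundary into it; the two ranks therefore exhaust
    the level. *)
Lemma bt_contractible X (h : C -> C -> int) : is_cpx X ->
  (forall s t, h s t != 0 -> deg t = (deg s).+1) ->
  (forall s u, s \in X -> u \in X ->
    \sum_(t in X) inc s t * h t u + \sum_(t in X) h s t * inc t u = (s == u)%:R) ->
  forall n, bt X n = 0%N.
Proof.
move=> cX hdeg hh n.
pose H : 'M[F]_#|C| := fun_mx (fun s t => (h s t)%:~R).
have eH Y Z : P Y *m H *m P Z =
    fun_mx (fun s t => if (s \in Y) && (t \in Z) then (h s t)%:~R else 0).
  rewrite !fun_mx_mul; apply: eq_fun_mx => s t.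
  rewrite (bigD1 t) //= [X in _ + X = _]big1 ?addr0; last first.
    by move=> i hi; rewrite (negPf hi) mulr0.
  rewrite (bigD1 s) //= [X in (_ + X) * _ = _]big1 ?addr0; last first.
    by move=> i hi; rewrite eq_sym (negPf hi) mul0r.
  by rewrite !eqxx /=; do 2!case: (_ \in _); rewrite /= ?mulr1 ?mul1r ?mulr0 ?mul0r.
have e : P X *m D *m P X *m (P X *m H *m P X) + P X *m H *m P X *m (P X *m D *m P X) = P X.
  rewrite !entry !eH !fun_mx_mul fun_mxD; apply: eq_fun_mx => s u.
  case: (boolP (s \in X)) => sX; last first.
    by rewrite !big1 ?addr0 ?andbF // => t _ /=; rewrite mul0r.
  case: (boolP (u \in X)) => uX; last first.
    rewrite !big1 ?addr0 //; last by move=> t _; rewrite andbF mulr0.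
      by case: eqP => // eu; rewrite -eu sX in uX.
    by move=> t _; rewrite andbF mulr0.
  rewrite andbT -(mulr_natl 1) mulr1; have /(congr1 (fun z : int => z%:~R : F)) := hh s u sX uX.
  rewrite rmorphD !rmorph_sum /= mulrz_nat => <-; congr (_ + _);
    rewrite [RHS]big_mkcond /=; apply: eq_bigr => t _; rewrite andbT;
    by case: (t \in X) => //=; rewrite ?mulr0 ?mul0r // rmorphM.
have Plev Y m : P (level Y m) *m P Y = P (level Y m).
  by rewrite PP (setIidPl (lev_sub _ _)).
have Hl : P (level X n) *m H *m P X = P (level X n) *m H *m P (level X n.+1).
  rewrite !eH; apply: eq_fun_mx => s t; rewrite !inE.
  case: (s \in X) => //=; case: eqP => //= es; case: (t \in X) => //=.
  case: eqP => // ne; case: (eqVneq (h s t) 0) => [->//|/hdeg].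
  by rewrite es => /ne.
have : P (level X n) = P (level X n) *m D *m P X *m (P X *m H *m P X)
     + P (level X n) *m H *m P (level X n.+1) *m (P (level X n.+1) *m D *m P X).
  rewrite -{1}(Plev X n) -{1}e mulmxDr !mulmxA.
  congr (_ + _); first by rewrite Plev.
  rewrite Plev -(mulmxA _ (P (level X n.+1)) (P (level X n.+1))) PP setIid -Hl.
  by rewrite -(mulmxA _ (P X) (P X)) PP setIid.
move=> /(congr1 (fun A => \rank A)); rewrite rank_P => e1.
have := mxrank_add (P (level X n) *m D *m P X *m (P X *m H *m P X))
  (P (level X n) *m H *m P (level X n.+1) *m (P (level X n.+1) *m D *m P X)).
have := mxrankM_maxl (P (level X n) *m D *m P X) (P X *m H *m P X).
have := mxrankM_maxr (P (level X n) *m H *m P (level X n.+1)) (P (level X n.+1) *m D *m P X).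
rewrite -e1 /bt /rk; lia.
Qed.

Lemma bt_top0 X n : (forall t, t \in X -> (deg t <= n)%N) ->
  (forall o : C -> F, (forall s, o s != 0 -> s \in level X n) ->
    (forall t, t \in X -> \sum_(s in level X n) o s * (inc s t)%:~R = 0) ->
    forall s, o s = 0) ->
  bt X n = 0%N.
Proof.
move=> hX ho; suff : (#|level X n| <= rk X n)%N by rewrite /bt; lia.
rewrite -rank_P /rk -mulmxA -(mxrank_mul_ker (P (level X n)) (D *m P X)).
suff -> : (P (level X n) :&: kermx (D *m P X))%MS = 0 by rewrite mxrank0 addn0.
apply/eqP/rowV0P=> v; rewrite sub_capmx => /andP[/submxP[y vy] /sub_kermxP v0].
have vs s : s \notin level X n -> v 0 (enum_rank s) = 0.
  move=> ns; rewrite vy mxE big1 // => j _; rewrite mxE enum_rankK.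
  by case: eqP => [->|]; rewrite ?(negPf ns) /= mulr0.
suff h s : v 0 (enum_rank s) = 0.
  by apply/rowP=> j; rewrite mxE -(enum_valK j) h.
move: s; apply: (ho (fun s => v 0 (enum_rank s))).
  by move=> s; apply: contraNT => /vs ->.
move=> t tX; have /matrixP/(_ 0 (enum_rank t)) := v0; rewrite !mxE.
have DP : D *m P X = fun_mx (fun s u => if u \in X then (inc s u)%:~R else 0).
  rewrite fun_mx_mul; apply: eq_fun_mx => s u; rewrite (bigD1 u) //= big1 ?addr0.
    by rewrite eqxx /=; case: (u \in X); rewrite /= ?mulr1 ?mulr0.
  by move=> i hi; rewrite (negPf hi) mulr0.
rewrite DP; move=> e; rewrite -[RHS]e.
rewrite [in RHS](reindex enum_rank) /=; last exact/onW_bij/enum_rank_bij.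
rewrite big_mkcond /=; apply: eq_bigr => s _; rewrite mxE !enum_rankK tX.
by case: ifP => // /negbT /vs ->; rewrite mul0r.
Qed.

Lemma bt_small X n : (forall t, t \in X -> deg t != n) -> bt X n = 0%N.
Proof.
move=> h; rewrite /bt (_ : level X n = set0) ?cards0 //.
by apply/setP=> s; rewrite !inE; apply/negP=> /andP[/h /negPf ->].
Qed.

Lemma euler X N : is_cpx X -> (forall s, s \in X -> (deg s < N)%N) ->
  \sum_(n < N) (-1) ^+ n * (bt X n)%:R = \sum_(s in X) (-1) ^+ deg s :> int.
Proof.
move=> cX hN.
have rkN : rk X N = 0%N.
  have := bt_rk N cX; rewrite (_ : level X N = set0) ?cards0; first by lia.
  by apply/setP=> s; rewrite !inE; apply/negP=> /andP[/hN h /eqP e]; rewrite e ltnn in h.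
(* A partial sum keeps the rank at the cut as an error term, which vanishes at [N]. *)
have e1 (m : nat) : \sum_(n < m) (-1) ^+ n * (bt X n)%:R =
    \sum_(n < m) (-1) ^+ n * #|level X n|%:R + (-1) ^+ m * (rk X m)%:R :> int.
  elim: m => [|m IH]; first by rewrite !big_ord0 rk0 add0r mulr0.
  rewrite !big_ord_recr /= IH -(bt_rk m cX) !natrD exprS; ring.
rewrite e1 rkN mulr0 addr0.
transitivity (\sum_(n < N) \sum_(s in level X n) (-1) ^+ deg s : int).
  apply: eq_bigr => n _; rewrite (eq_bigr (fun=> (-1) ^+ n)).
    by rewrite sumr_const mulr_natr.
  by move=> s; rewrite inE => /andP[_ /eqP ->].
rewrite (exchange_big_dep (mem X)) /=; last by move=> n s _; rewrite inE => /andP[].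
apply: eq_bigr => s sX; rewrite (bigD1 (Ordinal (hN s sX))) /=; last by rewrite inE sX /=.
rewrite big1 ?addr0 // => n; rewrite inE => /andP[/andP[_ /eqP e] /negP[]].
by apply/eqP/val_inj.
Qed.

End BasedComplex.

(** * Transport and duality of based complexes *)

Section Transport.
Variables (F : fieldType) (C C' : finType) (inc : C -> C -> int) (deg : C -> nat).
Variables (inc' : C' -> C' -> int) (deg' : C' -> nat) (X : {set C}).
Variables (phi : C -> C') (eps : C -> int).
Local Open Scope ring_scope.
Hypothesis inj_phi : {in X &, injective phi}.
Hypothesis eps2 : forall s, eps s * eps s = 1.

Let eF s : (eps s)%:~R * (eps s)%:~R = 1 :> F.
Proof. by rewrite -rmorphM /= eps2. Qed.

Lemma bt_transport c n :
    (forall s t, s \in X -> t \in X -> inc' (phi s) (phi t) = eps s * inc s t * eps t) ->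
    (forall s, s \in X -> deg' (phi s) = (deg s + c)%N) ->
  bt F inc' deg' (phi @: X) (n + c) = bt F inc deg X n.
Proof.
move=> hi hd.
have rE m : rk F inc' deg' (phi @: X) (m + c) = rk F inc deg X m.
  rewrite !rkE; apply: (@rank_fun_mx_embed _ _ _ _ _ (fun s => s \in X) (fun s => s \in X) _ _ phi phi
     (fun s => (eps s)%:~R) (fun s => (eps s)%:~R)) => //.
  - by move=> s t; case: ifP => [/and3P[/= -> _ ->]|]; rewrite ?eqxx.
  - move=> s t; case: ifP; rewrite ?eqxx // => /and3P[/imsetP[a aX ->] _ /imsetP[b bX ->]] _.
    by exists a, b.
  move=> s t sX tX; rewrite !imset_f // hd // eqn_add2r sX tX andbT /=.
  by case: eqP => _; rewrite ?mulr0 ?mul0r // hi // !rmorphM.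
rewrite /bt -addSn (rE n) (rE n.+1); congr (_ - _ - _)%N.
rewrite -[RHS](card_in_imset (f := phi)); last first.
  by move=> s t /= + +; rewrite !inE => /andP[sX _] /andP[tX _]; apply: inj_phi.
apply: eq_card => s'; rewrite !inE; apply/andP/imsetP.
  by case=> /imsetP[s sX ->]; rewrite hd // eqn_add2r => e; exists s; rewrite // inE sX.
by case=> s; rewrite inE => /andP[sX /eqP e] ->; rewrite imset_f // hd // e.
Qed.

Hypothesis inc_deg : forall s t, inc s t != 0 -> deg s = (deg t).+1.

(** Transposing the incidence matrix exchanges boundary and coboundary, and over a field this
    preserves ranks. *)
Lemma bt_dual c n n' :
    (forall s t, s \in X -> t \in X -> inc' (phi s) (phi t) = eps s * inc t s * eps t) ->
    (forall s, s \in X -> deg' (phi s) + deg s = c)%N ->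
  (n + n')%N = c -> bt F inc' deg' (phi @: X) n' = bt F inc deg X n.
Proof.
move=> hi hd hn.
have rE m m' : (m + m')%N = c -> rk F inc' deg' (phi @: X) m' = rk F inc deg X m.+1.
  move=> hm; rewrite !rkE -[RHS]mxrank_tr fun_mx_tr.
  apply: (@rank_fun_mx_embed _ _ _ _ _ (fun s => s \in X) (fun s => s \in X) _ _ phi phi
     (fun s => (eps s)%:~R) (fun s => (eps s)%:~R)) => //.
  - by move=> s t; case: ifP => [/and3P[/= -> _ ->]|]; rewrite ?eqxx.
  - move=> s t; case: ifP; rewrite ?eqxx // => /and3P[/imsetP[a aX ->] _ /imsetP[b bX ->]] _.
    by exists a, b.
  move=> s t sX tX; rewrite !imset_f //= sX tX andbT /=.
  have e1 := hd s sX; case: (eqVneq (inc t s) 0) => [z|/inc_deg e2].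
    by rewrite hi // z mulr0 mul0r /=; do 2!case: ifP => _; rewrite ?mulr0 ?mul0r.
  have -> : (deg' (phi s) == m') = (deg t == m.+1) by apply/eqP/eqP; lia.
  by case: eqP => _; rewrite ?mulr0 ?mul0r // hi // !rmorphM.
have e1 : rk F inc' deg' (phi @: X) n'.+1 = rk F inc deg X n.
  case: n hn => [|n] hn; last by apply: rE; lia.
  rewrite rk0 // rkE -[RHS](mxrank0 F #|C'| #|C'|); congr (\rank _); apply/matrixP=> i j.
  rewrite !mxE; case: ifP => // /and3P[/imsetP[a aX ->] /eqP e _].
  by have := hd a aX; lia.
rewrite /bt e1 (rE n n') // -subnDA addnC subnDA; congr (_ - _ - _)%N.
rewrite -[RHS](card_in_imset (f := phi)); last first.
  by move=> s t /= + +; rewrite !inE => /andP[sX _] /andP[tX _]; apply: inj_phi.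
apply: eq_card => s'; rewrite !inE; apply/andP/imsetP.
  case=> /imsetP[s sX ->] /eqP e; exists s; rewrite // inE sX /=.
  by apply/eqP; have := hd s sX; lia.
case=> s; rewrite inE => /andP[sX /eqP e] ->; rewrite imset_f //; split=> //.
by apply/eqP; have := hd s sX; lia.
Qed.

End Transport.

(** * Convex families of simplices and their Betti numbers *)

Section SimplexSigns.
Variables (T : finType) (r : T -> nat).
Hypothesis r_inj : injective r.
Implicit Types (s t u : {set T}) (X Y Q : {set {set T}}).
Local Open Scope ring_scope.

Definition vsign (v : T) s : int := (-1) ^+ #|[set u in s | (r u < r v)%N]|.

Definition incid s t : int := \sum_(v in s | s :\ v == t) vsign v s.

Lemma incid_rem v s : v \in s -> incid s (s :\ v) = vsign v s.
Proof.
move=> vs; rewrite /incid (bigD1 v) /=; last by rewrite vs eqxx.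
rewrite big1 ?addr0 // => w /andP[/andP[ws /eqP /setP /(_ v)]].
by rewrite !inE eqxx /= vs andbT => /negbT; rewrite negbK => /eqP ->; rewrite eqxx.
Qed.

Lemma incidP s t : incid s t != 0 -> exists2 v, v \in s & t = s :\ v.
Proof.
move=> h; have [v /andP[vs /eqP <-]|no] := pickP (fun v => (v \in s) && (s :\ v == t)).
  by exists v.
by move: h; rewrite /incid big_pred0 ?eqxx.
Qed.

Lemma incid_card s t : incid s t != 0 -> #|s| = #|t|.+1.
Proof. by move=> /incidP[v vs ->]; rewrite (cardsD1 v s) vs. Qed.

Lemma incid_sub s t : incid s t != 0 -> t \subset s.
Proof. by move=> /incidP[v vs ->]; rewrite subD1set. Qed.

Lemma vsign2 v s : vsign v s * vsign v s = 1.
Proof. by rewrite -expr2 sqrr_sign. Qed.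

(** Deleting the smaller of two vertices moves the larger one down by one place; deleting the larger
    does not move the smaller. *)
Lemma vsign_swap v w s : v \in s -> w \in s -> v != w ->
  vsign v s * vsign w (s :\ v) = - (vsign w s * vsign v (s :\ w)).
Proof.
move=> vs ws vw; rewrite /vsign -!exprD.
have e (x y : T) : x \in s -> #|[set u in s | (r u < r y)%N]| =
    ((r x < r y)%N + #|[set u in s :\ x | (r u < r y)%N]|)%N.
  move=> xs; rewrite (cardsD1 x) inE xs /=; congr (_ + _)%N; apply: eq_card => z.
  by rewrite !inE andbA.
rewrite (e v w) // (e w v) //.
have : r v != r w by rewrite (inj_eq r_inj).
rewrite neq_ltn; case: ltngtP => //= h _; rewrite !exprD ?expr0 ?expr1; ring.
Qed.

(** The sum runs over ordered pairs of removed vertices and is antisymmetric in them; doubling is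
    injective on the integers. *)
Lemma incid_sq s u : \sum_t incid s t * incid t u = 0.
Proof.
pose g (p : T * T) := if [&& p.1 \in s, p.2 \in s, p.1 != p.2 & s :\ p.1 :\ p.2 == u]
   then vsign p.1 s * vsign p.2 (s :\ p.1) else 0.
have e : \sum_t incid s t * incid t u = \sum_v \sum_w g (v, w).
  transitivity (\sum_(v in s) vsign v s * incid (s :\ v) u).
    under eq_bigr do rewrite mulr_suml.
    rewrite (exchange_big_dep (mem s)) /=; last by move=> t v _ /andP[].
    apply: eq_bigr => v vs; rewrite (bigD1 (s :\ v)) /=; last by rewrite vs eqxx.
    by rewrite big1 ?addr0 // => t /andP[/andP[_ /eqP ->]]; rewrite eqxx.
  rewrite big_mkcond /=; apply: eq_bigr => v _; case: (boolP (v \in s)) => vs; last first.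
    by rewrite big1 // => w _; rewrite /g /= (negPf vs).
  rewrite mulr_sumr big_mkcond /=; apply: eq_bigr => w _; rewrite /g /= vs /= !inE.
  by rewrite eq_sym andbA [(w \in s) && _]andbC.
have a v w : g (v, w) = - g (w, v).
  rewrite /g /= eq_sym setDDl setUC -setDDl.
  case: (boolP (v \in s)) => vs; case: (boolP (w \in s)) => ws; rewrite ?oppr0 //=.
  case: (eqVneq w v) => /= vw; rewrite ?oppr0 //.
  case: (_ == u); rewrite ?oppr0 //.
  by rewrite vsign_swap // eq_sym.
have : \sum_v \sum_w g (v, w) + \sum_v \sum_w g (v, w) = 0.
  rewrite {1}exchange_big /= -big_split /= big1 // => v _; rewrite -big_split /= big1 // => w _.
  by rewrite a addNr.
by rewrite e => /eqP; rewrite -mulr2n mulrn_eq0 /= => /eqP.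
Qed.

(** Such a family is a difference of two complexes, and its chains are the relative chains of the
    pair. *)
Definition convex X := forall s t u, s \in X -> u \in X -> u \subset t -> t \subset s -> t \in X.

Variable F : fieldType.

(* Homology is reduced and indexed by the size of faces: when X is a complex
   this is the rank of the reduced homology of X in dimension n - 1. *)
Definition betti X n := bt F incid (fun s : {set T} => #|s|) X n.

Lemma cpx_convex X : convex X -> is_cpx F incid X.
Proof.
move=> cv; apply: is_cpxP => s u sX uX.
rewrite -[RHS](incid_sq s u) big_mkcond /=; apply: eq_bigr => t _.
case: ifP => // /negbT nt; apply/esym/eqP; apply: contraNT nt.
rewrite mulf_eq0 negb_or => /andP[/incid_sub h1 /incid_sub h2].
exact: cv sX uX h2 h1.
Qed.

Definition lower_in X X' := X' \subset X /\
  forall s t, s \in X' -> t \in X -> t \subset s -> t \in X'.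

Lemma lower_closed X X' : lower_in X X' -> closed_in incid X X'.
Proof. by case=> h1 h2; split=> // s t sX tX /incid_sub; apply: h2. Qed.

Lemma les X X' : convex X -> lower_in X X' ->
  exists c : nat -> nat, c 0 = 0%N /\ forall n,
  [/\ (c n <= betti (X :\: X') n)%N, (c n.+1 <= betti X' n)%N &
      (betti X n + c n + c n.+1 = betti X' n + betti (X :\: X') n)%N].
Proof.
move=> cv cl; exact (@long_exact F _ incid (fun s : {set T} => #|s|) incid_card X X' (cpx_convex cv) (lower_closed cl)).
Qed.

Lemma betti_acyclic_sub X X' : convex X -> lower_in X X' ->
  (forall n, betti X' n = 0%N) -> forall n, betti X n = betti (X :\: X') n.
Proof.
move=> cv cl h n; have [c [c0 hc]] := les cv cl.
have z m : c m = 0%N by case: m => // m; have [_] := hc m; rewrite h; lia.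
by have [_ _] := hc n; rewrite !z h; lia.
Qed.

Lemma betti_acyclic_quot X X' : convex X -> lower_in X X' ->
  (forall n, betti (X :\: X') n = 0%N) -> forall n, betti X n = betti X' n.
Proof.
move=> cv cl h n; have [c [c0 hc]] := les cv cl.
have z m : c m = 0%N by have [+ _ _] := hc m; rewrite h; lia.
by have [_ _] := hc n; rewrite !z h; lia.
Qed.

Lemma betti_acyclic_total X X' : convex X -> lower_in X X' ->
  (forall n, betti X n = 0%N) -> forall n, betti X' n = betti (X :\: X') n.+1.
Proof.
move=> cv cl h n; have [c [c0 hc]] := les cv cl.
by have [] := hc n; have [] := hc n.+1; rewrite !h; lia.
Qed.

Lemma betti_sub_top X X' n : convex X -> lower_in X X' ->
  betti (X :\: X') n.+1 = 0%N -> (betti X' n <= betti X n)%N.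
Proof.
move=> cv cl h; have [c [c0 hc]] := les cv cl.
by have [] := hc n; have [] := hc n.+1; rewrite h; lia.
Qed.

Lemma betti_small X n : (forall t, t \in X -> #|t| != n) -> betti X n = 0%N.
Proof. exact: bt_small. Qed.

Lemma betti0 n : betti set0 n = 0%N.
Proof. by apply: betti_small => t; rewrite inE. Qed.

Lemma betti_le X n : (betti X n <= #|level (fun s : {set T} => #|s|) X n|)%N.
Proof. rewrite /betti /bt; lia. Qed.

(** The contracting homotopy adds [p], with the sign that gives [s] coefficient one in the boundary
    of the image. *)
Lemma betti_cone p X : (forall s, s \in X -> (p |: s \in X) /\ (s :\ p \in X)) -> convex X ->
  forall n, betti X n = 0%N.
Proof.
move=> hp cv.
pose h s t := if (p \notin s) && (t == p |: s) then incid t s else 0.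
apply: (bt_contractible (h := h)); [exact: cpx_convex| |].
  by move=> s t; rewrite /h; case: ifP => [_ /incid_card|]; rewrite ?eqxx.
move=> s u sX uX; have [ps1 ps2] := hp s sX.
have h0 t w : p \in t -> h t w = 0 by move=> pt; rewrite /h pt.
have hU t : p \notin t -> h t (p |: t) = incid (p |: t) t by move=> pt; rewrite /h pt eqxx.
have h1 t : p \notin t -> forall w, w != p |: t -> h t w = 0.
  by move=> pt w wn; rewrite /h (negPf wn) andbF.
case: (boolP (p \in s)) => ps.
  rewrite [X in _ + X]big1 ?addr0; last by move=> t _; rewrite h0 ?mul0r.
  rewrite (bigD1 (s :\ p)) //= [X in _ + X]big1 ?addr0; last first.
    move=> t /andP[tX tn]; case: (eqVneq (incid s t) 0) => [->|/incidP[x xs te]].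
      by rewrite mul0r.
    rewrite h0 ?mulr0 // te !inE ps andbT.
    by apply: contraNneq tn => e; rewrite te e.
  have np : p \notin s :\ p by rewrite !inE eqxx.
  case: eqVneq => [<-|ne]; last by rewrite h1 ?mulr0 // setD1K // eq_sym.
  have -> : h (s :\ p) s = incid s (s :\ p) by rewrite -{2}(setD1K ps) hU // setD1K.
  by rewrite incid_rem // vsign2.
rewrite [X in _ + X](bigD1 (p |: s)) //= [X in _ + (_ + X)]big1 ?addr0; last first.
  by move=> t /andP[_ tn]; rewrite h1 ?mul0r.
rewrite hU //; have pps : p \in p |: s by rewrite !inE eqxx.
have Us : (p |: s) :\ p = s by rewrite setU1K.
case: eqVneq => [<-|ne].
  rewrite big1 ?add0r.
    by rewrite -{2 4}Us incid_rem // vsign2.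
  by move=> t _; rewrite /h; case: ifP; rewrite ?mulr0 // => /andP[_ /eqP e]; move: ps; rewrite e !inE eqxx.
case: (boolP (p \in u)) => pu; last first.
  rewrite big1 ?add0r; last first.
    move=> t _; rewrite /h; case: ifP; rewrite ?mulr0 // => /andP[_ /eqP e].
    by move: pu; rewrite e !inE eqxx.
  case: (eqVneq (incid (p |: s) u) 0) => [->|/incidP[x xs ue]]; first by rewrite mulr0.
  move: ne pu; rewrite ue !inE; case: (eqVneq p x) => [<-|px].
    by rewrite Us eqxx.
  by rewrite eqxx.
case: (eqVneq (incid (p |: s) u) 0) => [z|/incidP[x xs ue]].
  rewrite z mulr0 addr0 big1 // => t _; rewrite /h; case: ifP; rewrite ?mulr0 //.
  move=> /andP[pt /eqP ue]; case: (eqVneq (incid s t) 0) => [->|/incidP[x xs te]].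
    by rewrite mul0r.
  have xp : x != p by apply: contraNneq ps => <-.
  move: z; have -> : u = (p |: s) :\ x.
    rewrite ue te; apply/setP=> y; rewrite !inE; case: (eqVneq y p) => [->|//] /=.
    by rewrite eq_sym xp.
  rewrite incid_rem ?inE ?xs ?orbT // => /eqP.
  by rewrite /vsign expf_eq0 /= andbF.
have xp : x != p by apply: contraTneq pu => xp; rewrite ue xp !inE eqxx.
have xs' : x \in s by move: xs; rewrite !inE (negPf xp).
have uE : u = p |: (s :\ x).
  rewrite ue; apply/setP=> y; rewrite !inE; case: (eqVneq y p) => [->|//] /=.
  by rewrite eq_sym xp.
have npx : p \notin s :\ x by rewrite !inE (negPf ps) andbF.
have sxX : s :\ x \in X.
  by have [_] := hp u uX; rewrite uE setU1K.
rewrite (bigD1 (s :\ x)) //= [X in _ + X + _]big1 ?addr0; last first.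
  move=> t /andP[_ tn]; rewrite /h; case: ifP; rewrite ?mulr0 // => /andP[pt /eqP e].
  by move: tn; rewrite -(setU1K pt) -e uE setU1K // eqxx.
rewrite uE hU //.
have e1 : incid (p |: s :\ x) (s :\ x) = vsign p (p |: s :\ x).
  by rewrite -{2}(setU1K npx) incid_rem // !inE eqxx.
have e2 : incid (p |: s) s = vsign p (p |: s) by rewrite -{2}Us incid_rem.
have e3 : incid (p |: s) (p |: s :\ x) = vsign x (p |: s).
  by rewrite -uE ue incid_rem.
rewrite e1 e2 e3 incid_rem //.
have /= := @vsign_swap p x (p |: s) pps xs; rewrite eq_sym xp => /(_ isT).
rewrite Us -ue uE => e4.
have := vsign2 p (p |: s :\ x); have := vsign2 p (p |: s); move: e4.
move: (vsign x s) (vsign p (p |: s :\ x)) (vsign p (p |: s)) (vsign x (p |: s)).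
move=> a b c d e4 c2 b2; have -> : a * b = c * a * (c * b) by rewrite -[LHS]mul1r -c2; ring.
have -> : c * a * (c * b) = - (c * d) * (b * b) by rewrite e4; ring.
by rewrite b2 mulr1 addNr.
Qed.

Lemma betti_single s n : betti [set s] n = (n == #|s|).
Proof.
have lE m : level (fun s : {set T} => #|s|) [set s] m = if m == #|s| then [set s] else set0.
  by apply/setP=> t; rewrite !inE; case: (eqVneq m #|s|) => [->|ne]; rewrite !inE;
     case: eqVneq => //= ->; rewrite ?eqxx // eq_sym (negPf ne).
have cv : convex [set s].
  move=> a t b; rewrite !inE => /eqP -> /eqP -> h1 h2.
  by rewrite eqEsubset h2 h1.
have r0 m : rk F incid (fun s : {set T} => #|s|) [set s] m = 0%N.
  have -> : rk F incid (fun s : {set T} => #|s|) [set s] m = \rank (0 : 'M[F]_(#|{set T}|)).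
    rewrite rkE; congr (\rank _); apply/matrixP=> i j; rewrite !mxE.
    case: ifP => // /and3P[]; rewrite !inE => /eqP -> _ /eqP ->.
    by rewrite (_ : incid s s = 0) //; apply/eqP; apply: contraT => /incid_card; lia.
  by rewrite mxrank0.
rewrite /betti /bt !r0 !subn0 lE; case: eqP; rewrite ?cards1 ?cards0 //.
Qed.

Definition seg s t : {set {set T}} := [set u : {set T} | s \subset u & u \subset t].

Lemma convex_seg s t : convex (seg s t).
Proof.
move=> a u b; rewrite !inE => /andP[_ h1] /andP[h2 _] h3 h4.
by rewrite (subset_trans h2 h3) (subset_trans h4 h1).
Qed.

Lemma betti_seg s t n : s \proper t -> betti (seg s t) n = 0%N.
Proof.
case/properP=> st [p pt ps]; apply: (@betti_cone p _ _ (@convex_seg s t)) => u.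
rewrite !inE => /andP[su ut]; rewrite subUset sub1set pt ut /= subsetU ?su ?orbT //.
split=> //; rewrite (subset_trans (subD1set _ _) ut) andbT.
by apply/subsetP=> x xs; rewrite !inE (subsetP su _ xs) andbT; apply: contraNneq ps => <-.
Qed.

Section Fibres.
Variables (I : finType) (phi : {set T} -> I) (ro : I -> nat) (X : {set {set T}}).
Hypothesis cX : convex X.
Hypothesis mono : forall s t, s \in X -> t \in X -> t \subset s ->
  phi t = phi s \/ (ro (phi t) < ro (phi s))%N.

Let mono' s t : s \in X -> t \in X -> incid s t != 0 ->
  phi t = phi s \/ (ro (phi t) < ro (phi s))%N.
Proof. by move=> sX tX /incid_sub; apply: mono. Qed.

Lemma betti_fibre_le n : (betti X n <= \sum_i betti (fibre phi X i) n)%N.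
Proof. exact (@patchwork_le F _ incid (fun s : {set T} => #|s|) incid_card I phi ro X (cpx_convex cX) mono' n). Qed.

Lemma betti_fibre n :
  (forall n, \sum_i betti (fibre phi X i) n = 0 \/ \sum_i betti (fibre phi X i) n.+1 = 0)%N ->
  betti X n = (\sum_i betti (fibre phi X i) n)%N.
Proof. exact (@patchwork F _ incid (fun s : {set T} => #|s|) incid_card I phi ro X (cpx_convex cX) mono' n). Qed.

Lemma betti_fibre0 : (forall i n, betti (fibre phi X i) n = 0)%N -> forall n, betti X n = 0%N.
Proof.
move=> h n; apply/eqP; rewrite -leqn0 (leq_trans (betti_fibre_le n)) //.
by rewrite big1 // => i _.
Qed.

Lemma convex_fibre i : convex (fibre phi X i).
Proof.
move=> s t u; rewrite !inE => /andP[sX /eqP si] /andP[uX /eqP ui] h1 h2.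
have tX := cX sX uX h1 h2; rewrite tX /=.
have [->|h3] := mono sX tX h2; first by rewrite si.
have [<-|h4] := mono tX uX h1; first by rewrite ui.
by move: (ltn_trans h4 h3); rewrite si ui ltnn.
Qed.

End Fibres.

Lemma betti_euler X N : convex X -> (forall s, s \in X -> (#|s| < N)%N) ->
  \sum_(n < N) (-1) ^+ n * (betti X n)%:R = \sum_(s in X) (-1) ^+ #|s| :> int.
Proof.
move=> cv h.
exact (@euler F _ incid (fun s : {set T} => #|s|) incid_card X N (cpx_convex cv) h).
Qed.

End SimplexSigns.

(** * Relabelling vertices, twisting signs, shifting and dualising degrees *)

Section Relabel.
Variables (T T' : finType) (r : T -> nat) (r' : T' -> nat) (F : fieldType).
Local Open Scope ring_scope.

Lemma incid_image (f : T -> T') (s t : {set T}) : injective f ->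
    (forall x y, (r' (f x) < r' (f y))%N = (r x < r y)%N) ->
  incid r' (f @: s) (f @: t) = incid r s t.
Proof.
move=> fi hf.
have im_rem (v : T) : (f @: s) :\ f v = f @: (s :\ v).
  apply/setP=> y; rewrite !inE; apply/andP/imsetP.
    case=> yv /imsetP[x xs e]; exists x => //; rewrite !inE xs andbT.
    by apply: contraNneq yv => <-; rewrite e.
  case=> x; rewrite !inE => /andP[xv xs] ->; split; last exact: imset_f.
  by rewrite (inj_eq fi).
rewrite /incid big_mkcond /= [RHS]big_mkcond /=.
rewrite [RHS](eq_bigr (fun v => if (f v \in f @: s) && ((f @: s) :\ f v == f @: t) then vsign r' (f v) (f @: s) else 0)); last first.
  move=> v _; rewrite mem_imset // im_rem (inj_eq (imset_inj fi)).
  case: ifP => // _; rewrite /vsign -(card_imset _ fi); congr (_ ^+ _); apply: eq_card => y.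
  rewrite !inE; apply/imsetP/andP.
    by case=> x; rewrite !inE => /andP[xs h] ->; rewrite imset_f // hf.
  by case=> /imsetP[x xs ->]; rewrite hf => h; exists x => //; rewrite inE xs.
rewrite (bigID (fun y => y \in codom f)) /= [X in _ + X]big1 ?addr0; last first.
  move=> y ny; case: ifP => // /andP[/imsetP[x xs e]].
  by move: ny; rewrite e codom_f.
rewrite (reindex_omap (fun x => f x) (fun y => [pick x | f x == y])) /=; last first.
  by move=> y /codomP[x ->]; case: pickP => [z /eqP /= e|/(_ x)]; rewrite ?eqxx //= e.
apply: eq_bigl => x; rewrite codom_f /=; case: pickP => [z /eqP /fi ->|/(_ x)]; by rewrite eqxx.
Qed.

Lemma betti_image (f : T -> T') (X : {set {set T}}) n : injective f ->
    (forall x y, (r' (f x) < r' (f y))%N = (r x < r y)%N) ->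
  betti r' F [set f @: (s : {set T}) | s in X] n = betti r F X n.
Proof.
move=> fi hf; rewrite -[n in LHS]addn0.
apply: (@bt_transport F _ _ (incid r) (fun s : {set T} => #|s|) (incid r') (fun s : {set T'} => #|s|) X (fun s => f @: s) (fun=> 1)) => //.
- by move=> s t _ _; apply: imset_inj.
- by move=> s t _ _; rewrite mul1r mulr1 incid_image.
- by move=> s _; rewrite addn0 card_imset.
Qed.

End Relabel.

Section Twist.
Variables (T : finType) (theta : T -> int).
Hypothesis theta2 : forall x, (theta x * theta x = 1)%R.
Local Open Scope ring_scope.

Definition twist (s : {set T}) : int := \prod_(x in s) theta x.

Lemma twist2 s : twist s * twist s = 1.
Proof. by rewrite -big_split /= big1. Qed.

Lemma twist_rem x (s : {set T}) : x \in s -> twist s * twist (s :\ x) = theta x.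
Proof.
move=> xs; rewrite {1}/twist (big_setD1 x) //= -/(twist _) -mulrA twist2 mulr1 //.
Qed.

(** A change of sign that depends only on the removed vertex is the quotient of the products of
    [theta] over the two faces, so it is absorbed by rescaling the basis. *)
Lemma twistE (r : T -> nat) (X : {set {set T}}) (g : {set T} -> {set T} -> int) :
    (forall s t, s \in X -> t \in X -> g s t != 0 -> exists2 x, x \in s & t = s :\ x) ->
    (forall s x, s \in X -> s :\ x \in X -> x \in s -> g s (s :\ x) = theta x * vsign r x s) ->
  forall s t, s \in X -> t \in X -> g s t = twist s * incid r s t * twist t.
Proof.
move=> h1 h2 s t sX tX; case: (eqVneq (incid r s t) 0) => [z|/incidP[x xs te]].
  rewrite z mulr0 mul0r; apply/eqP; apply: contraT => /(h1 _ _ sX tX)[x xs te].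
  by move: z; rewrite te incid_rem // => /eqP; rewrite /vsign expf_eq0 /= andbF.
by rewrite te in tX *; rewrite incid_rem // h2 // -(twist_rem xs); ring.
Qed.

End Twist.

Section Shift.
Variables (T : finType) (r : T -> nat) (F : fieldType).
Hypothesis r_inj : injective r.
Local Open Scope ring_scope.

Lemma betti_shift (v : T) (X : {set {set T}}) n : (forall s, s \in X -> v \notin s) ->
  betti r F [set v |: s | s in X] n.+1 = betti r F X n.
Proof.
move=> hv; rewrite -[n.+1]addn1.
(* Joining [v] changes the sign of removing [x] exactly when [v] precedes [x]. *)
pose theta x : int := (-1) ^+ (r v < r x)%N.
have th2 x : theta x * theta x = 1 by rewrite /theta -expr2 sqrr_sign.
apply: (@bt_transport F _ _ (incid r) (fun s : {set T} => #|s|) (incid r) (fun s : {set T} => #|s|) X (fun s => v |: s) (twist theta)) => //.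
- by move=> s t sX tX e; rewrite -(setU1K (hv _ sX)) e setU1K // hv.
- exact: twist2.
- apply: (twistE th2) => s.
    move=> t sX tX /incidP[x]; rewrite !inE => /orP[/eqP->|xs] e.
      have : v \in v |: t by rewrite !inE eqxx.
      by rewrite e !inE eqxx.
    exists x => //; rewrite -(setU1K (hv _ tX)) e; apply/setP=> y; rewrite !inE.
    by case: (eqVneq y v) => [->|]; rewrite ?(negPf (hv _ sX)) ?andbF.
  move=> x sX _ xs; have xv : x != v by apply: contraTneq xs => ->; rewrite hv.
  have -> : v |: s :\ x = (v |: s) :\ x.
    by apply/setP=> y; rewrite !inE; case: (eqVneq y v) => [->|//]; rewrite eq_sym xv.
  rewrite incid_rem ?inE ?xs ?orbT // /vsign /theta -exprD; congr (_ ^+ _).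
  rewrite (cardsD1 v) !inE eqxx /=; congr (_ + _)%N; apply: eq_card => y; rewrite !inE.
  by case: (eqVneq y v) => [->|//]; rewrite ?(negPf (hv _ sX)).
- by move=> s sX; rewrite cardsU1 hv // addnC.
Qed.

(** Interleaving the two copies keeps the ranking injective without requiring a bound on [r]. *)
Definition dbl_rank (z : T + T) : nat :=
  match z with inl x => (r x).*2 | inr x => (r x).*2.+1 end.

Lemma dbl_rank_inj : injective dbl_rank.
Proof.
move=> [x|x] [y|y] /= e; [congr inl|exfalso|exfalso|congr inr]; try lia; by apply: r_inj; lia.
Qed.

Lemma inl_inj : injective (@inl T T). Proof. by move=> x y []. Qed.
Lemma inr_inj : injective (@inr T T). Proof. by move=> x y []. Qed.
Lemma inl_inr (A : {set T}) x : (inl x \in (@inr T T) @: A) = false.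
Proof. by apply/negP=> /imsetP[]. Qed.
Lemma inr_inl (A : {set T}) x : (inr x \in (@inl T T) @: A) = false.
Proof. by apply/negP=> /imsetP[]. Qed.
Lemma card_inlr (A B : {set T}) : #|(@inl T T @: A) :|: (@inr T T @: B)| = (#|A| + #|B|)%N.
Proof.
rewrite cardsU (_ : _ :&: _ = set0) ?cards0 ?subn0.
  by rewrite !card_imset //; [exact: inr_inj | exact: inl_inj].
by apply/setP=> -[x|x]; rewrite !inE ?inl_inr ?inr_inl ?andbF.
Qed.

(* The pair (w, t) as a cell, where growing t is taking a face. *)
Definition dcell (w t : {set T}) : {set T + T} :=
  [set z | match z with inl x => x \in w | inr x => x \notin t end].

Lemma dcell_card w t : (#|dcell w t| + #|t| = #|w| + #|T|)%N.
Proof.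
have -> : dcell w t = (@inl T T @: w) :|: (@inr T T @: (~: t)).
  apply/setP=> -[x|x]; rewrite !inE ?inl_inr ?inr_inl ?orbF /=.
    by rewrite (mem_imset _ _ inl_inj).
  by rewrite (mem_imset _ _ inr_inj) inE.
by rewrite card_inlr -addnA (addnC #|~: t|) cardsC.
Qed.

(** With [w] fixed, inclusion of cells reverses inclusion of the sets [t], so the cells compute the
    cohomology of [X]. *)
Lemma betti_dcell (w : {set T}) (X : {set {set T}}) n n' : (n + n' = #|w| + #|T|)%N ->
  betti dbl_rank F [set dcell w (t : {set T}) | t in X] n' = betti r F X n.
Proof.
move=> hn.
(* Vertices before [x] lie in [t] or in its complement, so the sign of removing [x] from [t] and
   that of removing [inr x] from the cell differ by a factor depending only on [w] and [x]. *)
pose theta x : int := (-1) ^+ (#|[set y in w | (r y <= r x)%N]| + #|[set y | (r y < r x)%N]|)%N.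
have th2 x : theta x * theta x = 1 by rewrite /theta -expr2 sqrr_sign.
apply: (@bt_dual F _ _ (incid r) (fun s : {set T} => #|s|) (incid dbl_rank) (fun s : {set T + T} => #|s|) X (dcell w) (twist theta) _ _ _ _ _ _ _ _ hn).
- move=> s t _ _ /setP e; apply/setP=> x; have := e (inr x); rewrite !inE.
  by case: (x \in s); case: (x \in t).
- exact: twist2.
- exact: incid_card.
- move=> s t sX tX.
  rewrite [RHS](_ : _ = twist theta t * incid r t s * twist theta s); last by ring.
  apply: (twistE (X := X) (g := fun t s => incid dbl_rank (dcell w s) (dcell w t)) th2) => //.
    move=> {sX tX} {}t {}s _ _ /incidP[[x|x]]; rewrite !inE.
      move=> xw /setP /(_ (inl x)); by rewrite !inE eqxx xw.
    move=> xs /setP e; exists x.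
      by have := e (inr x); rewrite !inE eqxx /=; case: (x \in t).
    apply/setP=> y; have := e (inr y); rewrite !inE.
    rewrite (inj_eq inr_inj).
    by case: (eqVneq y x) => [->|_] /=; [rewrite (negPf xs) | case: (y \in t); case: (y \in s)].
  move=> {sX tX} {}s x sX _ xs.
  have -> : dcell w s = dcell w (s :\ x) :\ inr x.
    apply/setP=> -[y|y]; rewrite !inE //.
    rewrite (inj_eq inr_inj).
    by case: (eqVneq y x) => [->|]; rewrite ?xs.
  rewrite incid_rem ?inE ?eqxx // /vsign.
  have -> : #|[set u in dcell w (s :\ x) | (dbl_rank u < dbl_rank (inr x))%N]| =
      (#|[set y in w | (r y <= r x)%N]| + #|[set y in ~: s | (r y < r x)%N]|)%N.
    have -> : [set u in dcell w (s :\ x) | (dbl_rank u < dbl_rank (inr x))%N] =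
        (@inl T T @: [set y in w | (r y <= r x)%N]) :|: (@inr T T @: [set y in ~: s | (r y < r x)%N]).
      apply/setP=> -[y|y]; rewrite !inE ?inl_inr ?inr_inl ?orbF /=.
        by rewrite (mem_imset _ _ inl_inj) inE; congr (_ && _); apply/idP/idP; lia.
      rewrite (mem_imset _ _ inr_inj) !inE.
      have -> : ((r y).*2.+1 < (r x).*2.+1)%N = (r y < r x)%N by apply/idP/idP; lia.
      by case: (eqVneq y x) => [->|]; rewrite ?ltnn ?andbF.
    by rewrite card_inlr.
  rewrite /theta; have -> : #|[set y | (r y < r x)%N]| =
     (#|[set u in s | (r u < r x)%N]| + #|[set y in ~: s | (r y < r x)%N]|)%N.
    rewrite -(cardsID s); congr (_ + _)%N; apply: eq_card => y; rewrite !inE.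
      by rewrite andbC.
    by [].
  rewrite !exprD; set a := _ ^+ _; set b := _ ^+ _; set c := _ ^+ _.
  have c2 : c * c = 1 by rewrite /c -expr2 sqrr_sign.
  by rewrite -[LHS]mulr1 -c2; ring.
- by move=> s sX; rewrite dcell_card.
Qed.

End Shift.

(** * Shellings of stellated balls *)

Section Shelling.
Variables (T : finType) (k e : nat).
Implicit Types (s t u g : {set T}) (p : {set T} * {set T}) (l : seq ({set T} * {set T})).

(** For a shelling these intervals are disjoint: each consists of the faces that its simplex
    contributes. *)
Definition ball l : {set {set T}} := \bigcup_(p <- l) seg p.1 (p.1 :|: p.2).
(** A new simplex is glued along its faces that do not contain [beta]; this buries its faces
    containing [alpha], which become interior. *)
Definition inner l : {set {set T}} := \bigcup_(p <- l) seg p.2 (p.1 :|: p.2).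
Definition bnd l : {set {set T}} := ball l :\: inner l.

(** Here [e] is the dimension of the boundary sphere: its facets have [e + 1] vertices and those of
    the ball [e + 2]. *)
Definition shelling_step l (p : {set T} * {set T}) : Prop :=
  [/\ [disjoint p.1 & p.2], #|p.1| <= k & #|p.1| + #|p.2| = e.+2] /\
  [/\ p.1 \notin ball l &
      forall t, t \subset p.1 :|: p.2 -> ~~ (p.1 \subset t) -> t \in bnd l].

(* Lists are read from the right: the head (beta, alpha) is the last simplex
   beta U alpha added, and beta its minimal new face. *)
Fixpoint shelling l : Prop :=
  if l is p :: l' then
    [/\ shelling l', shelling_step l' p &
        forall t, t \in bnd l' -> p.2 \subset t -> t \subset p.1 :|: p.2]
  else True.

Hypothesis k_le : k <= e.

Lemma ball_nil : ball [::] = set0. Proof. exact: big_nil. Qed.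
Lemma inner_nil : inner [::] = set0. Proof. exact: big_nil. Qed.
Lemma ball_cons p l : ball (p :: l) = seg p.1 (p.1 :|: p.2) :|: ball l.
Proof. by rewrite /ball /inner big_cons. Qed.
Lemma inner_cons p l : inner (p :: l) = seg p.2 (p.1 :|: p.2) :|: inner l.
Proof. by rewrite /ball /inner big_cons. Qed.

Lemma ball_down l t u : shelling l -> t \in ball l -> u \subset t -> u \in ball l.
Proof.
elim: l => [|p l IH] /=; first by rewrite ?ball_nil ?inner_nil inE.
case=> sl [[_ _ _] [_ h5]] _; rewrite ball_cons => /setUP[|tb ut]; last first.
  by rewrite inE IH ?orbT.
rewrite inE => /andP[pt tp] ut; rewrite inE.
case: (boolP (p.1 \subset u)) => pu; first by rewrite inE pu (subset_trans ut tp).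
by have := h5 u (subset_trans ut tp) pu; rewrite inE => /andP[_ ->]; rewrite orbT.
Qed.

Lemma ball_sup l p t : shelling l -> p.1 \notin ball l -> t \in ball l -> ~~ (p.1 \subset t).
Proof. by move=> sl np tb; apply: contra np; apply: ball_down. Qed.

Lemma inner_ball l t : shelling l -> t \in inner l -> t \in ball l.
Proof.
elim: l => [|p l IH] /=; first by rewrite ?ball_nil ?inner_nil inE.
case=> sl [[_ _ _] [_ h5]] _; rewrite inner_cons ball_cons => /setUP[|ti]; last first.
  by rewrite inE IH ?orbT.
rewrite inE => /andP[pt tp]; rewrite inE.
case: (boolP (p.1 \subset t)) => pu; first by rewrite inE pu tp.
by have := h5 t tp pu; rewrite inE => /andP[_ ->]; rewrite orbT.
Qed.

Lemma inner_notsub l p t : shelling l -> shelling_step l p ->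
  t \in inner l -> ~~ (t \subset p.1 :|: p.2).
Proof.
move=> sl [_ [h4 h5]] ti; apply/negP=> tp.
have pt := ball_sup sl h4 (inner_ball sl ti).
by have := h5 t tp pt; rewrite inE ti.
Qed.

(** The third clause of [shelling] enters here: an old boundary face containing [alpha] lies in the
    new simplex, hence is buried with it. *)
Lemma inner_up l t u : shelling l -> t \in inner l -> u \in ball l -> t \subset u -> u \in inner l.
Proof.
elim: l => [|p l IH] /=; first by rewrite ?ball_nil ?inner_nil inE.
case=> sl st h6; rewrite inner_cons ball_cons => /setUP[] ti /setUP[] ub tu; apply/setUP.
- left; move: ti ub; rewrite !inE => /andP[h _] /andP[_ ->]; rewrite andbT.
  exact: subset_trans h tu.
- move: ti; rewrite inE => /andP[pt _]; have pu := subset_trans pt tu.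
  case: (boolP (u \in inner l)) => [ui|nu]; first by right.
  by left; rewrite inE pu h6 // inE nu ub.
- have /negP[] := inner_notsub sl st ti; move: ub; rewrite inE => /andP[_].
  exact: subset_trans.
- by right; apply: IH ti ub tu.
Qed.

Lemma bnd_down l t u : shelling l -> t \in bnd l -> u \subset t -> u \in bnd l.
Proof.
move=> sl /setDP[tb nt] ut; rewrite inE (ball_down sl tb ut) andbT.
by apply: contra nt => ui; apply: inner_up ui tb ut.
Qed.

Lemma step_size l p : shelling_step l p -> #|p.1 :|: p.2| = e.+2.
Proof. by case=> [[dp _ <-] _]; apply/eqP; rewrite leq_card_setU. Qed.

Lemma ball_size l t : shelling l -> t \in ball l -> #|t| <= e.+2.
Proof.
elim: l => [|p l IH] /=; first by rewrite ball_nil inE.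
case=> sl st _; rewrite ball_cons => /setUP[]; last exact: IH.
by rewrite inE => /andP[_ /subset_leq_card]; rewrite (step_size st).
Qed.

(** Every interior face contains some [alpha], whose partner [beta] has at most [k] elements. *)
Lemma inner_size l t : shelling l -> t \in inner l -> e.+2 <= #|t| + k.
Proof.
elim: l => [|p l IH] /=; first by rewrite ?ball_nil ?inner_nil inE.
case=> sl [[dp h1 h2] _] _; rewrite inner_cons => /setUP[]; last exact: IH.
by rewrite inE => /andP[/subset_leq_card h _]; lia.
Qed.

Lemma facet_cons l p s : shelling_step l p -> s \in ball (p :: l) -> #|s| = e.+2 ->
  s = p.1 :|: p.2 \/ s \in ball l.
Proof.
move=> st; rewrite ball_cons => /setUP[]; last by right.
rewrite inE => /andP[_ h] cs; left; apply/eqP.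
by rewrite eqEcard h (step_size st) cs leqnn.
Qed.

Lemma facet_inner l s : shelling l -> s \in ball l -> #|s| = e.+2 -> s \in inner l.
Proof.
elim: l => [|p l IH] /=; first by rewrite ?ball_nil ?inner_nil inE.
case=> sl st _ sb cs; rewrite inner_cons; apply/setUP.
have [->|h] := facet_cons st sb cs; last by right; apply: IH.
by left; rewrite inE subsetUr subxx.
Qed.

Lemma bnd_size l t : shelling l -> t \in bnd l -> #|t| <= e.+1.
Proof.
move=> sl /setDP[tb ti]; have := ball_size sl tb; rewrite leq_eqVlt => /orP[/eqP h|//].
by rewrite (facet_inner sl tb h) in ti.
Qed.

Lemma ball_pure l t : shelling l -> t \in ball l ->
  exists s, [/\ s \in ball l, #|s| = e.+2 & t \subset s].
Proof.
elim: l => [|p l IH] /=; first by rewrite ?ball_nil ?inner_nil inE.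
case=> sl st _; rewrite ball_cons => /setUP[].
  rewrite inE => /andP[_ h]; exists (p.1 :|: p.2); split => //; last exact: step_size st.
  by rewrite !inE subsetUl subxx.
by case/(IH sl) => s [h1 h2 h3]; exists s; split=> //; rewrite inE h1 orbT.
Qed.

(** A ridge of the newest simplex that stays on the boundary omits a vertex of [alpha], so it
    contains [beta] and is not a face of the older ball. *)
Lemma ridge_uniq l g s1 s2 : shelling l -> g \in bnd l -> #|g| = e.+1 ->
  s1 \in ball l -> s2 \in ball l -> #|s1| = e.+2 -> #|s2| = e.+2 ->
  g \subset s1 -> g \subset s2 -> s1 = s2.
Proof.
elim: l => [|p l IH] /=; first by rewrite ball_nil !inE.
case=> sl st h6 gb cg b1 b2 c1 c2 g1 g2.
have gl : g \subset p.1 :|: p.2 -> g \notin ball l.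
  move=> gp; have [x xp xg] : exists2 x, x \in p.1 :|: p.2 & x \notin g.
    by apply/subsetPn/negP=> /subset_leq_card; rewrite (step_size st) cg ltnn.
  have gE : g = (p.1 :|: p.2) :\ x.
    apply/eqP; rewrite eqEcard; have := cardsD1 x (p.1 :|: p.2).
    rewrite xp (step_size st) cg add1n => -[<-]; rewrite leqnn andbT.
    apply/subsetP=> y yg; rewrite !inE; have := subsetP gp y yg; rewrite inE => ->.
    by rewrite andbT; apply: contraNneq xg => <-.
  have sub (A : {set T}) : A \subset p.1 :|: p.2 -> ~~ (A \subset g) -> x \in A.
    move=> Ap; apply: contraR => xA; rewrite gE; apply/subsetP=> y yA; rewrite !inE.
    by have := subsetP Ap y yA; rewrite inE => ->; rewrite andbT; apply: contraNneq xA => <-.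
  apply/negP=> /(ball_sup sl (proj1 (proj2 st)))/(sub _ (subsetUl _ _)) x1.
  move: gb => /setDP[_]; rewrite inner_cons !inE negb_or gp andbT => /andP[+ _].
  move/(sub _ (subsetUr _ _)) => x2; case: st => [[dp _ _] _].
  by rewrite (disjointFr dp x1) in x2.
have inl' s : s \in ball (p :: l) -> #|s| = e.+2 -> g \subset s -> g \in ball l -> s \in ball l.
  move=> sb cs gs gb'; have [se|//] := facet_cons st sb cs.
  by move: gb'; rewrite (negPf (gl _)) // -se.
case: (boolP (g \in ball l)) => gb'.
  apply: (IH sl _ cg (inl' _ b1 c1 g1 gb') (inl' _ b2 c2 g2 gb') c1 c2 g1 g2).
  by move: gb => /setDP[_]; rewrite inner_cons inE negb_or => /andP[_ h]; rewrite inE h.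
have out s : s \in ball (p :: l) -> #|s| = e.+2 -> g \subset s -> s = p.1 :|: p.2.
  move=> sb cs gs; have [//|h] := facet_cons st sb cs.
  by rewrite (ball_down sl h gs) in gb'.
by rewrite (out s1) // (out s2).
Qed.

(** If [t] contains [beta], each set [x |: beta] with [x] in [t] is small enough to be tested;
    containing [beta] it is a new face, which forces [x] into the new simplex. *)
Lemma shelling_flag l t : shelling l -> l <> [::] ->
  (forall s, s \subset t -> #|s| <= k.+1 -> s \in ball l) -> t \in ball l.
Proof.
elim: l => [|p l IH] //= [sl st h6] _ h; rewrite ball_cons; apply/setUP.
case: (boolP (p.1 \subset t)) => pt.
  left; rewrite inE pt; apply/subsetP=> x xt.
  have : x |: p.1 \in ball (p :: l).
    apply: h; first by rewrite subUset sub1set xt.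
    by case: st => [[_ h1 _] _]; rewrite cardsU1; case: (_ \notin _); lia.
  rewrite ball_cons => /setUP[]; first by rewrite inE subUset sub1set => /andP[_ /andP[]].
  by move/(ball_sup sl (proj1 (proj2 st))); rewrite subsetUr.
right; apply: IH => // [l0|s su cs].
  have : ~~ (p.1 \subset set0) by apply: contra pt => h0; apply: subset_trans h0 (sub0set _).
  by move/(proj2 (proj2 st) _ (sub0set _)); rewrite l0 /bnd ball_nil !inE andbF.
have := h s su cs; rewrite ball_cons => /setUP[] //.
by rewrite inE => /andP[h1 _]; rewrite (subset_trans h1 su) in pt.
Qed.

Section Betti.
Variables (r : T -> nat) (F : fieldType).
Hypothesis r_inj : injective r.
Local Notation b := (betti r F).

(** The open star of [u]; its Betti numbers are the local homology along [u]. *)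
Definition over (u : {set T}) (X : {set {set T}}) : {set {set T}} := [set t in X | u \subset t].

Lemma over_seg u s t : over u (seg s t) = seg (s :|: u) t.
Proof. by apply/setP=> x; rewrite !inE subUset andbAC. Qed.

Lemma overU u X Y : over u (X :|: Y) = over u X :|: over u Y.
Proof. by apply/setP=> x; rewrite !inE andb_orl. Qed.

Lemma convex_over u X : convex X -> convex (over u X).
Proof.
move=> cv s t w; rewrite !inE => /andP[sX _] /andP[wX uw] wt ts.
by rewrite (cv s t w) // (subset_trans uw wt).
Qed.

Lemma convex_ball l : shelling l -> convex (ball l).
Proof. by move=> sl s t u sb _ _ ts; apply: ball_down sb ts. Qed.

Lemma convex_inner l : shelling l -> convex (inner l).
Proof.
move=> sl s t u si ui ut ts; apply: inner_up ui _ ut => //.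
exact: ball_down (inner_ball sl si) ts.
Qed.

Lemma betti_seg_over s t n : b (seg s t) n = (s == t) && (n == #|t|).
Proof.
case: (eqVneq s t) => [->|st] /=.
  have -> : seg t t = [set t] by apply/setP=> x; rewrite !inE eqEsubset andbC.
  by rewrite betti_single.
case: (boolP (s \subset t)) => h; first by apply: betti_seg => //; rewrite properEneq st.
have -> : seg s t = set0; last exact: betti0.
by apply/setP=> x; rewrite !inE; apply: contraNF h => /andP[]; apply: subset_trans.
Qed.

(** A step adds to the star an interval from [beta U u] to the new simplex. It is acyclic unless it
    is a single face, and that happens exactly at the step that makes [u] interior. *)
Lemma betti_over_ball l u n : shelling l ->
  b (over u (ball l)) n = (u \in inner l) && (n == e.+2).
Proof.
elim: l n => [|p l IH] n.
  by move=> _; rewrite ball_nil inner_nil !inE betti_small // => t; rewrite !inE.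
move=> spl; have [sl st h6] := spl; have [_ [h4 h5]] := st.
have lo : lower_in (over u (ball (p :: l))) (over u (ball l)).
  split; first by rewrite ball_cons overU subsetUr.
  move=> s t; rewrite inE => /andP[sb _] /setIdP[_ ut] ts.
  by rewrite inE ut (ball_down sl sb ts).
have cv := @convex_over u _ (convex_ball spl).
have QE : over u (ball (p :: l)) :\: over u (ball l) = seg (p.1 :|: u) (p.1 :|: p.2).
  rewrite ball_cons overU over_seg setDUl setDv setU0; apply/setDidPl.
  rewrite -setI_eq0; apply/eqP/setP=> t; rewrite in_setI in_set0; apply/negP=> /andP[].
  rewrite inE => /andP[+ _] /setIdP[tb _]; rewrite subUset => /andP[pt _].
  by move/negP: (ball_sup sl h4 tb).
case: (eqVneq (p.1 :|: u) (p.1 :|: p.2)) => [ue|ne].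
  have uin : u \in inner (p :: l).
    rewrite inner_cons inE inE -ue subsetUr andbT; apply/orP; left.
    case: st => [[dp _ _] _]; apply/subsetP=> x xp.
    have : x \in p.1 :|: u by rewrite ue inE xp orbT.
    by rewrite inE (disjointFl dp xp).
  have un : u \notin inner l.
    by apply: contraL uin => ui; have /negP[] := inner_notsub sl st ui; rewrite -ue subsetUr.
  rewrite uin (betti_acyclic_sub r_inj cv lo); last by move=> m; rewrite IH // (negPf un).
  by rewrite QE betti_seg_over ue eqxx (step_size st).
rewrite (betti_acyclic_quot r_inj cv lo); last by move=> m; rewrite QE betti_seg_over (negPf ne).
rewrite IH // inner_cons !inE; congr (_ && _); case: (u \in inner l); rewrite ?orbT ?orbF //.
apply/esym; apply: contraNF ne => /andP[pu up]; rewrite eqEsubset !subUset subsetUl up /=.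
by rewrite subsetUl subsetU ?pu ?orbT.
Qed.

(** Dual to [betti_over_ball]: [alpha] and [beta] exchange roles, and now the new interval is the
    subcomplex while the old star is the quotient. *)
Lemma betti_over_inner l u n : shelling l ->
  b (over u (inner l)) n = (u \in ball l) && (n == e.+2).
Proof.
elim: l n => [|p l IH] n.
  by move=> _; rewrite ball_nil inner_nil !inE betti_small // => t; rewrite !inE.
move=> spl; have [sl st h6] := spl; have [_ [h4 h5]] := st.
have cv := @convex_over u _ (convex_inner spl).
have dis t : t \in seg (p.2 :|: u) (p.1 :|: p.2) -> t \in inner l -> False.
  by rewrite inE => /andP[_ tp] /(inner_notsub sl st); rewrite tp.
have lo : lower_in (over u (inner (p :: l))) (seg (p.2 :|: u) (p.1 :|: p.2)).
  split; first by rewrite inner_cons overU over_seg subsetUl.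
  move=> s t; rewrite inE => /andP[_ sp]; rewrite inner_cons overU over_seg => /setUP[//|].
  rewrite inE => /andP[ti _] ts; have := inner_notsub sl st ti.
  by rewrite (subset_trans ts sp).
have QE : over u (inner (p :: l)) :\: seg (p.2 :|: u) (p.1 :|: p.2) = over u (inner l).
  rewrite inner_cons overU over_seg setDUl setDv set0U; apply/setDidPl.
  rewrite -setI_eq0; apply/eqP/setP=> t; rewrite in_setI in_set0; apply/negP=> /andP[].
  by rewrite inE => /andP[ti _] /dis; apply.
case: (eqVneq (p.2 :|: u) (p.1 :|: p.2)) => [ue|ne].
  have uin : u \in ball (p :: l).
    rewrite ball_cons inE inE -ue subsetUr andbT; apply/orP; left.
    case: st => [[dp _ _] _]; apply/subsetP=> x xp.
    have : x \in p.2 :|: u by rewrite ue inE xp.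
    by rewrite inE (disjointFr dp xp).
  have un : u \notin ball l.
    apply: contraNN h4 => ub; apply: ball_down sl ub _.
    move: uin; rewrite ball_cons inE inE => /orP[/andP[//]|].
    move=> _; case: st => [[dp _ _] _]; apply/subsetP=> x xp.
    have : x \in p.2 :|: u by rewrite ue inE xp.
    by rewrite inE (disjointFr dp xp).
  rewrite uin (betti_acyclic_quot r_inj cv lo); last by move=> m; rewrite QE IH // (negPf un).
  by rewrite betti_seg_over ue eqxx (step_size st).
rewrite (betti_acyclic_sub r_inj cv lo); last by move=> m; rewrite betti_seg_over (negPf ne).
rewrite QE IH // ball_cons !inE; congr (_ && _); case: (u \in ball l); rewrite ?orbT ?orbF //.
apply/esym; apply: contraNF ne => /andP[pu up]; rewrite eqEsubset !subUset subsetUr up /=.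
by rewrite subsetUl subsetU ?pu ?orbT.
Qed.

(** The star of a boundary face in the ball is acyclic, so its part on the boundary has the homology
    of its interior part, one degree lower. *)
Lemma betti_over_bnd l u n : shelling l -> u \in bnd l ->
  b (over u (bnd l)) n = (n == e.+1).
Proof.
move=> sl /setDP[ub ui].
have lo : lower_in (over u (ball l)) (over u (bnd l)).
  split; first by apply/subsetP=> t; rewrite !inE => /andP[/andP[_ ->] ->].
  move=> s t /setIdP[sb _] /setIdP[_ ut] ts; rewrite inE ut andbT.
  exact: bnd_down sb ts.
rewrite (betti_acyclic_total r_inj (@convex_over u _ (convex_ball sl)) lo); last first.
  by move=> m; rewrite betti_over_ball // (negPf ui).
have -> : over u (ball l) :\: over u (bnd l) = over u (inner l).
  apply/setP=> t; rewrite in_setD /over 3!in_set [t \in bnd l]in_setD.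
  case: (u \subset t); rewrite ?andbF //= !andbT.
  case: (boolP (t \in inner l)) => ti /=; first exact: inner_ball.
  by rewrite andNb.
by rewrite betti_over_inner // ub.
Qed.

Local Open Scope ring_scope.

(* A relative cycle of top dimension has, up to sign, the same coefficient on
   the two sides of an interior ridge, and the facets are connected through
   interior ridges. *)
Lemma facets_connected l u (o : {set T} -> F) : shelling l ->
    (forall g, g \in inner l -> #|g| = e.+1 -> u \subset g ->
       \sum_(s in ball l | (#|s| == e.+2) && (g \subset s)) o s * (incid r s g)%:~R = 0) ->
  forall s1 s2, s1 \in ball l -> s2 \in ball l -> #|s1| = e.+2 -> #|s2| = e.+2 ->
    u \subset s1 -> u \subset s2 -> o s1 = 0 -> o s2 = 0.
Proof.
elim: l => [|p l IH]; first by move=> _ _ s1 s2; rewrite ball_nil inE.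
move=> spl; have [sl st h6] := spl; have [_ [h4 h5]] := st => H.
have sgn v s : (vsign r v s)%:~R * (vsign r v s)%:~R = 1 :> F.
  by rewrite -rmorphM /= vsign2.
have sgn0 v s (x : F) : x * (vsign r v s)%:~R = 0 -> x = 0.
  by move=> h; rewrite -[x]mulr1 -(sgn v s) mulrA h mul0r.
have Hl g : g \in inner l -> #|g| = e.+1 -> u \subset g ->
       \sum_(s in ball l | (#|s| == e.+2) && (g \subset s)) o s * (incid r s g)%:~R = 0.
  move=> gi cg ug; rewrite -[RHS](H g _ cg ug); last by rewrite inner_cons inE gi orbT.
  apply: eq_bigl => s; rewrite ball_cons inE; case: (boolP (s \in ball l)) => sb; rewrite ?orbT ?orbF //=.
  apply/esym/negP=> /andP[]; rewrite inE => /andP[_ sp] /andP[_ gs].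
  by have /negP[] := inner_notsub sl st gi; exact: (subset_trans gs sp).
have {}IH := IH sl Hl.
have [|nup] := boolP (u \subset p.1 :|: p.2); last first.
  have inl' s : s \in ball (p :: l) -> #|s| = e.+2 -> u \subset s -> s \in ball l.
    by move=> sb cs us; have [se|//] := facet_cons st sb cs; rewrite -se us in nup.
  by move=> s1 s2 b1 b2 c1 c2 u1 u2; apply: IH => //; apply: inl'.
move=> up; have [pu|] := boolP (p.1 \subset u).
  have out s : s \in ball (p :: l) -> #|s| = e.+2 -> u \subset s -> s = p.1 :|: p.2.
    move=> sb cs us; have [//|h] := facet_cons st sb cs.
    by have := ball_down sl h (subset_trans pu us); rewrite (negPf h4).
  by move=> s1 s2 b1 b2 c1 c2 u1 u2; rewrite (out s1) // (out s2).
case/subsetPn=> x xp xu.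
(* Omitting a vertex of [beta] outside [u] gives an interior ridge through which the new facet meets
   an old one. *)
pose g := (p.1 :|: p.2) :\ x.
have xs : x \in p.1 :|: p.2 by rewrite inE xp.
have cg : #|g| = e.+1 by have := cardsD1 x (p.1 :|: p.2); rewrite xs (step_size st) add1n => -[<-].
have ug : u \subset g by apply/subsetD1P.
have pg : p.2 \subset g.
  by apply/subsetD1P; rewrite subsetUr; case: st => [[dp _ _] _]; rewrite (disjointFr dp xp).
have gp : g \subset p.1 :|: p.2 by apply: subD1set.
have gi : g \in inner (p :: l) by rewrite inner_cons inE inE pg gp.
have np1 : ~~ (p.1 \subset g) by apply/subsetPn; exists x; rewrite // !inE eqxx.
have gb := h5 g gp np1.
have [s' [sb' cs' gs']] := ball_pure sl (proj1 (setDP gb)).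
have sne : s' != p.1 :|: p.2.
  by apply: contraNneq h4 => e1; rewrite e1 in sb'; apply: ball_down sb' (subsetUl _ _).
have e0 := H g gi cg ug.
have {e0} e1 : o (p.1 :|: p.2) * (incid r (p.1 :|: p.2) g)%:~R + o s' * (incid r s' g)%:~R = 0.
  rewrite -[RHS]e0 (bigD1 (p.1 :|: p.2)) /=; last first.
    by rewrite (step_size st) eqxx gp ball_cons inE inE subsetUl subxx.
  congr (_ + _); rewrite (bigD1 s') /= ?big1 ?addr0 //; last first.
    by rewrite ball_cons inE sb' orbT cs' eqxx gs'.
  move=> s /andP[/andP[/andP[sb /andP[/eqP cs gs]] n1] n2].
  have [e1|sb1] := facet_cons st sb cs; first by rewrite e1 eqxx in n1.
  by rewrite (ridge_uniq sl gb cg sb1 sb' cs cs' gs gs') eqxx in n2.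
have [y ys' ye] : exists2 y, y \in s' & g = s' :\ y.
  have [y ys yg] : exists2 y, y \in s' & y \notin g.
    by apply/subsetPn/negP=> /subset_leq_card; rewrite cs' cg ltnn.
  exists y => //; apply/eqP; rewrite eqEcard; have := cardsD1 y s'.
  rewrite ys cs' cg add1n => -[<-]; rewrite leqnn andbT.
  by apply/subsetD1P.
have eqv : o (p.1 :|: p.2) = 0 <-> o s' = 0.
  move: e1; rewrite {1}/g incid_rem // ye incid_rem //.
  split=> h; move: e1; rewrite h mul0r ?add0r ?addr0; exact: sgn0.
have us' : u \subset s' := subset_trans ug gs'.
move=> s1 s2 b1 b2 c1 c2 u1 u2 o1.
have os' : o s' = 0.
  have [se|sb1] := facet_cons st b1 c1; first by apply/eqv; rewrite -se.
  exact: (IH s1).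
have [->|sb2] := facet_cons st b2 c2; first exact/eqv.
exact: (IH s').
Qed.

(** A top cycle vanishes at the removed facet, hence everywhere by [facets_connected]. *)
Lemma betti_inner_minus_facet l u s : shelling l -> s \in ball l -> #|s| = e.+2 -> u \subset s ->
  b (over u (inner l) :\ s) e.+2 = 0%N.
Proof.
move=> sl sb cs us; apply: bt_top0.
  by move=> t; rewrite !inE => /and3P[_ /(inner_ball sl)/(ball_size sl)].
move=> o o1 o2.
have os : o s = 0 by apply/eqP; apply: contraT => /o1; rewrite !inE eqxx.
have o0 t : t \notin level (fun s : {set T} => #|s|) (over u (inner l) :\ s) e.+2 -> o t = 0.
  by move=> nt; apply/eqP; apply: contraNT nt; apply: o1.
move=> t; case: (boolP (t \in level (fun s : {set T} => #|s|) (over u (inner l) :\ s) e.+2)); last exact: o0.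
rewrite !inE => /andP[/and3P[_ ti ut] /eqP ct].
apply: (facets_connected sl _ sb (inner_ball sl ti) cs ct us ut os) => g gi cg ug.
have gX : g \in over u (inner l) :\ s.
  by rewrite !inE gi ug !andbT; apply: contra_eqN cg => /eqP ->; rewrite cs; lia.
rewrite -[RHS](o2 g gX) big_mkcond /= [RHS]big_mkcond /=; apply: eq_bigr => a _.
case: ifP => [/and3P[ab /eqP ca ga]|na].
  by case: ifP => // /negbT /o0 ->; rewrite mul0r.
case: ifP => //; rewrite !inE => /andP[/and3P[_ ai ua] ca].
rewrite (_ : incid r a g = 0) ?mulr0 //; apply/eqP; apply: contraFT na => /incid_sub ->.
by rewrite ca (inner_ball sl ai).
Qed.

(** The interior stars of [u] and of [v |: u] both have a single class, in top degree. The map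
    between them is an isomorphism, because a top cycle avoiding [v] misses a facet through [v] and
    so vanishes. *)
Lemma betti_inner_avoid l u v n : shelling l -> v |: u \in ball l -> v \notin u ->
  b [set t in over u (inner l) | v \notin t] n = 0%N.
Proof.
move=> sl vub vu; set X := [set t in _ | _].
have lo : lower_in (over u (inner l)) X.
  split; first by apply/subsetP=> t /setIdP[].
  move=> s t /setIdP[_ vs] tX ts; rewrite inE tX /=.
  by apply: contra vs; apply: subsetP.
have cv : convex (over u (inner l)) by apply/convex_over/convex_inner.
have QE : over u (inner l) :\: X = over (v |: u) (inner l).
  apply/setP=> t; rewrite !inE subUset sub1set.
  by case: (t \in inner l); case: (v \in t); case: (u \subset t).
have ub : u \in ball l by apply: ball_down vub (subsetUr _ _).
have [s [sb cs us]] := ball_pure sl vub.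
have top : b X e.+2 = 0%N.
  have lo' : lower_in (over u (inner l) :\ s) X.
    split.
      apply/subsetP=> t /setIdP[tX vt]; rewrite !inE in tX *; rewrite tX andbT.
      by apply: contraNneq vt => ->; apply: (subsetP us); rewrite !inE eqxx.
    by move=> a t aX /setD1P[_ tX]; case: lo => _; apply.
  have cv' : convex (over u (inner l) :\ s).
    move=> a t c /setD1P[na aX] /setD1P[nc cX] ct ta; rewrite inE (cv a t c) // andbT inE.
    apply: contraNneq na => te; rewrite eq_sym eqEcard -te ta te cs.
    by case/setIdP: aX => ai _; apply: (ball_size sl); apply: (inner_ball sl).
  apply/eqP; rewrite -leqn0.
  rewrite -(betti_inner_minus_facet sl sb cs (subset_trans (subsetUr _ _) us)).
  apply: (betti_sub_top r_inj cv' lo'); apply: betti_small => t /setDP[/setD1P[_ /setIdP[ti _]] _].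
  by apply: contraTneq (ball_size sl (inner_ball sl ti)) => ->; rewrite ltnn.
have [c [c0 hc]] := @les _ _ r_inj F _ _ cv lo.
rewrite QE in hc.
have cz m : c m = 0%N.
  have [h1 _ _] := hc m; have [_ _ h4] := hc e.+2.
  rewrite (betti_over_inner (v |: u) m sl) vub in h1; move: h4.
  rewrite top (betti_over_inner u e.+2 sl) (betti_over_inner (v |: u) e.+2 sl) ub vub eqxx.
  by move: h1; case: eqP => [->|_]; lia.
have [_ _] := hc n; rewrite !cz (betti_over_inner u n sl) (betti_over_inner (v |: u) n sl) ub vub.
by move: (b X n) => a; lia.
Qed.

(* In a closed combinatorial manifold the star of alpha cannot be larger than
   the sphere alpha * bd beta it contains. *)
Lemma shelling_star l p : shelling l -> shelling_step l p ->
  forall t, t \in bnd l -> p.2 \subset t -> t \subset p.1 :|: p.2.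
Proof.
move=> sl st t tb pt; have [[dp _ _] [h4 h5]] := st.
have [p0|[x0 xp0]] := set_0Vmem p.1.
  have := ball_down sl (proj1 (setDP tb)) (sub0set _).
  by rewrite -p0 (negPf h4).
have [f [fb cf tf]] : exists f, [/\ f \in bnd l, #|f| = e.+1 & t \subset f].
  have := betti_over_bnd e.+1 sl tb; rewrite eqxx => h.
  have := betti_le r F (over t (bnd l)) e.+1; rewrite h card_gt0 => /set0Pn[f].
  by rewrite !inE => /andP[/andP[h1 h2] /eqP h3]; exists f; rewrite inE h1.
apply: (subset_trans tf); apply: contraT => fp.
have np t' : p.2 \subset t' -> t' \subset p.1 :|: p.2 -> t' != p.1 :|: p.2 -> t' \in bnd l.
  move=> h1 h2 h3; apply: h5 => //; apply: contra h3 => h.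
  by rewrite eqEsubset h2 subUset h h1.
have pne : p.2 != p.1 :|: p.2.
  by apply: contraTneq xp0 => e1; apply/negP=> xp; have := disjointFr dp xp; rewrite e1 inE xp.
have pb : p.2 \in bnd l by apply: np; rewrite ?subsetUr.
have pf : p.2 \subset f := subset_trans pt tf.
(* A star that is too large has a facet [f] outside the simplex. The part [Z] of the star inside the
   simplex carries a top cycle, and it survives in [Y], the star without [f]. *)
pose Z := seg p.2 (p.1 :|: p.2) :\ (p.1 :|: p.2).
pose Y := over p.2 (bnd l) :\ f.
have bZ n : b Z n = (n == e.+1).
  have lo : lower_in (seg p.2 (p.1 :|: p.2)) Z.
    split; first exact: subD1set.
    move=> a c /setD1P[na]; rewrite /Z !inE => /andP[_ a1] /andP[c1 c2] ca; rewrite c1 c2 !andbT.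
    by apply: contra na => /eqP ce; rewrite eqEsubset a1 -ce ca.
  rewrite (betti_acyclic_total r_inj (@convex_seg _ _ _) lo); last first.
    by move=> m; rewrite betti_seg_over (negPf pne).
  have -> : seg p.2 (p.1 :|: p.2) :\: Z = [set p.1 :|: p.2].
    apply/setP=> a; rewrite !inE; case: eqP => [->|_] /=; last by rewrite andNb.
    by rewrite subsetUr subxx.
  by rewrite betti_single (step_size st).
have cvY : convex Y.
  move=> a c d /setD1P[na /setIdP[ab pa]] /setD1P[_ /setIdP[_ pd]] dc ca.
  apply/setD1P; split; last by rewrite inE (bnd_down sl ab ca) (subset_trans pd dc).
  apply: contra na => /eqP ce; rewrite eq_sym eqEcard -ce ca ce cf.
  exact: bnd_size ab.
have lo : lower_in Y Z.
  split.
    apply/subsetP=> a /setD1P[na]; rewrite inE => /andP[a1 a2].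
    apply/setD1P; split; last by rewrite inE a1 andbT np.
    by apply: contraNneq fp => <-.
  move=> a c /setD1P[na]; rewrite inE => /andP[_ a2] /setD1P[_ /setIdP[_ pc]] ca.
  apply/setD1P; split; last by rewrite inE pc (subset_trans ca a2).
  by apply: contra na => /eqP ce; rewrite eqEsubset a2 -ce ca.
have Y1 : (0 < b Y e.+1)%N.
  apply: leq_trans (betti_sub_top r_inj cvY lo _); first by rewrite bZ eqxx.
  apply: betti_small => a /setDP[/setD1P[_ /setIdP[ab _]] _].
  by apply: contraTneq (bnd_size sl ab) => ->; rewrite ltnn.
have [s [sb cs fs]] := ball_pure sl (proj1 (setDP fb)).
have si := facet_inner sl sb cs.
(* The contradiction: [W] is acyclic and contains [Y], and the quotient is the interior star without
   the facet [s], which has no top class; so [Y] cannot have one either. *)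
pose W := over p.2 (ball l) :\: seg f s.
have fsegE a : a \in ball l -> f \subset a -> a \in seg f s.
  move=> ab fa; rewrite inE fa; have := ball_size sl ab; rewrite leq_eqVlt => /orP[/eqP ca|ca].
    by rewrite (ridge_uniq sl fb cf ab sb ca cs fa fs) subxx.
  suff -> : a = f by [].
  by apply/esym/eqP; rewrite eqEcard fa cf.
have loW : lower_in (over p.2 (ball l)) W.
  split; first exact: subsetDl.
  move=> a c /setDP[/setIdP[ab _] na] cb ca; rewrite inE cb andbT.
  apply: contra na => cs'; apply: fsegE => //; apply: subset_trans ca.
  by move: cs'; rewrite inE => /andP[].
have cvB : convex (over p.2 (ball l)) by apply/convex_over/convex_ball.
have WQ : over p.2 (ball l) :\: W = seg f s.
  apply/setP=> a; rewrite /W !in_setD negb_and negbK.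
  case: (boolP (a \in seg f s)) => /=; last by case: (a \in over _ _).
  rewrite inE => /andP[fa as1]; rewrite inE (ball_down sl sb as1).
  exact: subset_trans pf fa.
have bW n : b W n = 0%N.
  rewrite -(betti_acyclic_quot r_inj cvB loW) => [|m].
    by rewrite betti_over_ball //; case/setDP: pb => _ /negPf ->.
  by rewrite WQ betti_seg_over; case: eqP => [fe|//]; move: cs; rewrite -fe cf => /n_Sn.
have loY : lower_in W Y.
  split.
    apply/subsetP=> a /setD1P[na /setIdP[ab pa]]; apply/setDP; split.
      by rewrite inE (proj1 (setDP ab)).
    apply: contra na; rewrite inE => /andP[fa as1].
    by rewrite eq_sym eqEcard fa cf (bnd_size sl ab).
  move=> a c /setD1P[na /setIdP[ab pa]] /setDP[/setIdP[cb pc] nc] ca.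
  apply/setD1P; split; last by rewrite inE (bnd_down sl ab ca).
  by apply: contraNneq nc => ->; rewrite inE subxx fs.
have cvW : convex W.
  move=> a c d aW dW dc ca; apply: (proj2 loW a) => //.
  by case/setDP: aW => aB _; case/setDP: dW => dB _; apply: cvB aB dB dc ca.
have := betti_acyclic_total r_inj cvW loY bW e.+1.
have -> : W :\: Y = over p.2 (inner l) :\ s.
  apply/setP=> a; rewrite /W /Y !in_setD !in_set1 /over !in_set.
  case: (boolP (a \in ball l)) => ab; last first.
    rewrite !andbF /=; apply/esym/negP=> /and3P[_ /(inner_ball sl)]; by rewrite (negPf ab).
  case: (p.2 \subset a); last by rewrite !andbF.
  rewrite !andbT; case: (boolP (a \in inner l)) => ai /=.
    rewrite !andbF /= andbT; case: (eqVneq a s) => [->|as1]; first by rewrite fs subxx.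
    apply/negP=> /andP[fa]; rewrite subEproper (negPf as1) /= => /proper_card; rewrite cs ltnS => ca.
    have ae : a = f by apply/esym/eqP; rewrite eqEcard fa cf ca.
    by move: fb; rewrite -ae inE ai.
  rewrite andbT !andbF; case: (eqVneq a f) => [->|na] /=; first by rewrite subxx fs.
  by [].
rewrite (betti_inner_minus_facet sl sb cs (subset_trans pf fs)) => e1.
by rewrite e1 in Y1.
Qed.

End Betti.

End Shelling.

(** * Euler characteristics of shellings *)

Section Counting.
Variable T : finType.
Implicit Types (s t : {set T}) (l : seq ({set T} * {set T})).

Lemma seg_split (V : nmodType) (G : {set T} -> V) s t x : x \in t -> x \notin s ->
  (\sum_(u in seg s t) G u = \sum_(u in seg (x |: s) t) G u + \sum_(u in seg s (t :\ x)) G u)%R.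
Proof.
move=> xt xs; rewrite (bigID (fun u : {set T} => x \in u)) /=; congr (_ + _)%R; apply: eq_bigl => u.
  by rewrite !inE subUset sub1set; case: (x \in u); case: (s \subset u); rewrite ?andbF ?andbT.
rewrite !inE subsetD1 andbA; case: (s \subset u) => //=.
Qed.

Lemma seg_ind (P : {set T} -> {set T} -> Prop) :
    (forall s, P s s) ->
    (forall s t x, s \subset t -> x \in t -> x \notin s -> P (x |: s) t -> P s (t :\ x) -> P s t) ->
  forall s t, s \subset t -> P s t.
Proof.
move=> h0 h1 s t; move en: (#|t :\: s|) => n.
elim: n s t en => [|n IH] s t en st.
  have /eqP : t :\: s == set0 by rewrite -cards_eq0 en.
  move/eqP; rewrite setD_eq0 => ts; suff -> : s = t by [].
  by apply/eqP; rewrite eqEsubset st ts.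
have [x xts] : exists x, x \in t :\: s by apply/set0Pn; rewrite -cards_eq0 en.
have [xt xs] := setDP xts.
have c1 := cardsD1 x (t :\: s); rewrite xts en add1n in c1; case: c1 => c1.
apply: (h1 s t x) => //; apply: IH.
- by rewrite c1; apply: eq_card => y; rewrite !inE negb_or; case: (y == x); case: (y \in s).
- by rewrite subUset sub1set xt.
- rewrite c1; apply: eq_card => y; rewrite !inE; case: (y == x); case: (y \in s) => //.
- by apply/subsetD1P.
Qed.

Definition seg_count a N n := if a <= n then 'C(N, n - a) else 0.

Lemma card_seg s t n : s \subset t ->
  \sum_(u in seg s t) (#|u| == n : nat) = seg_count #|s| (#|t| - #|s|) n.
Proof.
move: s t; apply: seg_ind => [s|s t x st xt xs IH1 IH2].
  have -> : seg s s = [set s] by apply/setP=> x; rewrite !inE eqEsubset andbC.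
  rewrite big_set1 subnn /seg_count; case: ltngtP => // h.
    by rewrite bin0n subn_eq0 leqNgt h.
  by rewrite h subnn.
have := seg_split (fun u : {set T} => (#|u| == n : nat)) xt xs.
rewrite /GRing.add /= => ->; rewrite IH1 IH2 cardsU1 xs.
have := cardsD1 x t; rewrite xt => ct; have := subset_leq_card (_ : s \subset t :\ x).
rewrite subsetD1 st xs => /(_ isT) cs.
have -> : #|t| - #|s| = (#|t :\ x| - #|s|).+1 by rewrite ct add1n subSn.
rewrite add1n ct add1n subSS /seg_count.
case: ltngtP => h //; last by rewrite h subnn !bin0.
by rewrite -[n - #|s|]prednK ?subn_gt0 // binS subnS addnC.
Qed.

(** Up to sign the beta integral of x^a (1-x)^N over the unit interval, as obtained by integrating
    the sum over an interval of faces term by term. *)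
Definition seg_weight a N : rat := ((-1) ^+ a * (a`! * N`!)%:R / (a + N).+1`!%:R)%R.

Lemma fact_unit n : (n`!%:R != 0 :> rat)%R.
Proof. by rewrite pnatr_eq0 -lt0n fact_gt0. Qed.

Lemma natS_unit n : (n.+1%:R != 0 :> rat)%R.
Proof. by rewrite pnatr_eq0. Qed.

Lemma sum_seg_weight s t : s \subset t ->
  (\sum_(u in seg s t) (-1) ^+ #|u| / #|u|.+1%:R = seg_weight #|s| (#|t| - #|s|))%R.
Proof.
move: s t; apply: seg_ind => [s|s t x st xt xs IH1 IH2].
  have -> : seg s s = [set s] by apply/setP=> x; rewrite !inE eqEsubset andbC.
  rewrite big_set1 subnn /seg_weight addn0 factS fact0 muln1.
  rewrite natrM; have h1 := fact_unit #|s|; have h2 := natS_unit #|s|.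
  move: (#|s|.+1%:R : rat)%R ((#|s|)`!%:R : rat)%R ((-1) ^+ #|s| : rat)%R h1 h2 => x y z h1 h2.
  by field; rewrite h1 h2.
rewrite (seg_split _ xt xs) IH1 IH2 cardsU1 xs.
have := cardsD1 x t; rewrite xt => ct; have := subset_leq_card (_ : s \subset t :\ x).
rewrite subsetD1 st xs => /(_ isT) cs.
have -> : #|t| - #|s| = (#|t :\ x| - #|s|).+1 by rewrite ct add1n subSn.
rewrite add1n ct add1n subSS; move: #|s| (#|t :\ x| - #|s|) => a N.
rewrite /seg_weight addSn addnS !factS exprS !natrM invfM.
have h1 := natS_unit (a + N).+1; have h2 := fact_unit (a + N); have h3 := natS_unit (a + N).
rewrite !invfM.
have -> : ((a + N)%N.+2%:R = a.+1%:R + N.+1%:R :> rat)%R by rewrite -natrD addSn addnS.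
have h1' : (a.+1%:R + N.+1%:R != 0 :> rat)%R by rewrite -natrD addSn addnS.
move: h1' h2 h3.
move: (a.+1%:R : rat)%R (N.+1%:R : rat)%R ((a + N)%N`!%:R : rat)%R ((a + N)%N.+1%:R : rat)%R => y1 y2 y3 y4 h1' h2 h3.
by field; rewrite h1' h2 h3.
Qed.

Lemma sum_ball (V : nmodType) (k e : nat) (G : {set T} -> V) l : shelling k e l ->
  (\sum_(t in ball l) G t = \sum_(p <- l) \sum_(t in seg p.1 (p.1 :|: p.2)) G t)%R.
Proof.
elim: l => [|p l IH]; first by rewrite ball_nil big_set0 big_nil.
case=> sl [_ [h4 _]] _; rewrite ball_cons big_cons -(IH sl) -bigU /=.
  by apply: eq_bigl => t; rewrite inE.
rewrite -setI_eq0; apply/eqP/setP=> t; rewrite in_setI in_set0; apply/negP=> /andP[].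
by rewrite inE => /andP[pt _] tb; move: (ball_sup sl h4 tb); rewrite pt.
Qed.

Lemma sum_inner (V : nmodType) (k e : nat) (G : {set T} -> V) l : shelling k e l ->
  (\sum_(t in inner l) G t = \sum_(p <- l) \sum_(t in seg p.2 (p.1 :|: p.2)) G t)%R.
Proof.
elim: l => [|p l IH]; first by rewrite inner_nil big_set0 big_nil.
case=> sl st _; rewrite inner_cons big_cons -(IH sl) -bigU /=.
  by apply: eq_bigl => t; rewrite inE.
rewrite -setI_eq0; apply/eqP/setP=> t; rewrite in_setI in_set0; apply/negP=> /andP[].
by rewrite inE => /andP[_ tp] ti; move: (inner_notsub sl st ti); rewrite tp.
Qed.

Lemma shelling_steps k e l p : shelling k e l -> p \in l ->
  [/\ #|p.1| <= k, #|p.1 :|: p.2| = e.+2 & #|p.1 :|: p.2| - #|p.1| = #|p.2|].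
Proof.
elim: l => // q l IH [sl st _]; rewrite inE => /orP[/eqP ->|]; last exact: IH.
have := step_size st; case: st => [[_ h1 h2] _] h3; split=> //.
by rewrite h3 -h2 addKn.
Qed.

(** The h-vector of the shelled ball. *)
Definition hnum l j := count (fun p : {set T} * {set T} => #|p.1| == j) l.

Lemma sum_hnum (V : nmodType) k e (G : nat -> V) l : shelling k e l ->
  (\sum_(p <- l) G #|p.1| = \sum_(j < k.+1) G j *+ hnum l j)%R.
Proof.
move=> sl; have hk p : p \in l -> #|p.1| <= k by case/(shelling_steps sl).
rewrite /hnum; elim: l hk {sl} => [|p l IH] hk.
  by rewrite big_nil big1 // => j _; rewrite mulr0n.
rewrite big_cons IH; last by move=> q ql; apply: hk; rewrite inE ql orbT.
have pk : #|p.1| < k.+1 by rewrite ltnS hk // inE eqxx.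
rewrite [RHS](bigD1 (Ordinal pk)) //= eqxx mulrnDr -addrA; congr (_ + _)%R.
rewrite [LHS](bigD1 (Ordinal pk)) //=; congr (_ + _)%R; apply: eq_bigr => j jp.
by rewrite -val_eqE /= eq_sym in jp; rewrite (negPf jp).
Qed.

(** Both factors are coefficients of negative powers of 1 - x, with exponents [A] and [N - n + 1].
    For [A = 0] the truncated predecessor leaves only the term [j = 0]. *)
Lemma vandermonde_like A N n : n <= N ->
  \sum_(j < n.+1) 'C((A + j).-1, j) * 'C(N - j, n - j) = 'C(A + N, n).
Proof.
elim: A N n => [|A IHA] N n nN.
  rewrite big_ord_recl /= subn0 subn0 bin0 mul1n big1 ?addn0 // => i _.
  by rewrite /bump /= add0n bin_small // add1n.
elim: n N nN => [|n IHn] N nN.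
  by rewrite big_ord_recl big_ord0 /= !bin0.
have E j : 'C((A.+1 + j).-1, j) = 'C((A + j).-1, j) + (if j is j'.+1 then 'C((A.+1 + j').-1, j') else 0).
  case: j => [|j]; first by rewrite !bin0.
  by rewrite !addSn !addnS /= binS.
transitivity (\sum_(j < n.+2) ('C((A + j).-1, j) * 'C(N - j, n.+1 - j) +
   (if nat_of_ord j is j'.+1 then 'C((A.+1 + j').-1, j') else 0) * 'C(N - j, n.+1 - j))).
  by apply: eq_bigr => j _; rewrite E mulnDl.
rewrite big_split /= IHA // big_ord_recl /= mul0n add0n.
case: N nN => // N nN.
transitivity ('C(A + N.+1, n.+1) + 'C(A.+1 + N, n)).
  by congr (_ + _); rewrite -IHn //; apply: eq_bigr => j _.
by rewrite !addSn binS !addnS.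
Qed.

(** Recovers an h-vector from face numbers: the system is triangular with ones on the diagonal. *)
Lemma triangular_unique (k N : nat) (h h' : nat -> nat) : 
  (forall n, n <= k -> \sum_(j < n.+1) h j * 'C(N - j, n - j) = \sum_(j < n.+1) h' j * 'C(N - j, n - j)) ->
  forall n, n <= k -> h n = h' n.
Proof.
move=> H n; elim/ltn_ind: n => n IH nk.
have := H n nk; rewrite !big_ord_recr /= subnn !bin0 !muln1.
rewrite (eq_bigr (fun j : 'I_n => h' j * 'C(N - j, n - j))); last first.
  by move=> j _; rewrite IH //; apply: leq_trans (ltnW (ltn_ord j)) nk.
by move/addnI.
Qed.

(** The closed form absorbs one more term at each step of an induction on [k]. In the application
    [A + N + 1] is the number of vertices and the left-hand side is the alternating face count of
    the filling. *)
Lemma telescope_weights A N k : k <= N ->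
  (1 - (A + N)%N.+1%:R * \sum_(j < k.+1) 'C((A + j)%N.-1, j)%:R * seg_weight j (N - j)%N =
   (-1) ^+ k.+1 * 'C((A + k)%N, k.+1)%:R / 'C(N.+1, k.+1)%:R :> rat)%R.
Proof.
have binE j : j <= N -> ('C(N.+1, j.+1)%:R = N.+1`!%:R / (j.+1`!%:R * (N - j)`!%:R) :> rat)%R.
  move=> jN; have := bin_fact (_ : j.+1 <= N.+1); rewrite ltnS subSS => /(_ jN) <-.
  by rewrite natrM natrM mulfK // mulf_neq0 // fact_unit.
have wE j : j <= N -> seg_weight j (N - j) = ((-1) ^+ j * (j`!%:R * (N - j)`!%:R) / N.+1`!%:R)%R.
  by move=> jN; rewrite /seg_weight subnKC // natrM.
elim: k => [|k IH] kN.
  rewrite big_ord1 wE // binE // !bin0 addn0 bin1 expr0 expr1 subn0 !fact0 !factS.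
  have h1 := fact_unit N; have h2 := natS_unit N; rewrite fact0 !natrM.
  have -> : ((A + N)%N.+1%:R = A%:R + N.+1%:R :> rat)%R by rewrite -natrD addnS.
  move: h1 h2; move: (N`!%:R : rat)%R (N.+1%:R : rat)%R => x y h1 h2.
  by field; rewrite h1 h2.
rewrite big_ord_recr /= mulrDr opprD addrA IH; last exact: ltnW.
rewrite binE; last exact: ltnW.
rewrite binE // wE //.
have e1 : ((A + k.+1)%N%:R * 'C((A + k.+1)%N.-1, k.+1)%:R = k.+2%:R * 'C((A + k.+1)%N, k.+2)%:R :> rat)%R.
  by rewrite -!natrM mul_bin_diag.
have -> : 'C(A + k, k.+1) = 'C((A + k.+1).-1, k.+1) by rewrite addnS.
have -> : (N - k)`! = (N - k) * (N - k.+1)`! by rewrite -(subnSK kN) factS.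
have e2 : ((A + N)%N.+1%:R = (A + k.+1)%N%:R + (N - k)%N%:R :> rat)%R.
  by rewrite -natrD; congr (_%:R)%R; move: kN; clear; lia.
rewrite e2 !factS !natrM !exprS.
have h0 := natS_unit k.+1; have h1 := natS_unit k; have h2 := fact_unit k; have h3 := fact_unit (N - k.+1).
have h4 : ((N - k)%:R != 0 :> rat)%R by rewrite pnatr_eq0 subn_eq0 -ltnNge.
have h5 := natS_unit N; have h6 := fact_unit N.
have -> : ('C((A + k.+1)%N, k.+2)%:R = (A + k.+1)%N%:R * 'C((A + k.+1)%N.-1, k.+1)%:R / k.+2%:R :> rat)%R.
  by rewrite e1 mulrAC mulfV ?mul1r.
move: h0 h1 h2 h3 h4 h5 h6.
move: (k.+2%:R : rat)%R (k.+1%:R : rat)%R (k`!%:R : rat)%R ((N - k.+1)`!%:R : rat)%R ((N - k)%:R : rat)%R (N.+1%:R : rat)%R (N`!%:R : rat)%R.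
move=> x0 x1 x2 x3 x4 x5 x6 h0 h1 h2 h3 h4 h5 h6.
by field; rewrite ?h0 ?h1 ?h2 ?h3 ?h4 ?h5 ?h6.
Qed.

(** Every face is shared equally among its vertices. Removing the chosen vertex leaves a face of the
    link [Y v], smaller by one, whence the sign and the denominator. *)
Lemma sum_by_vertices (X : {set {set T}}) (Y : T -> {set {set T}}) : set0 \notin X ->
    (forall v s, s \in Y v -> v \notin s) ->
    (forall v s, v \notin s -> (v |: s \in X) = (s \in Y v)) ->
  (\sum_(t in X) (-1) ^+ #|t| = - \sum_v \sum_(s in Y v) (-1) ^+ #|s| / #|s|.+1%:R :> rat)%R.
Proof.
move=> X0 Yv XY.
transitivity (\sum_(t in X) \sum_(v in t) (-1) ^+ #|t| / #|t|%:R : rat)%R.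
  apply: eq_bigr => t tX; rewrite sumr_const -mulrnAl -mulr_natr mulfK //.
  by rewrite pnatr_eq0 cards_eq0; apply: contraNneq X0 => <-.
rewrite (exchange_big_dep predT) //= -sumrN; apply: eq_bigr => v _.
rewrite (reindex_onto (fun s => v |: s) (fun t => t :\ v)) /=; last first.
  by move=> t /andP[_ vt]; rewrite setD1K.
rewrite -sumrN; apply: eq_big => s.
  rewrite setU11 andbT; case: (boolP (v \in s)) => vs; last by rewrite XY // setU1K // eqxx andbT.
  rewrite (contraTF (Yv v s)) ?vs //; apply/negP=> /andP[_ /eqP e].
  by have := setD11 v (v |: s); rewrite e vs.
move=> /andP[_ /eqP e]; have vs : v \notin s by rewrite -e !inE eqxx.
by rewrite cardsU1 vs add1n exprS mulN1r mulNr.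
Qed.

End Counting.

(** * Neighbourly members of Walkup's class *)

Section LesBound.
Variables (T : finType) (r : T -> nat) (F : fieldType).
Hypothesis r_inj : injective r.

Lemma betti_le_add (X X' : {set {set T}}) n : convex X -> lower_in X X' ->
  betti r F X n <= betti r F X' n + betti r F (X :\: X') n.
Proof.
move=> cv lo; have [c [_ /(_ n) [_ _ h]]] := @les _ _ r_inj F _ _ cv lo.
by rewrite -h -addnA leq_addr.
Qed.

Lemma betti_setT (x : T) n : betti r F [set: {set T}] n = 0.
Proof.
by apply: (@betti_cone _ _ r_inj F x) => [s _|s t u _ _ _ _]; rewrite !inE.
Qed.

(** In the subcomplex induced on [A] a shelling step contributes an interval starting at [beta],
    acyclic unless it is [beta] alone, which has at most [k] elements. *)
Lemma betti_restricted_ball k e l (A : {set T}) n : shelling k e l -> k < n ->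
  betti r F [set t in ball l | t \subset A] n = 0.
Proof.
move=> + kn; elim: l => [|p l IH] spl.
  by rewrite betti_small // => t; rewrite ball_nil !inE.
have [sl0 st _] := spl; have sl : shelling k e l := sl0.
have [[_ pk _] [h4 _]] := st.
have cv : convex [set t in ball (p :: l) | t \subset A].
  move=> s t u /setIdP[sb sA] _ _ ts; rewrite inE (ball_down spl sb ts).
  exact: subset_trans sA.
have lo : lower_in [set t in ball (p :: l) | t \subset A] [set t in ball l | t \subset A].
  split.
    by apply/subsetP=> t /setIdP[tb tA]; rewrite inE tA andbT ball_cons inE tb orbT.
  by move=> s t /setIdP[sb _] /setIdP[_ tA] ts; rewrite inE tA (ball_down sl sb ts).
apply/eqP; rewrite -leqn0; apply: leq_trans (betti_le_add n cv lo) _.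
rewrite IH // add0n.
have -> : [set t in ball (p :: l) | t \subset A] :\: [set t in ball l | t \subset A] =
    if p.1 \subset A then seg p.1 ((p.1 :|: p.2) :&: A) else set0.
  apply/setP=> t; rewrite in_setD 2![t \in [set _ in _ | _]]inE ball_cons in_setU.
  case: (boolP (p.1 \subset A)) => pA; last first.
    rewrite in_set0; case: (t \in ball l); rewrite ?andbT ?orbT ?orbF /= ?andNb // inE.
    by apply: contraNF pA => /andP[/andP[h _]]; apply: subset_trans h.
  rewrite !inE subsetI; case: (boolP (p.1 \subset t)) => pt; rewrite /= ?andbF.
    have -> : t \in ball l = false by apply: contraTF pt; apply: (ball_sup sl h4).
    by rewrite /= orbF.
  by rewrite andNb.
case: ifP => _; last by rewrite betti0.
rewrite (betti_seg_over F r_inj); case: (p.1 =P _) => //= <-; case: (n =P _) => // e1.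
by rewrite e1 ltnNge pk in kn.
Qed.

End LesBound.

(** * The filling of a neighbourly manifold *)

Section Manifold.
Variables (T : finType) (k e : nat) (M : {set {set T}}) (lv : T -> seq ({set T} * {set T})).
(** With [e = d - 1], facets of [M] have [e + 2] vertices, those of the filling [e + 3], and [ke]
    says d >= 2k + 2. *)
Hypotheses (k2 : 1 < k) (ke : 2 * k < e).
Hypothesis M_down : forall s t : {set T}, s \in M -> t \subset s -> t \in M.
Hypothesis M_nbly : forall t : {set T}, #|t| = k.+1 -> t \in M.
Hypothesis kT : k < #|T|.
Hypothesis lv_sh : forall v, shelling k e (lv v).
Hypothesis lv_nil : forall v, lv v <> [::].
Hypothesis lv_link : forall v (t : {set T}), (t \in bnd (lv v)) = (v \notin t) && (v |: t \in M).
Implicit Types (s t u w : {set T}).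

Let k_le : k <= e. Proof. by clear -ke; lia. Qed.

Definition filling : {set {set T}} :=
  [set t : {set T} | [forall s : {set T}, (s \subset t) && (#|s| <= k.+2) ==> (s \in M)]].
Definition interior : {set {set T}} := filling :\: M.
Local Notation D := filling.
Local Notation I := interior.

Lemma fillingP t : reflect (forall s, s \subset t -> #|s| <= k.+2 -> s \in M) (t \in D).
Proof.
rewrite inE; apply: (iffP forallP) => h s; last by apply/implyP=> /andP[]; apply: h.
by move=> h1 h2; have /implyP := h s; apply; rewrite h1.
Qed.

Lemma filling_down t s : t \in D -> s \subset t -> s \in D.
Proof. by move=> /fillingP h st; apply/fillingP=> u us; apply: h (subset_trans us st). Qed.

Lemma M_filling t : t \in M -> t \in D.
Proof. by move=> tM; apply/fillingP=> s st _; apply: M_down tM st. Qed.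

Lemma M_small t : #|t| <= k.+1 -> t \in M.
Proof.
move en: (k.+1 - #|t|) => n; elim: n t en => [|n IH] t en ht; first by apply: M_nbly; clear -en ht; lia.
have [x xt] : exists x, x \notin t.
  by apply/existsP; rewrite -negb_forall; apply/negP=> /forallP h;
     have := subset_leq_card (introT subsetP (fun x _ => h x) : [set: T] \subset t);
     rewrite cardsT; move: en kT; clear; lia.
apply: (@M_down (x |: t)); last exact: subsetUr.
by apply: IH; rewrite cardsU1 xt; move: en ht; clear; lia.
Qed.

Lemma filling_small t : #|t| <= k.+1 -> t \in D.
Proof. by move=> h; apply/M_filling/M_small. Qed.

Lemma ball_small v t : t \in ball (lv v) -> #|t| + k <= e.+1 -> t \in bnd (lv v).
Proof.
move=> tb h; rewrite inE tb andbT; apply/negP=> /(inner_size k_le (lv_sh v)).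
by rewrite leqNgt ltnS h.
Qed.

(** Only the boundary of the ball is known to be the link, so the ball might use [v] itself. But a
    single vertex of the ball is too small to be interior, hence lies in the link. *)
Lemma ball_avoid v t : t \in ball (lv v) -> v \notin t.
Proof.
move=> tb; apply/negP=> vt.
have : [set v] \in bnd (lv v).
  apply: ball_small; first by apply: ball_down (lv_sh v) tb _; rewrite sub1set.
  by rewrite cards1; move: ke; clear; lia.
by rewrite lv_link !inE eqxx.
Qed.

(** Small faces decide both inclusions: the ball is determined by its faces of size at most [k + 1]
    by [shelling_flag], and its faces of size at most [k + 2] lie on its boundary, the link of [v]
    in [M], because [2 * k < e]. *)
Lemma filling_link v t : v \notin t -> (v |: t \in D) = (t \in ball (lv v)).
Proof.
move=> vt; apply/idP/idP.
  move=> /fillingP h; apply: (shelling_flag k_le (lv_sh v) (@lv_nil v)) => s st cs.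
  have vs : v \notin s by apply: contra vt; apply: subsetP.
  have : s \in bnd (lv v) by rewrite lv_link vs h ?setUS // cardsU1 vs.
  by case/setDP.
move=> tb; apply/fillingP=> s st cs.
have sb : s :\ v \in ball (lv v).
  apply: ball_down (lv_sh v) tb _; apply/subsetP=> x; rewrite !inE => /andP[xv xs].
  by have := subsetP st x xs; rewrite !inE (negPf xv).
have : s :\ v \in bnd (lv v).
  apply: ball_small => //; have := cardsD1 v s; move: cs ke; clear; lia.
rewrite lv_link => /andP[_ h]; apply: M_down h _.
by apply/subsetP=> x xs; rewrite !inE xs andbT orbN.
Qed.

Lemma interior_link v t : v \notin t -> (v |: t \in I) = (t \in inner (lv v)).
Proof.
move=> vt; rewrite inE filling_link //.
have := lv_link v t; rewrite vt inE /= => <-.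
case: (boolP (t \in inner _)) => ti /=; first exact: inner_ball (lv_sh v) ti.
by case: (t \in ball _).
Qed.

Lemma set0_M : set0 \in M.
Proof. by apply: M_small; rewrite cards0. Qed.

Lemma interior_neq0 t : t \in I -> exists x, x \in t.
Proof.
move=> /setDP[_ nt]; apply/set0Pn; apply: contraNneq nt => ->; exact: set0_M.
Qed.

Lemma filling_rem v t : v \in t -> (t \in D) = (t :\ v \in ball (lv v)).
Proof. by move=> vt; rewrite -{1}(setD1K vt) filling_link // !inE eqxx. Qed.

Lemma interior_rem v t : v \in t -> (t \in I) = (t :\ v \in inner (lv v)).
Proof. by move=> vt; rewrite -{1}(setD1K vt) interior_link // !inE eqxx. Qed.

Lemma interior_size t : t \in I -> e.+3 <= #|t| + k.
Proof.
move=> tI; have [v vt] := interior_neq0 tI; move: tI; rewrite (interior_rem vt).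
by move/(inner_size k_le (lv_sh v)); rewrite (cardsD1 v t) vt; clear; lia.
Qed.

Lemma filling_size t : t \in D -> #|t| <= e.+3.
Proof.
have [->|[v vt]] := set_0Vmem t; first by rewrite cards0.
by rewrite (filling_rem vt) => /(ball_size (lv_sh v)); rewrite (cardsD1 v t) vt; clear; lia.
Qed.

Lemma convex_filling : convex D.
Proof. by move=> s t u sD _ _ ts; apply: filling_down sD ts. Qed.

Lemma convex_interior : convex I.
Proof.
move=> s t u /setDP[sD _] /setDP[_ nu] ut ts; rewrite inE (filling_down sD ts) andbT.
by apply: contra nu => tM; apply: M_down tM ut.
Qed.

Section WithField.
Variables (r : T -> nat) (F : fieldType).
Hypothesis r_inj : injective r.
Local Notation b := (betti r F).

Lemma over_interior v w : v \in w ->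
  over w I = [set v |: s | s in over (w :\ v) (inner (lv v))].
Proof.
move=> vw; apply/setP=> t; apply/setIdP/imsetP.
  case=> tI wt; have vt := subsetP wt v vw.
  exists (t :\ v); last by rewrite setD1K.
  by rewrite inE -interior_rem // tI setSD.
case=> s /setIdP[si ws] ->; have vs := ball_avoid (inner_ball (lv_sh v) si).
by rewrite interior_link // si -(setD1K vw) setUS.
Qed.

Lemma betti_over_interior w n : w \in D -> w != set0 -> b (over w I) n = (n == e.+3).
Proof.
move=> wD /set0Pn[v vw]; rewrite (over_interior vw).
case: n => [|n]; first by rewrite betti_small // => t /imsetP[s _ ->]; rewrite -lt0n; apply/card_gt0P; exists v; rewrite !inE eqxx.
rewrite betti_shift //; last by move=> s /setIdP[si _]; apply: ball_avoid (inner_ball (lv_sh v) si).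
by rewrite (betti_over_inner F r_inj _ _ (lv_sh v)) -filling_rem // wD.
Qed.

Lemma betti_interior_avoid w x n : x |: w \in D -> w != set0 -> x \notin w ->
  b [set t in over w I | x \notin t] n = 0.
Proof.
move=> wD /set0Pn[v vw] xw; have vx : v != x by apply: contraNneq xw => <-.
have -> : [set t in over w I | x \notin t] =
    [set v |: s | s in [set t in over (w :\ v) (inner (lv v)) | x \notin t]].
  apply/setP=> t; rewrite (over_interior vw); apply/setIdP/imsetP.
    case=> /imsetP[s sX ->] xs; exists s => //; rewrite inE sX /=.
    by apply: contra xs => xs; rewrite !inE xs orbT.
  by case=> s /setIdP[sX xs] ->; rewrite imset_f // !inE eq_sym (negPf vx).
case: n => [|n]; first by rewrite betti_small // => t /imsetP[s _ ->]; rewrite -lt0n; apply/card_gt0P; exists v; rewrite !inE eqxx.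
rewrite betti_shift //; last first.
  by move=> s /setIdP[/setIdP[si _] _]; apply: ball_avoid (inner_ball (lv_sh v) si).
apply: (betti_inner_avoid k_le F r_inj _ (lv_sh v)).
  have -> : x |: w :\ v = (x |: w) :\ v.
    by apply/setP=> y; rewrite !inE; case: (eqVneq y x) => [->|//] /=; rewrite eq_sym vx.
  by rewrite -filling_rem // !inE vw orbT.
by rewrite !inE negb_and xw orbT.
Qed.

(** Proved for all induced subcomplexes, adding one vertex at a time: a vertex contributes its link
    in the part already present, an induced subcomplex of a link ball, shifted by one degree. *)
Lemma betti_filling_high n : k.+1 < n -> b D n = 0.
Proof.
move=> kn.
have h (A : {set T}) : b [set t in D | t \subset A] n = 0.
  elim: {A}_.+1 {-2}A (ltnSn #|A|) => // N IH A hA.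
  have [->|[v vA]] := set_0Vmem A.
    rewrite betti_small // => t /setIdP[_]; rewrite subset0 => /eqP ->.
    by rewrite cards0; case: (n) kn.
  have cv : convex [set t in D | t \subset A].
    by move=> s t u /setIdP[sD sA] _ _ ts; rewrite inE (filling_down sD ts) (subset_trans ts).
  have lo : lower_in [set t in D | t \subset A] [set t in D | t \subset A :\ v].
    split.
      apply/subsetP=> t /setIdP[tD tA]; rewrite inE tD /=.
      exact: subset_trans tA (subD1set _ _).
    move=> s t /setIdP[_ sA] /setIdP[tD _] ts; rewrite inE tD.
    exact: subset_trans ts sA.
  apply/eqP; rewrite -leqn0; apply: leq_trans (betti_le_add F r_inj n cv lo) _.
  rewrite IH; last by move: hA; rewrite (cardsD1 v A) vA.
  have -> : [set t in D | t \subset A] :\: [set t in D | t \subset A :\ v] =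
      [set v |: s | s in [set t in ball (lv v) | t \subset A :\ v]].
    apply/setP=> t; rewrite in_setD 2![t \in [set _ in _ | _]]inE subsetD1.
    apply/andP/imsetP.
      case=> + /andP[tD tA]; rewrite tD tA /= negbK => vt; exists (t :\ v); last by rewrite setD1K.
      by rewrite inE -filling_rem // tD setSD.
    case=> s /setIdP[sb sA] ->; rewrite filling_link ?sb /=; last exact: ball_avoid sb.
    rewrite !inE eqxx andbF /= subUset sub1set vA; split=> //=.
    exact: subset_trans sA (subD1set _ _).
  case: (n) kn => // n1 kn; rewrite betti_shift; last first.
    by move=> s /setIdP[sb _]; apply: ball_avoid sb.
  by rewrite (betti_restricted_ball F r_inj _ (lv_sh v)).
have <- : [set t in D | t \subset [set: T]] = D.
  by apply/setP=> t; rewrite inE subsetT andbT.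
exact: h.
Qed.

Let T0 : exists x : T, true.
Proof. by have : 0 < #|T| by [apply: leq_ltn_trans kT]; case/card_gt0P=> x _; exists x. Qed.

(** Compared with the full simplex, the filling lacks only sets of more than [k + 1] vertices. *)
Lemma betti_filling_low n : n <= k -> b D n = 0.
Proof.
move=> nk; have [x _] := T0.
have cv : convex [set: {set T}] by move=> s t u; rewrite !inE.
have lo : lower_in [set: {set T}] D.
  by split; [exact: subsetT | move=> s t sD _; apply: filling_down].
rewrite (betti_acyclic_total r_inj cv lo (betti_setT F r_inj x)).
apply: betti_small => t /setDP[_ nt]; apply: contraNneq nt => ct.
by apply: filling_small; rewrite ct ltnS.
Qed.

(** * Lefschetz duality in a range, by a double complex *)

Local Notation br := (betti (dbl_rank r) F).
Let dr_inj := dbl_rank_inj r_inj.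

Definition dleft (c : {set T + T}) : {set T} := [set x | inl x \in c].
Definition dright (c : {set T + T}) : {set T} := [set x | inr x \notin c].

Lemma dcellK (c : {set T + T}) : dcell (dleft c) (dright c) = c.
Proof. by apply/setP=> -[x|x]; rewrite !inE ?negbK. Qed.
Lemma dleftK (w t : {set T}) : dleft (dcell w t) = w.
Proof. by apply/setP=> x; rewrite !inE. Qed.
Lemma drightK (w t : {set T}) : dright (dcell w t) = t.
Proof. by apply/setP=> x; rewrite !inE negbK. Qed.

Lemma dleft_sub (c c' : {set T + T}) : c \subset c' -> dleft c \subset dleft c'.
Proof. by move=> h; apply/subsetP=> x; rewrite !inE; apply: (subsetP h). Qed.
Lemma dright_sub (c c' : {set T + T}) : c \subset c' -> dright c' \subset dright c.
Proof. by move=> h; apply/subsetP=> x; rewrite !inE; apply: contra; apply: (subsetP h). Qed.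

Lemma dcell_image (w : {set T}) (X : {set {set T}}) :
  [set c | (dleft c == w) && (dright c \in X)] = [set dcell w t | t in X].
Proof.
apply/setP=> c; rewrite inE; apply/andP/imsetP.
  by case=> /eqP <- h; exists (dright c); rewrite // dcellK.
by case=> t tX ->; rewrite dleftK drightK.
Qed.

Lemma dcard (c : {set T + T}) : #|c| + #|dright c| = #|dleft c| + #|T|.
Proof. by rewrite -{1}(dcellK c) dcell_card. Qed.

Lemma dleftU x (c : {set T + T}) : dleft (inl x |: c) = x |: dleft c.
Proof. by apply/setP=> y; rewrite !inE (inj_eq (@inl_inj T)). Qed.
Lemma dleftD x (c : {set T + T}) : dleft (c :\ inl x) = dleft c :\ x.
Proof. by apply/setP=> y; rewrite !inE (inj_eq (@inl_inj T)). Qed.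
Lemma drightU x (c : {set T + T}) : dright (inl x |: c) = dright c.
Proof. by apply/setP=> y; rewrite !inE. Qed.
Lemma drightD x (c : {set T + T}) : dright (c :\ inl x) = dright c.
Proof. by apply/setP=> y; rewrite !inE. Qed.

(* The double complex of pairs w <= t with t an interior face: fibred over t
   it computes the homology of the interior, fibred over w that of the nerve
   of the cover of the interior by the stars of the vertices. *)
Definition pairs0 : {set {set T + T}} := [set c | (dleft c \subset dright c) && (dright c \in I)].
Definition pairs := pairs0 :\: [set c in pairs0 | dleft c == set0].

Lemma convex_pairs0 : convex pairs0.
Proof.
move=> s t u /setIdP[s1 s2] /setIdP[u1 u2] ut ts; rewrite inE; apply/andP; split.
  exact: subset_trans (dleft_sub ts) (subset_trans s1 (dright_sub ts)).
exact: convex_interior u2 s2 (dright_sub ts) (dright_sub ut).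
Qed.

Lemma lower_pairs : lower_in pairs0 [set c in pairs0 | dleft c == set0].
Proof.
split; first by apply/subsetP=> c /setIdP[].
move=> s t /setIdP[_ /eqP s0] tp ts; rewrite inE tp -subset0 -s0.
exact: dleft_sub.
Qed.

(** With [t] fixed, [w] runs over all subsets of [t]; this is a cone because an interior face is
    nonempty. *)
Lemma betti_pairs0 n : br pairs0 n = 0.
Proof.
pose ro (t : {set T}) := #|T| - #|t|.
have mono (s t : {set T + T}) : s \in pairs0 -> t \in pairs0 -> t \subset s ->
    dright t = dright s \/ ro (dright t) < ro (dright s).
  move=> _ _ /dright_sub; rewrite subEproper => /orP[/eqP ->|/proper_card h]; first by left.
  by right; rewrite /ro; have := max_card (dright t); move: h; clear; lia.
apply: (betti_fibre0 dr_inj convex_pairs0 mono) => t m.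
have [tI|ntI] := boolP (t \in I); last first.
  by apply: betti_small => c /setIdP[/setIdP[_ cI] /eqP e1]; rewrite e1 (negPf ntI) in cI.
have [x xt] := interior_neq0 tI.
apply: (@betti_cone _ _ dr_inj F (inl x)); last exact: (@convex_fibre _ _ dright ro _ convex_pairs0 mono).
move=> c /setIdP[/setIdP[c1 c2] /eqP c3].
rewrite ![_ \in fibre _ _ _]inE ![_ \in pairs0]inE dleftU dleftD drightU drightD c3 tI eqxx !andbT.
rewrite c3 in c1; split; first by rewrite subUset sub1set xt.
exact: subset_trans (subD1set _ _) c1.
Qed.

Lemma convex_pairs : convex pairs.
Proof.
move=> s t u /setDP[sp _] /setDP[up nu] ut ts; apply/setDP; split.
  exact: convex_pairs0 sp up ut ts.
apply: contra nu => tp; exact: (proj2 lower_pairs) tp up ut.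
Qed.

(** The pairs with empty [w] form a dual copy of the interior inside an acyclic complex, so the
    remaining pairs have the same Betti numbers one degree higher. *)
Lemma betti_interior_pairs n m : n + m = #|T| -> b I n = br pairs m.+1.
Proof.
move=> nm; rewrite -(betti_acyclic_total dr_inj convex_pairs0 lower_pairs betti_pairs0).
have -> : [set c in pairs0 | dleft c == set0] = [set dcell set0 t | t in I].
  rewrite -dcell_image; apply/setP=> c; rewrite !inE.
  by case: eqP => [->|_]; rewrite ?sub0set ?andbT ?andbF.
by rewrite (betti_dcell r F _ (n := n)) // cards0.
Qed.

(** Counting [w] without [x] lets [x] be toggled in [w], while [w] together with [x] stays within
    the [k + 1] vertices that always span a face. *)
Definition low_pairs (x : T) := [set c in pairs | #|dleft c :\ x| <= k].

Lemma in_pairs (c : {set T + T}) : (c \in pairs) = [&& dleft c != set0, dleft c \subset dright c & dright c \in I].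
Proof.
rewrite in_setD in_set; case: (boolP (c \in pairs0)) => h.
  by move: h; rewrite inE => /andP[-> ->]; rewrite !andbT.
by move: h; rewrite inE => /negPf ->; rewrite !andbF.
Qed.

Lemma lower_low x : lower_in pairs (low_pairs x).
Proof.
split; first by apply/subsetP=> c /setIdP[].
move=> s t /setIdP[_ cs] tp ts; rewrite inE tp.
by apply: leq_trans cs; apply/subset_leq_card/setSD/dleft_sub.
Qed.

Lemma convex_low x : convex (low_pairs x).
Proof.
move=> s t u sl /setIdP[up _] ut ts; apply: (proj2 (lower_low x) _ _ sl _ ts).
by case/setIdP: sl => sp _; apply: convex_pairs sp up ut ts.
Qed.

(** The fibre over the empty set has [w = [set x]] and yields the star of [x]. In a fibre over a
    nonempty [u] the cells with [x] in [t] form a cone, by toggling [x] in [w]; the others have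
    [w = u] and [t] avoiding [x], and are acyclic because [x |: u] lies in the filling. *)
Lemma betti_low x n : br (low_pairs x) n = (n + e.+3 == #|T|.+1).
Proof.
have mono (s t : {set T + T}) : s \in low_pairs x -> t \in low_pairs x -> t \subset s ->
    dleft t :\ x = dleft s :\ x \/ #|dleft t :\ x| < #|dleft s :\ x|.
  move=> _ _ ts; have := setSD [set x] (dleft_sub ts).
  by rewrite subEproper => /orP[/eqP ->|/proper_card h]; [left|right].
have f0 m : br (fibre (fun c => dleft c :\ x) (low_pairs x) set0) m = (m + e.+3 == #|T|.+1).
  have -> : fibre (fun c => dleft c :\ x) (low_pairs x) set0 =
      [set dcell [set x] t | t in over [set x] I].
    rewrite -dcell_image; apply/setP=> c.
    rewrite [c \in fibre _ _ _]inE [c \in low_pairs _]inE in_pairs [RHS]inE [dright c \in over _ _]inE.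
    case: (eqVneq (dleft c) [set x]) => [->|ne] /=.
      have -> : ([set x] != set0) by apply/set0Pn; exists x; rewrite inE.
      by rewrite setDv cards0 leq0n eqxx !andbT /= andbC.
    apply/negP=> /andP[/andP[/and3P[/set0Pn[y yc] _ _] _]]; rewrite setD_eq0 subset1 (negPf ne) /=.
    by move/eqP=> c0; rewrite c0 inE in yc.
  have [hm|hm] := leqP m #|T|.+1.
    rewrite (betti_dcell r F _ (n := #|T|.+1 - m)); last by rewrite cards1 subnK.
    rewrite betti_over_interior; [|apply: filling_small; by rewrite cards1|by apply/set0Pn; exists x; rewrite inE].
    by congr nat_of_bool; apply/eqP/eqP; move: hm; clear; lia.
  rewrite betti_small; last first.
    move=> c /imsetP[t _ ->]; have := dcell_card [set x] t; rewrite cards1 add1n => h.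
    by apply: contraTneq hm => <-; rewrite -leqNgt -h leq_addr.
  by case: eqP => //; move: hm; clear; lia.
have f1 u m : u != set0 -> br (fibre (fun c => dleft c :\ x) (low_pairs x) u) m = 0.
  move=> u0; have [xu|xu] := boolP (x \in u).
    apply: betti_small => c /setIdP[_ /eqP cu].
    by move: xu; rewrite -cu !inE eqxx.
  have [uk|uk] := leqP #|u| k; last first.
    apply: betti_small => c /setIdP[/setIdP[_ ck] /eqP cu].
    by rewrite cu leqNgt uk in ck.
  set X := fibre _ _ _.
  have cv : convex X := @convex_fibre _ _ (fun c => dleft c :\ x) (fun u : {set T} => #|u|) _ (@convex_low x) mono u.
  have inX c : (c \in X) = [&& dleft c :\ x == u, dleft c \subset dright c & dright c \in I].
    rewrite /X [c \in fibre _ _ _]inE [c \in low_pairs _]inE in_pairs.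
    case: (dleft c :\ x =P u) => [cu|_]; last by rewrite andbF.
    rewrite cu uk !andbT /=; suff -> : dleft c != set0 by [].
    by apply: contraNneq u0 => c0; rewrite -cu c0 set0D.
  have lo : lower_in X [set c in X | x \in dright c].
    split; first by apply/subsetP=> c /setIdP[].
    by move=> s t /setIdP[_ xs] tX ts; rewrite inE tX; apply: subsetP (dright_sub ts) _ xs.
  have xD : x |: u \in D by apply: filling_small; rewrite cardsU1 xu.
  have e1 : [set c in X | x \notin dright c] = [set dcell u t | t in [set t in over u I | x \notin t]].
    rewrite -dcell_image; apply/setP=> c; rewrite inE inX [RHS]inE [dright c \in [set _ in _ | _]]inE.
    rewrite [dright c \in over _ _]inE.
    have [xr|xr] := boolP (x \in dright c); rewrite ?andbF //= !andbT.
    have [cs|ncs] := boolP (dleft c \subset dright c).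
      have -> : dleft c :\ x = dleft c.
        apply/setDidPl; rewrite disjoints_subset; apply/subsetP=> y yc; rewrite !inE.
        by apply: contraNneq xr => <-; apply: subsetP cs _ yc.
      by case: eqP => [<-|//] /=; rewrite cs andbT.
    rewrite andbF; apply/esym/negP=> /andP[/eqP ec /andP[_ h]].
    by rewrite ec h in ncs.
  have e2 : X :\: [set c in X | x \in dright c] = [set c in X | x \notin dright c].
    by apply/setP=> c; rewrite in_setD 2![c \in [set _ in _ | _]]inE; case: (c \in X); rewrite ?andbF ?andbT.
  rewrite (betti_acyclic_quot dr_inj cv lo) => [|n1].
    apply: (@betti_cone _ _ dr_inj F (inl x)) => [c|s t w].
      case/setIdP; rewrite inX => /and3P[/eqP c1 c2 c3] xc.
      split; apply/setIdP; rewrite inX ?dleftU ?dleftD ?drightU ?drightD; split=> //; rewrite c3 andbT.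
        rewrite subUset sub1set xc c2 /= andbT -c1; apply/eqP/setP=> y; rewrite !inE.
        by case: eqP.
      rewrite (subset_trans (subD1set _ _) c2) andbT -c1; apply/eqP/setP=> y; rewrite !inE.
      by case: eqP.
    move=> /setIdP[sX xs] /setIdP[wX xw] wt ts; rewrite inE (cv s t w) //.
    by apply: subsetP (dright_sub ts) _ xs.
  rewrite e2 e1; have [hm|hm] := leqP n1 (#|u| + #|T|).
    by rewrite (betti_dcell r F _ (n := #|u| + #|T| - n1)) ?subnK // betti_interior_avoid.
  apply: betti_small => c /imsetP[t _ ->]; have h := dcell_card u t.
  by apply: contraTneq hm => <-; rewrite -leqNgt -h leq_addr.
have sE m : \sum_u br (fibre (fun c => dleft c :\ x) (low_pairs x) u) m = (m + e.+3 == #|T|.+1).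
  by rewrite (bigD1 set0) //= f0 big1 ?addn0 // => u u0; rewrite f1.
rewrite -sE; apply: (@betti_fibre _ _ dr_inj F _ (fun c => dleft c :\ x) (fun u : {set T} => #|u|) _ (@convex_low x) mono n).
move=> m; case: (m + e.+3 =P #|T|.+1) => h1; [right; apply: (etrans (sE m.+1))|left; apply: (etrans (sE m))].
  by rewrite addSn h1; case: eqP => // /esym/n_Sn.
by case: eqP.
Qed.

Lemma card_vertices : e.+3 <= #|T|.
Proof.
have [v _] := T0; have : set0 \in ball (lv v).
  by rewrite -filling_link ?in_set0 // filling_small // cardsU1 cards0 inE.
move/(ball_pure (lv_sh v)) => [s [sb cs _]].
by have := max_card (v |: s); rewrite cardsU1 (ball_avoid sb) cs.
Qed.

(** Outside [low_pairs] the set [w] has more than [k] elements and [t] at most [e + 3], so such a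
    cell is too large to matter in these degrees. *)
Lemma betti_pairs m j : m + e.+3 = #|T|.+1 + j -> j < k -> br pairs m = (j == 0).
Proof.
move=> hm jk; have [x _] := T0.
have [c [_ hc]] := @les _ _ dr_inj F _ _ convex_pairs (lower_low x).
have Q0 i : i + e.+3 <= #|T| + k -> br (pairs :\: low_pairs x) i = 0.
  move=> hi; apply: betti_small => a /setDP[ap na]; apply: contraTneq hi => <-.
  have kl : k < #|dleft a|.
    move: na; rewrite inE ap -ltnNge => h; apply: leq_trans h _.
    exact/subset_leq_card/subD1set.
  move: ap; rewrite in_pairs => /and3P[_ _ /setDP[/filling_size h _]].
  have aux x1 x2 x3 x4 x5 x6 : x1 + x2 = x3 + x4 -> x2 <= x5 -> x6 < x3 -> ~~ (x1 + x5 <= x4 + x6).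
    by clear; lia.
  exact: aux (dcard a) h kl.
have cm : c m = 0 by have [+ _ _] := hc m; rewrite Q0 ?hm; [clear; lia | move: jk; clear; lia].
have [_ _] := hc m; rewrite cm Q0; last by move: hm jk; clear; lia.
rewrite betti_low; case: (eqVneq j 0) => [j0|j0].
  have -> : c m.+1 = 0.
    by have [+ _ _] := hc m.+1; rewrite Q0; [clear; lia | move: hm j0 k2; clear; lia].
  by rewrite hm j0 !addn0 eqxx.
by rewrite hm -[X in _ == X]addn0 eqn_add2l (negPf j0); clear; lia.
Qed.

Lemma betti_interior n j : n + j = e.+3 -> j < k -> b I n = (j == 0).
Proof.
move=> nj jk; rewrite (@betti_interior_pairs _ (#|T| - n)).
  by apply: betti_pairs jk; have := card_vertices; move: nj; clear; lia.
by have := card_vertices; move: nj; clear; lia.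
Qed.

Lemma betti_interior0 n : n != e.+3 -> n != e.+3 - k -> b I n = 0.
Proof.
move=> n1 n2; have [h|h] := leqP n (e.+3 - k).
  apply: betti_small => t /interior_size ht; apply: contraNneq n2 => ct.
  by apply/eqP; move: ht h; rewrite ct; clear; lia.
have [h'|h'] := leqP n e.+3.
  rewrite (@betti_interior n (e.+3 - n)); [|by rewrite subnKC|by move: h h'; clear; lia].
  by rewrite subn_eq0 leqNgt ltn_neqAle n1 h'.
apply: betti_small => t /setDP[/filling_size ht _]; apply: contraTneq ht => ->.
by rewrite -ltnNge.
Qed.

Lemma M_size t : t \in M -> #|t| <= e.+2.
Proof.
have [->|[v vt]] := set_0Vmem t; first by rewrite cards0.
move=> tM; have : t :\ v \in bnd (lv v) by rewrite lv_link setD1K // tM !inE eqxx.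
by move/(bnd_size (lv_sh v)); rewrite (cardsD1 v t) vt.
Qed.

(** The long exact sequence of the filling modulo [M]. Both connecting maps are injective, since the
    filling has homology only in size [k + 1], which [2 * k < e] keeps away from the sizes of the
    interior classes. *)
Lemma les_arith (bD bI bM c : nat -> nat) : (forall n, n != k.+1 -> bD n = 0) ->
  (forall n, n != e.+3 -> n != e.+3 - k -> bI n = 0) -> bI e.+3 = 1 ->
  (forall n, e.+2 < n -> bM n = 0) ->
  (forall n, c n <= bI n /\ bD n + c n + c n.+1 = bM n + bI n) ->
  forall n, bM n = (n == k.+1) * bD k.+1 + (n == e.+2 - k) * bI (e.+3 - k) + (n == e.+2).
Proof.
move: k2 ke; clear => k2 ke hD hI I1 hM hc.
have c0 n : n != e.+3 -> n != e.+3 - k -> c n = 0.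
  by move=> h1 h2; have [+ _] := hc n; rewrite hI //; lia.
have c1 : c e.+3 = 1.
  by have [_] := hc e.+3; rewrite hM // I1 hD ?(c0 e.+4); lia.
have cg : c (e.+3 - k) = bI (e.+3 - k) /\ bM (e.+3 - k) = 0.
  by have [+] := hc (e.+3 - k); rewrite hD ?(c0 (e.+3 - k).+1); lia.
move=> n; have [_] := hc n.
case: (eqVneq n e.+3) => [->|n1].
  by rewrite hM; lia.
case: (eqVneq n (e.+3 - k)) => [->|n2].
  by have [_ ->] := cg; lia.
rewrite (c0 n) // hI //.
case: (eqVneq n e.+2) => [->|n3].
  by rewrite c1 hD; lia.
case: (eqVneq n (e.+2 - k)) => [e1|n4].
  have -> : n.+1 = e.+3 - k by lia.
  have [-> _] := cg; rewrite hD; lia.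
rewrite c0; [|lia|lia].
by case: (eqVneq n k.+1) => [->|n5]; [lia | rewrite hD //; lia].
Qed.

Lemma betti_M n : b M n = (n == k.+1) * b D k.+1 + (n == e.+2 - k) * b I (e.+3 - k) + (n == e.+2).
Proof.
have lo : lower_in D M.
  by split; [apply/subsetP=> t; apply: M_filling | move=> s t sM _; apply: M_down].
have [c [_ hc]] := @les _ _ r_inj F _ _ convex_filling lo.
apply: (les_arith (bD := b D) (bI := b I) (c := c)).
- move=> m hm; have [h|h] := ltnP k.+1 m; first exact: betti_filling_high.
  by apply: betti_filling_low; rewrite -ltnS ltn_neqAle hm.
- exact: betti_interior0.
- by rewrite (@betti_interior e.+3 0) ?addn0 // (leq_trans _ k2).
- move=> m hm; apply: betti_small => t /M_size ht; apply: contraTneq ht => ->.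
  by rewrite -ltnNge.
- by move=> m; have [h1 _ h2] := hc m.
Qed.

(** * Euler characteristics and the formula for the Betti number *)

Local Open Scope ring_scope.

Lemma euler_filling : \sum_(t in D) (-1) ^+ #|t| = (-1) ^+ k.+1 * (b D k.+1)%:R :> int.
Proof.
have kE : (k.+1 < e.+4)%N by move: ke; clear; lia.
rewrite -(@betti_euler _ _ r_inj F _ e.+4 convex_filling); last by move=> t /filling_size.
rewrite (bigD1 (Ordinal kE)) //= big1 ?addr0 // => i.
rewrite -val_eqE /= => ik; suff -> : b D i = 0%N by rewrite mulr0.
have [h|h] := ltnP k.+1 i; first exact: betti_filling_high.
by apply: betti_filling_low; rewrite -ltnS ltn_neqAle ik.
Qed.

Lemma euler_interior : \sum_(t in I) (-1) ^+ #|t| =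
  (-1) ^+ e.+3 + (-1) ^+ (e.+3 - k)%N * (b I (e.+3 - k)%N)%:R :> int.
Proof.
have kE : (e.+3 - k < e.+4)%N by clear; lia.
rewrite -(@betti_euler _ _ r_inj F _ e.+4 convex_interior); last by move=> t /setDP[/filling_size].
rewrite (bigD1 (@Ordinal e.+4 e.+3 (ltnSn _))) //= (bigD1 (Ordinal kE)) /=; last first.
  by rewrite -val_eqE /=; move: k2 ke; clear; lia.
rewrite [X in _ + (_ + X)]big1 => [|i].
  rewrite [X in _ + X = _]addr0; congr (_ + _).
  have e1 : b I e.+3 = 1%N by apply: (@betti_interior e.+3 0); rewrite ?addn0 // (leq_trans _ k2).
  by rewrite e1 mulr1.
rewrite -!val_eqE /= => /andP[i1 i2]; suff -> : b I i = 0%N by rewrite mulr0.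
exact: betti_interior0.
Qed.

(** A facet of the filling has [e + 3] vertices, so this counts the vertices outside one. *)
Local Notation A := (#|T| - e.+3)%N.

Lemma link_face_count v n : (n <= k)%N ->
  (\sum_(t in ball (lv v)) (#|t| == n : nat) = 'C(A + e.+2, n))%N.
Proof.
move=> nk; have -> : (A + e.+2 = #|[set~ v]|)%N.
  by rewrite cardsC1; have := card_vertices; clear; lia.
rewrite -cards_draws -sum1_card [RHS]big_mkcond /= big_mkcond /=; apply: eq_bigr => t _.
rewrite inE subsetC sub1set inE; case: (eqVneq #|t| n) => [ct|nt]; last by rewrite andbF; case: ifP.
rewrite andbT; suff -> : (t \in ball (lv v)) = (v \notin t) by case: (v \in t).
apply/idP/idP; first exact: ball_avoid.
by move=> vt; rewrite -filling_link // filling_small // cardsU1 vt ct.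
Qed.

(** By neighbourliness every set of at most [k] other vertices is a face of the link ball, which
    fixes its low face numbers. They determine the h-vector, and [vandermonde_like] verifies the
    solution. *)
Lemma link_hnum v j : (j <= k)%N -> hnum (lv v) j = 'C((A + j).-1, j).
Proof.
move: j; apply: (@triangular_unique k e.+2) => n nk.
rewrite vandermonde_like; last by move: ke nk; clear; lia.
rewrite -(link_face_count v nk) (sum_ball _ (lv_sh v)).
transitivity (\sum_(p <- lv v) seg_count #|p.1| (e.+2 - #|p.1|) n)%N; last first.
  rewrite big_seq [RHS]big_seq; apply: eq_bigr => p pl.
  by have [_ <- _] := shelling_steps (lv_sh v) pl; rewrite card_seg // subsetUl.
rewrite (sum_hnum (fun j => seg_count j (e.+2 - j) n) (lv_sh v)).
rewrite (big_ord_widen k.+1 (fun j => hnum (lv v) j * 'C(e.+2 - j, n - j))%N) ?ltnS //.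
rewrite big_mkcond /=; apply: eq_bigr => j _; rewrite /seg_count ltnS.
by case: (_ <= _)%N; rewrite ?mul0rn // mulnC; elim: (hnum _ _) => [|h IH]; rewrite ?muln0 // mulnS mulrS IH.
Qed.

Let X : rat := \sum_(j < k.+1) 'C((A + j)%N.-1, j)%:R * seg_weight j (e.+2 - j)%N.

Lemma sum_ball_link v : \sum_(t in ball (lv v)) (-1) ^+ #|t| / #|t|.+1%:R = X.
Proof.
rewrite (sum_ball _ (lv_sh v)).
transitivity (\sum_(p <- lv v) seg_weight #|p.1| (e.+2 - #|p.1|)).
  rewrite big_seq [RHS]big_seq; apply: eq_bigr => p pl.
  by have [_ <- _] := shelling_steps (lv_sh v) pl; rewrite sum_seg_weight // subsetUl.
rewrite (sum_hnum (fun j => seg_weight j (e.+2 - j)) (lv_sh v)).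
by apply: eq_bigr => j _; rewrite link_hnum ?mulr_natl // -ltnS.
Qed.

(** The intervals of the interior start at [alpha] instead of [beta], and [seg_weight] is symmetric
    up to sign in its two arguments. *)
Lemma sum_inner_link v : \sum_(t in inner (lv v)) (-1) ^+ #|t| / #|t|.+1%:R = (-1) ^+ e.+2 * X.
Proof.
rewrite (sum_inner _ (lv_sh v)).
transitivity (\sum_(p <- lv v) (-1) ^+ e.+2 * seg_weight #|p.1| (e.+2 - #|p.1|)).
  rewrite big_seq [RHS]big_seq; apply: eq_bigr => p pl.
  have [pk c1 c2] := shelling_steps (lv_sh v) pl; rewrite sum_seg_weight ?subsetUr // c1 -c2 c1.
  have pe : (#|p.1| <= e.+2)%N by apply: leq_trans pk _; move: k_le; clear; lia.
  have sg : (-1) ^+ (e.+2 - #|p.1|)%N = (-1) ^+ e.+2 * (-1) ^+ #|p.1| :> rat.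
    by rewrite -signr_odd oddB // signr_addb !signr_odd.
  by rewrite subKn // /seg_weight subnK // subnKC // sg mulnC !mulrA.
rewrite -mulr_sumr -(sum_ball_link v) (sum_ball _ (lv_sh v)); congr (_ * _).
rewrite big_seq [RHS]big_seq; apply: eq_bigr => p pl.
by have [_ <- _] := shelling_steps (lv_sh v) pl; rewrite sum_seg_weight // subsetUl.
Qed.

Let signs : \sum_(t in D) (-1) ^+ #|t| = 1 - #|T|%:R * X :> rat.
Proof.
rewrite (bigD1 set0) /=; last by rewrite filling_small // cards0.
rewrite cards0 expr0; congr (_ + _).
rewrite (eq_bigl (fun t => t \in D :\ set0)); last by move=> t; rewrite in_setD1 andbC.
rewrite (sum_by_vertices (Y := fun v => ball (lv v))).
- by rewrite (eq_bigr (fun=> X)) => [|v _]; rewrite ?sum_ball_link // sumr_const mulr_natl.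
- by rewrite !inE eqxx.
- by move=> v s; apply: ball_avoid.
move=> v s vs; rewrite in_setD1 filling_link //.
by rewrite (_ : v |: s != set0) //; apply/set0Pn; exists v; rewrite setU11.
Qed.

Let signsI : \sum_(t in I) (-1) ^+ #|t| = - (#|T|%:R * ((-1) ^+ e.+2 * X)) :> rat.
Proof.
rewrite (sum_by_vertices (Y := fun v => inner (lv v))).
- by rewrite (eq_bigr (fun=> (-1) ^+ e.+2 * X)) => [|v _]; rewrite ?sum_inner_link // sumr_const mulr_natl.
- by rewrite inE set0_M.
- by move=> v s si; apply: ball_avoid (inner_ball (lv_sh v) si).
- by move=> v s vs; apply: interior_link.
Qed.

Lemma betti_filling_formula :
  (b D k.+1)%:R = 'C(A + k, k.+1)%:R / 'C(e.+3, k.+1)%:R :> rat.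
Proof.
have /(congr1 (fun z : int => z%:~R : rat)) := euler_filling.
rewrite rmorph_sum rmorphM rmorph_nat rmorphXn /= rmorphN1.
rewrite (eq_bigr (fun t : {set T} => (-1) ^+ #|t|)); last by move=> t _; rewrite rmorphXn /= rmorphN1.
rewrite signs; have -> : #|T| = (A + e.+2).+1%N by have := card_vertices; clear; lia.
have /(telescope_weights A) : (k <= e.+2)%N by move: k_le; clear; lia.
have -> : ((A + e.+2).+1 - e.+3)%N = A by clear; lia.
rewrite -/X => ->; rewrite -mulrA => /(mulfI _) ->; last by rewrite expf_eq0 andbF.
by [].
Qed.

(** The alternating face counts of the filling and of its interior involve the same sum [X].
    Eliminating it equates the two unknown Betti numbers; this replaces duality in codimension
    [k]. *)
Lemma betti_interior_formula : b I (e.+3 - k)%N = b D k.+1.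
Proof.
have /(congr1 (fun z : int => z%:~R : rat)) := euler_filling.
rewrite rmorph_sum rmorphM rmorph_nat rmorphXn /= rmorphN1.
rewrite (eq_bigr (fun t : {set T} => (-1) ^+ #|t|)); last by move=> t _; rewrite rmorphXn /= rmorphN1.
rewrite signs => e1.
have /(congr1 (fun z : int => z%:~R : rat)) := euler_interior.
have cst (n : nat) : ((n%:R : int)%:~R = n%:R :> rat) by rewrite rmorph_nat.
rewrite rmorph_sum intrD [X in _ = _ + X -> _]intrM cst !rmorphXn /= !rmorphN1.
rewrite (eq_bigr (fun t : {set T} => (-1) ^+ #|t|)); last by move=> t _; rewrite rmorphXn /= rmorphN1.
rewrite signsI.
have -> : #|T|%:R * ((-1) ^+ e.+2 * X) = (-1) ^+ e.+2 * (1 + (-1) ^+ k * (b D k.+1)%:R).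
  by rewrite mulrCA -[#|T|%:R * X](subKr 1) e1 [(-1) ^+ k.+1]exprS mulN1r mulNr opprK.
have kE : (k <= e.+3)%N by move: k_le; clear; lia.
have -> : (-1) ^+ (e.+3 - k)%N = (-1) ^+ e.+3 * (-1) ^+ k :> rat.
  by rewrite -signr_odd oddB // signr_addb !signr_odd.
have s0 m : (-1) ^+ m != 0 :> rat by rewrite expf_eq0 andbF.
have rr (u v n : rat) : -1 * u + -1 * u * v * n = - (u * (1 + v * n)) by ring.
rewrite [(-1) ^+ e.+3]exprS rr => /oppr_inj /(mulfI (s0 _)) /addrI /(mulfI (s0 _)).
by move/eqP; rewrite eqr_nat => /eqP ->.
Qed.

End WithField.
End Manifold.

(** * The product of two boundaries of simplices *)

Section Grid.
Variables (a b : nat).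
Local Notation T := ('I_a.+1 * 'I_b.+1)%type.
Implicit Types (p q : T) (c s t e : {set T}).

Definition grid_le p q := (p.1 <= q.1)%N && (p.2 <= q.2)%N.
Definition grid_cmp p q := grid_le p q || grid_le q p.
Definition grid_chain c := [forall p in c, forall q in c, grid_cmp p q].

Definition grid_prod : {set {set T}} :=
  [set c : {set T} | [&& grid_chain c, fst @: c != setT & snd @: c != setT]].

Lemma grid_chainP c : reflect {in c &, forall p q, grid_cmp p q} (grid_chain c).
Proof.
apply: (iffP forall_inP) => h p; first by move=> q pc qc; have /forall_inP := h p pc; apply.
by move=> pc; apply/forall_inP=> q; apply: h.
Qed.

Lemma grid_cmp_refl p : grid_cmp p p. Proof. by rewrite /grid_cmp /grid_le !leqnn. Qed.
Lemma grid_cmp_sym p q : grid_cmp p q = grid_cmp q p. Proof. exact: orbC. Qed.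

Lemma grid_chain_sub s t : grid_chain s -> t \subset s -> grid_chain t.
Proof.
move=> /grid_chainP h /subsetP ts; apply/grid_chainP=> p q /ts ps /ts qs; exact: h.
Qed.

Lemma grid_chainU1 p c : grid_chain c -> (forall q, q \in c -> grid_cmp p q) -> grid_chain (p |: c).
Proof.
move=> /grid_chainP h hp; apply/grid_chainP=> x y /setU1P[->|xc] /setU1P[->|yc].
- exact: grid_cmp_refl.
- exact: hp.
- by rewrite grid_cmp_sym hp.
- exact: h.
Qed.

Lemma imset_neqT (I J : finType) (f : I -> J) (s t : {set I}) : t \subset s -> f @: s != setT -> f @: t != setT.
Proof.
by move=> ts; apply: contraNneq => e; rewrite -subTset -e imsetS.
Qed.

Lemma grid_prod_down s t : s \in grid_prod -> t \subset s -> t \in grid_prod.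
Proof.
rewrite !inE => /and3P[h1 h2 h3] ts; rewrite (grid_chain_sub h1 ts).
by rewrite !(imset_neqT ts).
Qed.

Lemma imset_U1_mem (I J : finType) (f : I -> J) x y (s : {set I}) : y \in s -> f y = f x ->
  f @: (x |: s) = f @: s.
Proof.
by move=> ys e; rewrite imsetU1; apply/setUidPr; rewrite sub1set -e imset_f.
Qed.

Lemma imset_D1_mem (I J : finType) (f : I -> J) x y (s : {set I}) : y \in s -> y != x -> f y = f x ->
  f @: (s :\ x) = f @: s.
Proof.
move=> ys yx e; have [xs|nxs] := boolP (x \in s); last by rewrite (setDidPl _) // disjoint_sym disjoints1.
by rewrite -[in RHS](setD1K xs) (imset_U1_mem _ e) // in_setD1 yx.
Qed.

(** For a corner this is the monotone lattice path that turns at [(x0, y0)], in the grid without the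
    points having a zero coordinate. *)
Definition corner_facet (x0 : 'I_a.+1) (y0 : 'I_b.+1) : {set T} :=
  [set p : T | [&& p.1 != ord0, p.2 != ord0 & (p.1 == x0) || (p.2 == y0)]].

Variables (a2 : 1 < a) (b2 : 1 < b).

(** The points [(1, b)] and [(a, 1)]. They give two facets: one is glued to the sum built so far,
    the other is left open for the next summand. *)
Definition corner x0 y0 := [/\ x0 != ord0 :> 'I_a.+1, y0 != ord0 :> 'I_b.+1 &
  (x0 = 1%N :> nat /\ y0 = b :> nat) \/ (x0 = a :> nat /\ y0 = 1%N :> nat)].

Lemma corner_cmp x0 y0 p : corner x0 y0 -> p.1 != ord0 -> p.2 != ord0 ->
  grid_cmp p (x0, y0) = (p.1 == x0) || (p.2 == y0).
Proof.
case=> _ _; case: p => x y /=; rewrite -!val_eqE /= /grid_cmp /grid_le /= => h.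
have := ltn_ord x; have := ltn_ord y; move: h; clear; lia.
Qed.

Lemma corner_facet_prod x0 y0 : corner x0 y0 -> corner_facet x0 y0 \in grid_prod.
Proof.
move=> hc; have [hx hy hxy] := hc; rewrite inE; apply/and3P; split.
- apply/grid_chainP=> -[x y] [x' y']; rewrite !inE /= -!val_eqE /= /grid_cmp /grid_le /=.
  move: (ltn_ord x) (ltn_ord y) (ltn_ord x') (ltn_ord y') hxy; clear; lia.
- apply/eqP=> /setP /(_ ord0); rewrite !inE => /imsetP[p]; rewrite inE => /and3P[+ _ _] e.
  by rewrite -e eqxx.
- apply/eqP=> /setP /(_ ord0); rewrite !inE => /imsetP[p]; rewrite inE => /and3P[_ + _] e.
  by rewrite -e eqxx.
Qed.

Lemma corner_fst x0 y0 : corner x0 y0 -> fst @: corner_facet x0 y0 = [set~ ord0].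
Proof.
move=> [hx hy _]; apply/setP=> x; rewrite !inE; apply/imsetP/idP.
  by case=> p; rewrite inE => /and3P[h _ _] ->.
by move=> h; exists (x, y0); rewrite // inE /= h hy eqxx orbT.
Qed.

Lemma corner_snd x0 y0 : corner x0 y0 -> snd @: corner_facet x0 y0 = [set~ ord0].
Proof.
move=> [hx hy _]; apply/setP=> y; rewrite !inE; apply/imsetP/idP.
  by case=> p; rewrite inE => /and3P[_ h _] ->.
by move=> h; exists (x0, y); rewrite // inE /= hx h eqxx.
Qed.

Lemma setC0_sub n (A : {set 'I_n.+1}) : [set~ ord0] \subset A -> A != setT -> A = [set~ ord0].
Proof.
move=> h nT; apply/eqP; rewrite eqEsubset h andbT; apply/subsetP=> x xA; rewrite !inE.
apply: contraNneq nT => x0; rewrite -subTset; apply/subsetP=> y _.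
by case: (eqVneq y ord0) => [->|ny]; rewrite -?x0 // (subsetP h) // !inE.
Qed.

(** Both projections are already maximal proper subsets, and a point comparable with the turning
    point lies on the path. *)
Lemma corner_max x0 y0 c : corner x0 y0 -> c \in grid_prod -> corner_facet x0 y0 \subset c ->
  c = corner_facet x0 y0.
Proof.
move=> hc; have [hx hy hxy] := hc; rewrite inE => /and3P[/grid_chainP h1 h2 h3] sc.
have e1 : fst @: c = [set~ ord0] by apply: setC0_sub h2; rewrite -(corner_fst hc) imsetS.
have e2 : snd @: c = [set~ ord0] by apply: setC0_sub h3; rewrite -(corner_snd hc) imsetS.
apply/eqP; rewrite eqEsubset sc andbT; apply/subsetP=> p pc; rewrite inE.
have p1 : p.1 != ord0 by have := imset_f fst pc; rewrite e1 !inE.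
have p2 : p.2 != ord0 by have := imset_f snd pc; rewrite e2 !inE.
rewrite p1 p2 -(corner_cmp hc) // h1 // (subsetP sc) // inE /= hx hy eqxx.
by [].
Qed.

Lemma card_corner_facet x0 y0 : corner x0 y0 -> #|corner_facet x0 y0| = (a + b).-1.
Proof.
move=> [hx hy _].
have -> : corner_facet x0 y0 = setX [set x0] [set~ ord0] :|: setX ([set~ ord0] :\ x0) [set y0].
  apply/setP=> -[x y]; rewrite !inE /=.
  case: (eqVneq x x0) => [->|_]; first by rewrite hx /= orbF andbT.
  by case: (eqVneq y y0) => [->|_]; rewrite ?hy ?andbT ?andbF.
rewrite cardsU (_ : _ :&: _ = set0) ?cards0 ?subn0.
  have := cardsD1 x0 [set~ ord0]; rewrite !cardsX !cards1 !cardsC1 !card_ord !inE hx /=.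
  by move: a2 b2; clear; lia.
by apply/setP=> -[x y]; rewrite !inE /=; case: (x == x0); rewrite ?andbF ?andFb.

Qed.

Let i1 : 'I_a.+1 := inord 1.
Let j1 : 'I_b.+1 := inord 1.
Let i1E : i1 = 1%N :> nat. Proof. by rewrite inordK //; move: a2; clear; lia. Qed.
Let j1E : j1 = 1%N :> nat. Proof. by rewrite inordK //; move: b2; clear; lia. Qed.

Definition facet1 := corner_facet i1 ord_max.
Definition facet2 := corner_facet ord_max j1.

Lemma corner1 : corner i1 ord_max.
Proof. by split; rewrite -?val_eqE /= ?i1E //; [move: b2; clear; lia | left]. Qed.

Lemma corner2 : corner ord_max j1.
Proof. by split; rewrite -?val_eqE /= ?j1E //; [move: a2; clear; lia | right]. Qed.

Lemma facet12 : facet1 != facet2.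
Proof.
apply/eqP=> /setP /(_ (i1, inord 2)); rewrite !inE /= eqxx -!val_eqE /= i1E j1E inordK; last by lia.
by move: a2 b2; clear; lia.
Qed.

End Grid.

(** * Betti numbers of the product of two spheres without a facet *)

Section GridBetti.
Variables (F : fieldType).

(** The chains for which adding [(0, 0)] would fill the first factor but not the second. *)
Definition row_class a b : {set {set 'I_a.+1 * 'I_b.+1}} :=
  [set c : {set 'I_a.+1 * 'I_b.+1} |
    [&& grid_chain c, fst @: c == [set~ ord0] & ~~ ([set~ ord0] \subset snd @: c)]].

(** Only the chain of points [(x, 0)] with [x] nonzero survives, of size [a]; all others are paired
    off. *)
Lemma betti_row_class a b (r : 'I_a.+1 * 'I_b.+1 -> nat) n : injective r -> 1 < a -> 1 < b ->
  betti r F (row_class a b) n = (n == a).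
Proof.
move=> r_inj a2 b2; pose T := ('I_a.+1 * 'I_b.+1)%type.
have cv : convex (row_class a b).
  move=> s t u; rewrite !inE => /and3P[h1 /eqP h2 h3] /and3P[_ /eqP h4 _] ut ts.
  rewrite (grid_chain_sub h1 ts) eqEsubset -{1}h2 (imsetS _ ts) -h4 (imsetS _ ut) /=.
  by apply: contra h3 => h; rewrite (subset_trans h) // imsetS.
pose s1 : {set T} := setX [set~ ord0] [set ord0].
have s1E (c : {set T}) : c \in row_class a b -> c \subset s1 -> c = s1.
  rewrite inE => /and3P[_ /eqP h _] /subsetP cs; apply/eqP; rewrite eqEsubset; apply/andP; split.
    by apply/subsetP.
  apply/subsetP=> -[x y]; rewrite !inE /= => /andP[x0 /eqP ->].
  have /imsetP[[x' y'] pc /= ex] : x \in fst @: c by rewrite h !inE.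
  by have := cs _ pc; rewrite !inE /= => /andP[_ /eqP e]; rewrite ex -e.
have f1 : fst @: s1 = [set~ ord0].
  apply/setP=> x; apply/imsetP/idP => [[p]|xn]; first by rewrite inE => /andP[h _] ->.
  by exists (x, ord0) => //; rewrite !inE /= eqxx andbT; move: xn; rewrite !inE.
have s1P : s1 \in row_class a b.
  rewrite inE f1 eqxx /=; apply/andP; split.
    apply/grid_chainP=> -[x y] [x' y']; rewrite !inE /= => /andP[_ /eqP ->] /andP[_ /eqP ->].
    by rewrite /grid_cmp /grid_le /= leqnn !andbT leq_total.
  apply/negP=> /subsetP /(_ (inord 1)); rewrite !inE -val_eqE /= inordK; last by lia.
  move=> /(_ isT) /imsetP[[x y]]; rewrite !inE /= => /andP[_ /eqP ->] /(congr1 val) /=.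
  by rewrite inordK //; lia.
have lo : lower_in (row_class a b) [set s1].
  split; first by rewrite sub1set.
  by move=> s t; rewrite inE => /eqP -> tP ts; rewrite inE; apply/eqP/s1E.
have c1 : #|s1| = a by rewrite cardsX cardsC1 cards1 card_ord muln1.
rewrite (betti_acyclic_quot r_inj (F := F) cv lo) ?betti_single ?c1 //.
pose phi (c : {set T}) := [set p in c | p.2 != ord0].
have cv1 : convex (row_class a b :\: [set s1]).
  move=> s t u /setDP[h1 h2] /setDP[h3 h4] h5 h6; apply/setDP; split; first exact: cv h1 h3 h5 h6.
  apply: contra h4; rewrite !inE => /eqP e; apply/eqP; apply: s1E => //; by rewrite -e.
have mono (s t : {set T}) : t \subset s -> phi t = phi s \/ #|phi t| < #|phi s|.
  move=> ts; have h : phi t \subset phi s.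
    by apply/subsetP=> p; rewrite !inE => /andP[pt ->]; rewrite (subsetP ts).
  case: (eqVneq (phi t) (phi s)) => [|ne]; [by left | right].
  by apply: proper_card; rewrite properEneq ne h.
apply: (@betti_fibre0 T r r_inj F _ phi (fun s : {set T} => #|s|)) => //.
  by move=> s t _ _; apply: mono.
move=> e m.
have [->|[p0 p0e]] := set_0Vmem e.
  rewrite (_ : fibre _ _ _ = set0) ?betti0 //; apply/setP=> c; rewrite in_set0.
  apply/negP; rewrite inE => /andP[/setDP[cP cn] /eqP h].
  case/negP: cn; rewrite inE; apply/eqP/s1E => //; apply/subsetP=> p pc.
  move: cP; rewrite inE => /and3P[_ /eqP f _]; rewrite inE -f (imset_f fst pc) inE.
  by have /setP /(_ p) := h; rewrite !inE pc /= => /negbT; rewrite negbK.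
(* Chains with the same points e outside row 0 are paired by toggling (x, 0),
   where x is the least first coordinate in e. *)
pose p1 := [arg min_(p < p0 | p \in e) nat_of_ord p.1].
have [p1e p1m] : p1 \in e /\ forall q, q \in e -> (p1.1 <= q.1)%N.
  by rewrite /p1; case: arg_minnP.
pose z : T := (p1.1, ord0).
apply: (@betti_cone T r r_inj F z); last first.
  by apply: (@convex_fibre T _ phi (fun s : {set T} => #|s|)) => // s t _ _; apply: mono.
have key (c c' : {set T}) : c \in fibre phi (row_class a b :\: [set s1]) e ->
    grid_chain c' -> fst @: c' = fst @: c -> phi c' = phi c ->
    c' \in fibre phi (row_class a b :\: [set s1]) e.
  move=> h ch ef ep; move: h; rewrite [in X in X -> _]inE => /andP[/setDP[cP cn] /eqP pc].
  move: cP; rewrite inE => /and3P[h1 h2 h3].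
  rewrite inE ep pc eqxx andbT; apply/setDP; split.
    rewrite inE ch ef h2 /=; apply: contra h3 => h; apply/subsetP=> y; rewrite !inE => y0.
    have /imsetP[p pc' e2] : y \in snd @: c' by apply: (subsetP h); rewrite !inE.
    have : p \in phi c by rewrite -ep inE pc' -e2.
    by rewrite inE => /andP[pc2 _]; rewrite e2 imset_f.
  rewrite inE; apply/eqP=> e'; have : p1 \in phi c' by rewrite ep pc.
  by rewrite !inE e' !inE; case: (p1.2 == ord0); rewrite ?andbF.
move=> c cf; move: (cf); rewrite inE => /andP[/setDP[cP _] /eqP pc].
move: cP; rewrite inE => /and3P[/grid_chainP ch /eqP f _].
have p1c : p1 \in c by have := p1e; rewrite -pc inE => /andP[].
have p12 : p1.2 != ord0 by have := p1e; rewrite -pc inE => /andP[].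
split; apply: key cf _ _ _.
- apply: grid_chainU1; first by apply/grid_chainP.
  move=> q qc; rewrite /grid_cmp /grid_le /=.
  have [q2|q2] := eqVneq q.2 ord0; first by rewrite q2 /= !andbT leq_total.
  by rewrite p1m // -pc inE qc q2.
- exact: imset_U1_mem p1c _.
- apply/setP=> q; rewrite !inE; case: (eqVneq q z) => [->|//]; by rewrite eqxx !andbF.
- by apply: grid_chain_sub (subD1set _ _); apply/grid_chainP.
- apply: imset_D1_mem p1c _ _ => //; apply: contraNneq p12 => ->; exact: eqxx.
- apply/setP=> q; rewrite !inE; case: (eqVneq q z) => [->|//]; by rewrite eqxx !andbF.
Qed.

End GridBetti.

Section GridTop.
Variables (F : fieldType) (a b : nat).
Hypotheses (a2 : 1 < a) (b2 : 1 < b).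
Local Notation T := ('I_a.+1 * 'I_b.+1)%type.
Variables (r : T -> nat) (r_inj : injective r).

Definition top_class : {set {set T}} :=
  [set c : {set T} | [&& grid_chain c, fst @: c == [set~ ord0] & snd @: c == [set~ ord0]]].

Lemma top_class_convex : convex top_class.
Proof.
move=> s t u; rewrite !inE => /and3P[h1 /eqP h2 /eqP h3] /and3P[_ /eqP h4 /eqP h5] ut ts.
rewrite (grid_chain_sub h1 ts) !eqEsubset -{1}h2 -{1}h3 !(imsetS _ ts).
by rewrite -{1}h4 -{1}h5 !(imsetS _ ut).
Qed.

Let first_col (c : {set T}) := [set p in c | p.1 == 1 :> nat].
Let above (c : {set T}) := [set p in c | [forall q in first_col c, q.2 < p.2]].

Let col_ne c : c \in top_class -> exists y, (inord 1, y) \in c.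
Proof.
rewrite inE => /and3P[_ /eqP h _].
have /imsetP[[x y] pc /= e] : inord 1 \in fst @: c.
  by rewrite h !inE -val_eqE /= inordK //; lia.
by exists y; rewrite e.
Qed.

Let i1E : (inord 1 : 'I_a.+1) = 1 :> nat. Proof. by rewrite inordK //; lia. Qed.

Let top_pos c p : c \in top_class -> p \in c -> (0 < p.1) && (0 < p.2).
Proof.
rewrite inE => /and3P[_ /eqP h1 /eqP h2] pc.
have := imset_f fst pc; have := imset_f snd pc; rewrite h1 h2 !inE -!val_eqE /=.
by rewrite !lt0n => -> ->.
Qed.

(** Comparability with the turning point puts the chain on the path, and full projections force it
    to be the whole path. *)
Let top_full c : c \in top_class -> (inord 1, ord_max) \in c -> c = facet1 a b.
Proof.
move=> cP mc; have := cP; rewrite inE => /and3P[/grid_chainP ch /eqP h1 /eqP h2].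
have hc := corner1 a2 b2.
have cs p : p \in c -> p \in facet1 a b.
  move=> pc; have /andP[p1 p2] := top_pos cP pc.
  have p1' : p.1 != ord0 by rewrite -val_eqE -lt0n.
  have p2' : p.2 != ord0 by rewrite -val_eqE -lt0n.
  by rewrite inE p1' p2' -(corner_cmp hc) ?ch.
apply/eqP; rewrite eqEsubset; apply/andP; split; first by apply/subsetP.
apply/subsetP=> -[x y]; rewrite !inE /= => /and3P[x0 y0].
have [->|x1] := eqVneq x (inord 1) => /=.
  move=> _; have /imsetP[[x' y'] pc /= e] : y \in snd @: c by rewrite h2 !inE.
  have := cs _ pc; rewrite !inE /= => /and3P[_ _ /orP[/eqP <-|/eqP e']]; rewrite e //.
  by rewrite e'.
move/eqP=> ->; have /imsetP[[x' y'] pc /= e] : x \in fst @: c by rewrite h1 !inE.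
have := cs _ pc; rewrite !inE /= -e (negPf x1) /= => /and3P[_ _ /eqP e'].
by rewrite e -e'.
Qed.

Lemma facet1_top_max c : c \in top_class -> facet1 a b \subset c -> c = facet1 a b.
Proof.
move=> cP /subsetP h; apply: top_full => //; apply: h.
have [hx hy _] := corner1 a2 b2; by rewrite inE /= hx hy eqxx.
Qed.

Let phi c := (first_col c, above c).
(** A lexicographic rank: the factor exceeds every possible size of the second component. *)
Let ro (z : {set T} * {set T}) := (#|{: T}|.+1 * #|z.1| + #|z.2|)%N.

Let mono (s t : {set T}) : t \subset s -> phi t = phi s \/ ro (phi t) < ro (phi s).
Proof.
move=> ts; have h1 : first_col t \subset first_col s.
  by apply/subsetP=> p; rewrite !inE => /andP[/(subsetP ts) -> ->].
have [e|ne] := eqVneq (first_col t) (first_col s); last first.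
  right; have h : #|first_col t| < #|first_col s| by apply: proper_card; rewrite properEneq ne h1.
  have h2 : #|above t| <= #|{: T}| by apply: max_card.
  rewrite /ro /=; move: h h2.
  move: #|first_col t| #|first_col s| #|above t| #|above s| #|{: T}| => A B C D E; clear; nia.
have h2 : above t \subset above s.
  by apply/subsetP=> p; rewrite !inE e => /andP[/(subsetP ts) -> ->].
have [e2|ne2] := eqVneq (above t) (above s); [left | right].
  by rewrite /phi e e2.
by rewrite /ro /= e ltn_add2l; apply: proper_card; rewrite properEneq ne2 h2.
Qed.

(** Only for [facet1] does the first column reach the last ordinate, leaving no point above it to
    guide the pairing. *)
Lemma betti_top_class n : betti r F (top_class :\ facet1 a b) n = 0.
Proof.
have cv : convex (top_class :\ facet1 a b).
  move=> s t u /setD1P[h1 h2] /setD1P[h3 h4] ut ts; apply/setD1P; split; last first.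
    exact: top_class_convex h2 h4 ut ts.
  by apply: contraNneq h1 => e; apply/eqP/facet1_top_max; rewrite -?e.
apply: (@betti_fibre0 T r r_inj F _ phi ro) => //; first by move=> s t _ _; apply: mono.
move=> [A B] m.
have [->|[c cf]] := set_0Vmem (fibre phi (top_class :\ facet1 a b) (A, B)).
  by rewrite betti0.
have [y0 yc] : exists y, (inord 1, y) \in A.
  move: cf; rewrite inE => /andP[/setD1P[_ /col_ne[y yc]] /eqP[<- _]].
  by exists y; rewrite inE yc /= i1E.
pose y := [arg max_(y > y0 | (inord 1, y) \in A) nat_of_ord y].
have [yA ymax] : (inord 1, y) \in A /\ forall y', (inord 1, y') \in A -> y' <= y.
  by rewrite /y; case: arg_maxnP.
have A1 p : p \in A -> p.1 = inord 1.
  move: cf; rewrite inE => /andP[_ /eqP[<- _]]; rewrite inE => /andP[_ /eqP e].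
  by apply/val_inj; rewrite /= i1E.
have ymaxA p : p \in A -> p.2 <= y.
  by move=> pA; apply: ymax; rewrite -(A1 p pA) -surjective_pairing.
have memB c' p : c' \in fibre phi (top_class :\ facet1 a b) (A, B) ->
    (p \in B) = (p \in c') && (y < p.2).
  rewrite inE => /andP[_ /eqP[eA <-]]; rewrite inE eA; congr (_ && _).
  apply/forall_inP/idP => [/(_ _ yA) //|h q /ymaxA]; move: h; clear; lia.
have [p0 p0B] : exists p, p \in B.
  have := cf; rewrite inE => /andP[/setD1P[cn cP] /eqP[eA _]].
  have := cP; rewrite inE => /and3P[_ _ /eqP h2].
  have /imsetP[p pc e] : ord_max \in snd @: c by rewrite h2 !inE -val_eqE /=; lia.
  exists p; rewrite (memB c) // pc -e /= ltn_neqAle -ltnS ltn_ord andbT.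
  apply/eqP=> yb; case/eqP: cn; apply: top_full => //.
  have : (inord 1, y) \in first_col c by rewrite eA.
  by rewrite inE (_ : y = ord_max) => [/andP[]|]; last exact/val_inj.
(* A is the first column of the chain and y its last ordinate; the chains are
   paired by toggling (x, y), where x is the least first coordinate of a point
   above y. *)
pose p1 := [arg min_(p < p0 | p \in B) nat_of_ord p.1].
have [p1B p1m] : p1 \in B /\ forall q, q \in B -> p1.1 <= q.1.
  by rewrite /p1; case: arg_minnP.
have p1y : y < p1.2 by move: p1B; rewrite (memB c) // => /andP[].
have p11 : 1 < p1.1.
  have p1c : p1 \in c by move: p1B; rewrite (memB c) // => /andP[].
  move: (cf); rewrite inE => /andP[/setD1P[_ cP] /eqP[eA _]].
  have /andP[h _] := top_pos cP p1c; rewrite ltn_neqAle h andbT.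
  apply/eqP=> e; have : p1 \in A by rewrite -eA inE p1c -e.
  by move/ymaxA; rewrite leqNgt p1y.
pose z : T := (p1.1, y).
apply: (@betti_cone T r r_inj F z); last first.
  by apply: (@convex_fibre T _ phi ro) => // s t _ _; apply: mono.
have key (c1 c2 : {set T}) : c1 \in fibre phi (top_class :\ facet1 a b) (A, B) ->
    grid_chain c2 -> fst @: c2 = fst @: c1 -> snd @: c2 = snd @: c1 ->
    (forall p, p != z -> (p \in c2) = (p \in c1)) ->
    c2 \in fibre phi (top_class :\ facet1 a b) (A, B).
  move=> h ch e1 e2 ez; have memB1 := memB _ _ h.
  move: h; rewrite [in X in X -> _]inE => /andP[/setD1P[cn cP] /eqP[eA eB]].
  have eA2 : first_col c2 = A.
    rewrite -eA; apply/setP=> p; rewrite !inE; have [->|pz] := eqVneq p z; last by rewrite ez.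
    by rewrite /= (gtn_eqF p11) !andbF.
  have eB2 : above c2 = B.
    apply/setP=> p; rewrite memB1 inE eA2.
    have -> : [forall q in A, q.2 < p.2] = (y < p.2).
      by apply/forall_inP/idP => [/(_ _ yA) //|h q /ymaxA]; move: h; clear; lia.
    have [->|pz] := eqVneq p z; last by rewrite ez.
    by rewrite ltnn !andbF.
  rewrite inE /phi eA2 eB2 eqxx andbT; apply/setD1P; split; last first.
    by move: cP; rewrite !inE ch e1 e2 => /andP[_ ->].
  apply/eqP=> e; have : (inord 1, ord_max) \in A.
    rewrite -eA2 inE /= i1E andbT e inE /= eqxx andbT.
    by have [-> -> _] := corner1 a2 b2.
  by move/ymaxA; move: p1y (ltn_ord p1.2) => /=; clear; lia.
move=> c1 c1f; have := c1f; rewrite inE => /andP[/setD1P[c1n c1P] /eqP[eA eB]].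
have := c1P; rewrite inE => /and3P[/grid_chainP ch e1 e2].
have yc1 : (inord 1, y) \in c1 by move: yA; rewrite -eA inE => /andP[].
have p1c : p1 \in c1 by move: p1B; rewrite (memB c1) // => /andP[].
have yz : (inord 1, y) != z by apply/eqP=> -[e]; move: p11; rewrite -e i1E.
have pz : p1 != z by apply/eqP=> e; move: p1y; rewrite e ltnn.
split; apply: (key c1 _ c1f).
- apply: grid_chainU1; first by apply/grid_chainP.
  move=> q qc; have [qy|qy] := ltnP y q.2.
    have qB : q \in B by rewrite (memB c1 q c1f) qc.
    by rewrite /grid_cmp /grid_le /= p1m // ltnW.
  have := ch _ _ p1c qc; have := ch _ _ yc1 qc; have /andP[q1 q2] := top_pos c1P qc.
  by move: qy q1 q2 p1y p11; rewrite /grid_cmp /grid_le /= i1E; clear; lia.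
- exact: imset_U1_mem p1c _.
- exact: imset_U1_mem yc1 _.
- by move=> p pz'; rewrite !inE (negPf pz').
- by apply: grid_chain_sub (subD1set _ _); apply/grid_chainP.
- exact: imset_D1_mem p1c _ _.
- exact: imset_D1_mem yc1 _ _.
- by move=> p pz'; rewrite !inE pz'.
Qed.

End GridTop.

Section GridProduct.
Variables (F : fieldType) (a b : nat).
Hypotheses (a2 : 2 < a) (ab : a.+1 < b).
Local Notation T := ('I_a.+1 * 'I_b.+1)%type.
Variables (r : T -> nat) (r_inj : injective r).

Let a1 : 1 < a. Proof. exact: ltnW. Qed.
Let b1 : 1 < b. Proof. by rewrite (ltn_trans _ ab) // ltnW. Qed.

Let swap (p : 'I_b.+1 * 'I_a.+1) : T := (p.2, p.1).
Let swap_inj : injective swap. Proof. by move=> [x y] [x' y'] [-> ->]. Qed.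
Let unswap (p : T) : 'I_b.+1 * 'I_a.+1 := (p.2, p.1).
Definition col_class : {set {set T}} :=
  [set c : {set T} | [&& grid_chain c, snd @: c == [set~ ord0] & ~~ ([set~ ord0] \subset fst @: c)]].

Lemma col_classE : col_class = [set swap @: (c : {set _}) | c in row_class b a].
Proof.
apply/setP=> c; apply/idP/imsetP => [|[c' + ->]].
  rewrite inE => /and3P[/grid_chainP h1 /eqP h2 h3]; exists (unswap @: c); last first.
    by rewrite -imset_comp (eq_imset (g := id)) ?imset_id // => -[].
  rewrite inE -!imset_comp; apply/and3P; split; last exact: h3.
    apply/grid_chainP=> p q /imsetP[p' pc ->] /imsetP[q' qc ->].
    by have := h1 _ _ pc qc; rewrite /grid_cmp /grid_le /= andbC [in X in _ || X]andbC.
  by rewrite -h2; apply/eqP/eq_imset.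
rewrite inE => /and3P[/grid_chainP h1 /eqP h2 h3]; rewrite inE -!imset_comp.
apply/and3P; split; last exact: h3.
  apply/grid_chainP=> p q /imsetP[p' pc ->] /imsetP[q' qc ->].
  by have := h1 _ _ pc qc; rewrite /grid_cmp /grid_le /= andbC [in X in _ || X]andbC.
by rewrite -h2; apply/eqP/eq_imset.
Qed.

Lemma betti_col_class n : betti r F col_class n = (n == b).
Proof.
have rs_inj : injective (fun p => r (swap p)) by move=> x y /r_inj /swap_inj.
have e := @betti_image _ _ (fun p => r (swap p)) r F swap (row_class b a) n swap_inj (fun x y => erefl).
have e2 := @betti_row_class F b a (fun p => r (swap p)) n rs_inj b1 a1.
by rewrite col_classE; apply: etrans e e2.
Qed.

Let P := grid_prod a b.
Let s1 : {set T} := facet1 a b.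
Let o : T := (ord0, ord0).

Let o_notin : o \notin s1. Proof. by rewrite inE. Qed.

Lemma grid_facet1_max (c : {set T}) : c \in P -> s1 \subset c -> c = s1.
Proof. exact: corner_max (corner1 a1 b1). Qed.

Lemma grid_D1_down (s t : {set T}) : s \in P :\ s1 -> t \subset s -> t \in P :\ s1.
Proof.
move=> /setD1P[ns sP] ts; apply/setD1P; split; last exact: grid_prod_down sP ts.
by apply: contraNneq ns => e; rewrite (grid_facet1_max sP) // -e.
Qed.

Let cone : {set {set T}} := [set c | o |: c \in P].

Let coneE c : (c \in cone) = (o |: c \in P). Proof. by rewrite in_set. Qed.

Let cone_sub : cone \subset P :\ s1.
Proof.
apply/subsetP=> c; rewrite coneE => h; apply/setD1P; split; last first.
  by apply: grid_prod_down h _; apply: subsetUr.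
apply: contraNneq o_notin => e; rewrite -(grid_facet1_max h) ?setU11 //.
by rewrite e subsetUr.
Qed.

Let cone_down (s t : {set T}) : s \in cone -> t \subset s -> t \in cone.
Proof.
by rewrite !coneE => h ts; apply: grid_prod_down h (setUS [set o] ts).
Qed.

Let betti_cone_class n : betti r F cone n = 0.
Proof.
apply: (@betti_cone T r r_inj F o); last first.
  by move=> s t u sC _ _ ts; apply: cone_down ts.
move=> c cc; split; last exact: cone_down cc (subD1set _ _).
by move: cc; rewrite !coneE setUA setUid.
Qed.

Let chain_o (c : {set T}) : grid_chain c -> grid_chain (o |: c).
Proof. by move=> h; apply: grid_chainU1 => // q _; rewrite /grid_cmp /grid_le /=. Qed.

Let setC0_neqT n : [set~ ord0] != [set: 'I_n.+1].
Proof. by apply/eqP=> /setP /(_ ord0); rewrite !inE eqxx. Qed.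

Let U0_T n (A : {set 'I_n.+1}) : (ord0 |: A == setT) = ([set~ ord0] \subset A).
Proof.
rewrite -subTset; apply/subsetP/subsetP => h x.
  by have := h x; rewrite !inE => /(_ isT) /orP[->|].
by move=> _; have := h x; rewrite !inE; case: (x == ord0) => //= ->.
Qed.

Let rest : {set {set T}} := (P :\ s1) :\: cone.
Let phi (c : {set T}) := (fst @: c == [set~ ord0], snd @: c == [set~ ord0]).
Let ro (z : bool * bool) := (z.1 + z.2)%N.

Let restE (c : {set T}) : c \in rest -> [/\ c != s1, grid_chain c, fst @: c != setT, snd @: c != setT &
  (fst @: c == [set~ ord0]) || (snd @: c == [set~ ord0])].
Proof.
move=> /setDP[/setD1P[h1 cP] cn]; move: cP; rewrite inE => /and3P[h2 h3 h4]; split=> //.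
apply: contraR cn; rewrite negb_or => /andP[h5 h6].
rewrite coneE inE chain_o //= !imsetU1 !U0_T.
by apply/andP; split; [apply: contra h5 | apply: contra h6] => h; apply/eqP/setC0_sub.
Qed.

Let restI (c : {set T}) : c != s1 -> grid_chain c -> fst @: c != setT -> snd @: c != setT ->
  (fst @: c == [set~ ord0]) || (snd @: c == [set~ ord0]) -> c \in rest.
Proof.
move=> h1 h2 h3 h4 h5; apply/setDP; split; first by apply/setD1P; rewrite inE h2 h3 h4.
by rewrite coneE inE !imsetU1 !U0_T; case/orP: h5 => /eqP ->; rewrite subxx ?andbF.
Qed.

Let mono (s t : {set T}) : s \in rest -> t \in rest -> t \subset s ->
  phi t = phi s \/ ro (phi t) < ro (phi s).
Proof.
move=> /restE[_ _ s3 s4 _] _ ts.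
have h1 : (fst @: t == [set~ ord0]) ==> (fst @: s == [set~ ord0]).
  by apply/implyP=> /eqP e; apply/eqP/setC0_sub => //; rewrite -e imsetS.
have h2 : (snd @: t == [set~ ord0]) ==> (snd @: s == [set~ ord0]).
  by apply/implyP=> /eqP e; apply/eqP/setC0_sub => //; rewrite -e imsetS.
by move: h1 h2; rewrite /phi /ro /=; do 4 case: (_ == _) => //=; move=> _ _; (by left) || (by right).
Qed.

Let rest_convex : convex rest.
Proof.
move=> s t u /setDP[sP sn] /setDP[uP un] ut ts; apply/setDP; split; first exact: grid_D1_down ts.
by apply: contra un => h; apply: cone_down ut.
Qed.

Let C0_snd (c : {set T}) : snd @: c != setT -> ~~ (snd @: c == [set~ ord0]) = ~~ ([set~ ord0] \subset snd @: c).
Proof.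
by move=> h; congr (~~ _); apply/eqP/idP => [->//|]; move=> e; apply: setC0_sub.
Qed.

Let C0_fst (c : {set T}) : fst @: c != setT -> ~~ (fst @: c == [set~ ord0]) = ~~ ([set~ ord0] \subset fst @: c).
Proof.
by move=> h; congr (~~ _); apply/eqP/idP => [->//|]; move=> e; apply: setC0_sub.
Qed.

Let s1E : fst @: s1 = [set~ ord0] /\ snd @: s1 = [set~ ord0].
Proof. by rewrite (corner_fst (corner1 a1 b1)) (corner_snd (corner1 a1 b1)). Qed.

Let fibre10 : fibre phi rest (true, false) = row_class a b.
Proof.
apply/setP=> c; rewrite inE; apply/andP/idP.
  case=> /restE[h1 h2 h3 h4 _] /eqP[h5 h6]; rewrite inE h2 h5 -C0_snd // h6 //.
rewrite inE => /and3P[h1 /eqP h2 h3].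
have h4 : snd @: c != setT by apply: contraNneq h3 => ->; apply: subsetT.
rewrite -C0_snd // in h3; split; last by rewrite /phi h2 eqxx (negPf h3).
apply: restI => //; rewrite ?h2 ?setC0_neqT ?eqxx //.
by apply: contraNneq h3 => ->; have [_ ->] := s1E.
Qed.

Let fibre01 : fibre phi rest (false, true) = col_class.
Proof.
apply/setP=> c; rewrite inE; apply/andP/idP.
  case=> /restE[h1 h2 h3 h4 _] /eqP[h5 h6]; rewrite inE h2 h6 -C0_fst // h5 //.
rewrite inE => /and3P[h1 /eqP h2 h3].
have h4 : fst @: c != setT by apply: contraNneq h3 => ->; apply: subsetT.
rewrite -C0_fst // in h3; split; last by rewrite /phi h2 eqxx (negPf h3).
apply: restI => //; rewrite ?h2 ?setC0_neqT ?eqxx ?orbT //.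
by apply: contraNneq h3 => ->; have [-> _] := s1E.
Qed.

Let fibre11 : fibre phi rest (true, true) = top_class a b :\ s1.
Proof.
apply/setP=> c; rewrite inE; apply/andP/setD1P.
  by case=> /restE[h1 h2 h3 h4 _] /eqP[h5 h6]; rewrite inE h2 h5 h6.
case=> h1; rewrite inE => /and3P[h2 /eqP h3 /eqP h4].
split; last by rewrite /phi h3 h4 !eqxx.
by apply: restI; rewrite ?h3 ?h4 ?setC0_neqT ?eqxx.
Qed.

Let fibre00 : fibre phi rest (false, false) = set0.
Proof.
apply/setP=> c; rewrite in_set0; apply/negP; rewrite inE => /andP[/restE[_ _ _ _ h] /eqP[h1 h2]].
by move: h; rewrite h1 h2.
Qed.

Let bsum G : (\sum_(z : bool * bool) G z = G (true, true) + G (true, false) + G (false, true) + G (false, false))%N.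
Proof.
rewrite (eq_bigr (fun z => G (z.1, z.2))) => [|[]//].
by rewrite -(pair_bigA _ (fun x y => G (x, y))) /= !big_bool /= !addnA.
Qed.

(** The punctured product has the homology of a wedge of two spheres. Outside the cone over [(0, 0)]
    one projection misses only [0]; chains with just one such projection give one class each, and
    those with two give none. As [a.+1 < b] the sizes [a] and [b] are not consecutive, so the
    contributions add. *)
Lemma betti_grid_D1 n : betti r F (P :\ s1) n = ((n == a) + (n == b))%N.
Proof.
have cv : convex (P :\ s1) by move=> s t u sP _ _; apply: grid_D1_down.
have lo : lower_in (P :\ s1) cone by split=> [|s t sC _]; [exact: cone_sub | exact: cone_down].
rewrite (betti_acyclic_sub r_inj (F := F) cv lo betti_cone_class n).
have hs m : (\sum_z betti r F (fibre phi rest z) m = (m == a) + (m == b))%N.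
  rewrite bsum fibre00 fibre01 fibre10 fibre11 betti0 addn0.
  rewrite (@betti_top_class F a b a1 b1 r r_inj) add0n.
  by rewrite (@betti_row_class F a b r m r_inj a1 b1) betti_col_class.
rewrite (@betti_fibre T r r_inj F _ phi ro rest rest_convex mono n) ?hs // => m.
have [e|e] : ((m == a) + (m == b) = 0 \/ (m.+1 == a) + (m.+1 == b) = 0)%N.
    by move: a2 ab; clear; lia.
  by left; apply: etrans (hs m) e.
by right; apply: etrans (hs m.+1) e.
Qed.

End GridProduct.

(** * Connected sums *)

Section Glue.
Variables (V : finType) (r : V -> nat).
Hypothesis r_inj : injective r.
Implicit Types (X Y : {set {set V}}) (s t u : {set V}).

Let les_split x y c c' q q' : x + c + c' = y + q -> c = 0 -> c' = 0 -> q = q' -> x = y + q'.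
Proof. by move=> h c1 c2 <-; rewrite -h c1 c2 !addn0. Qed.

Definition is_facet X s := s \in X /\ forall t, t \in X -> s \subset t -> t = s.

Definition down_closed X := forall s t, s \in X -> t \subset s -> t \in X.

Lemma down_closed_D1 X s : down_closed X -> is_facet X s -> down_closed (X :\ s).
Proof.
move=> Xd [sX sm] u t /setD1P[us uX] tu; apply/setD1P; split; last exact: Xd uX tu.
by apply: contraNneq us => e; rewrite (sm u) // -e.
Qed.

Lemma down_closed_convex X : down_closed X -> convex X.
Proof. by move=> Xd s t u sX _ _; apply: Xd. Qed.

(** Nothing lives one degree below the facet, so its boundary already bounds and restoring the facet
    creates a class. *)
Lemma betti_facet (F : fieldType) X s n : down_closed X -> is_facet X s ->
    betti r F (X :\ s) #|s| = 0 -> betti r F (X :\ s) #|s|.-1 = 0 ->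
  betti r F X n = betti r F (X :\ s) n + (n == #|s|).
Proof.
move=> Xd sf b0 b1; have Xd' := down_closed_D1 Xd sf; have [sX sm] := sf.
have lo : lower_in X (X :\ s) by split=> [|u t uX _]; [exact: subD1set | exact: Xd'].
have [c [c0 hc]] := les r_inj F (down_closed_convex Xd) lo.
have q : X :\: (X :\ s) = [set s].
  apply/setP=> t; rewrite in_setD in_setD1 in_set1.
  by have [->|] := eqVneq t s; rewrite ?sX //=; case: (t \in X).
have qb m : betti r F (X :\: (X :\ s)) m = (m == #|s|) by rewrite q betti_single.
have z m : c m = 0.
  case: m => // m; have [_ h1 _] := hc m; have [h2 _ _] := hc m.+1.
  rewrite qb in h2; move: h2; have [e|//] := eqVneq m.+1 #|s|; last by move=> _; rewrite leqn0 => /eqP.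
  by move=> _; apply/eqP; rewrite -leqn0; apply: leq_trans h1 _; rewrite -[m]/m.+1.-1 e b1.
have [_ _ h] := hc n; exact: les_split h (z n) (z n.+1) (qb n).
Qed.

Variables (X Y : {set {set V}}) (s u : {set V}).
Hypotheses (Xd : down_closed X) (Yd : down_closed Y).
Hypotheses (sX : is_facet X s) (sY : is_facet Y s) (uY : is_facet Y u).
Hypothesis us : u != s.
Hypothesis XY : forall t, t \in X -> t \in Y -> t \subset s.

Let Z := (X :|: Y) :\ s.

Let uX : u \notin X.
Proof.
apply/negP=> h; case/negP: us; have [uY1 um] := uY; have [sY1 _] := sY.
by apply/eqP/esym/um => //; apply: XY.
Qed.

Lemma glue_down : down_closed Z.
Proof.
move=> v t /setD1P[vs]; rewrite inE => vXY tv; apply/setD1P; split.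
  apply: contraNneq vs => e; rewrite e in tv; apply/eqP.
  by have [_ mX] := sX; have [_ mY] := sY; case/orP: vXY => h; [apply: mX | apply: mY].
by rewrite inE; case/orP: vXY => h; [rewrite (Xd h tv) | rewrite (Yd h tv) orbT].
Qed.

Lemma glue_facet : is_facet Z u.
Proof.
have [uY1 um] := uY; split; first by apply/setD1P; rewrite inE uY1 orbT.
move=> t /setD1P[_]; rewrite inE => /orP[tX|tY] ut; last exact: um.
by case/negP: uX; apply: Xd ut.
Qed.

(** Excision: modulo [X] without [s] there remains [Y] without [u] modulo the closed simplex on [s],
    which is acyclic. The alternative on degrees kills the connecting maps. *)
Lemma betti_glue (F : fieldType) n : s != set0 ->
    (forall n, betti r F (X :\ s) n = 0 \/ betti r F (Y :\ u) n.+1 = 0) ->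
  betti r F (Z :\ u) n = betti r F (X :\ s) n + betti r F (Y :\ u) n.
Proof.
move=> s0 hXY.
have [sX1 sm] := sX; have [sY1 sm'] := sY; have [uY1 um] := uY.
have Zd := down_closed_D1 glue_down glue_facet.
have Xd' := down_closed_D1 Xd sX; have Yd' := down_closed_D1 Yd uY.
have lo : lower_in (Z :\ u) (X :\ s).
  split=> [|v t vX _]; last exact: Xd'.
  apply/subsetP=> t /setD1P[ts tX]; apply/setD1P; split; first by apply: contraNneq uX => <-.
  by apply/setD1P; rewrite inE tX.
have loY : lower_in (Y :\ u) (seg set0 s).
  split; last by move=> v t; rewrite !inE !sub0set /= => vs _ tv; apply: subset_trans tv vs.
  apply/subsetP=> t; rewrite inE sub0set /= => ts; apply/setD1P; split; last exact: Yd ts.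
  by apply: contraNneq us => e; apply/eqP/esym/um; rewrite // -e.
have acyc m : betti r F (seg set0 s) m = 0.
  by apply: betti_seg => //; rewrite properEneq eq_sym s0 sub0set.
have q : (Z :\ u) :\: (X :\ s) = (Y :\ u) :\: seg set0 s.
  apply/setP=> t; rewrite !in_setD !in_set1 in_setU inE sub0set /=.
  have [->|ts] := eqVneq t s; first by rewrite subxx /= !andbF.
  have [->|tu] := eqVneq t u; first by rewrite !andbF.
  rewrite /=; have [tX|tX] /= := boolP (t \in X).
    by have [tY|] := boolP (t \in Y); rewrite ?andbF // (XY tX tY).
  have [tY|] := boolP (t \in Y); rewrite ?andbF // andbT.
  by apply/esym; apply: contra tX; apply: Xd sX1.
have qb m : betti r F ((Z :\ u) :\: (X :\ s)) m = betti r F (Y :\ u) m.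
  rewrite q; apply/esym.
  exact: (betti_acyclic_sub r_inj (F := F) (down_closed_convex Yd') loY acyc m).
have [c [c0 hc]] := les r_inj F (down_closed_convex Zd) lo.
have z m : c m = 0.
  case: m => // m; have [_ h1 _] := hc m; have [h2 _ _] := hc m.+1.
  rewrite qb in h2; apply/eqP; rewrite -leqn0.
  by case: (hXY m) => e; [rewrite e in h1 | rewrite e in h2].
have [_ _ h] := hc n; exact: les_split h (z n) (z n.+1) (qb n).
Qed.

End Glue.

(** * Integral homology from field coefficients *)

Section Select.
Variable R : nzRingType.
Local Open Scope ring_scope.

(** Multiplication on the right by [sel S] keeps the columns indexed by [S]. *)
Definition sel (q : nat) (S : {set 'I_q}) : 'M[R]_(q, #|S|) :=
  \matrix_(j, a) (j == enum_val a)%:R.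

Lemma mul_sel p q (S : {set 'I_q}) (A : 'M[R]_(p, q)) i a : (A *m sel S) i a = A i (enum_val a).
Proof.
rewrite mxE (bigD1 (enum_val a)) //= mxE eqxx mulr1 big1 ?addr0 // => j /negPf h.
by rewrite mxE h mulr0.
Qed.

Lemma trsel_mul q s (S : {set 'I_q}) (A : 'M[R]_(q, s)) a j : ((sel S)^T *m A) a j = A (enum_val a) j.
Proof.
rewrite mxE (bigD1 (enum_val a)) //= !mxE eqxx mul1r big1 ?addr0 // => i /negPf h.
by rewrite !mxE h mul0r.
Qed.

Lemma sel_tr q (S : {set 'I_q}) : (sel S)^T *m sel S = 1%:M.
Proof.
apply/matrixP=> a b; rewrite trsel_mul !mxE (inj_eq enum_val_inj) //.
Qed.

Lemma sel_id p q (S : {set 'I_q}) (A : 'M[R]_(p, q)) :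
  (forall i j, j \notin S -> A i j = 0) -> A *m sel S *m (sel S)^T = A.
Proof.
move=> h; apply/matrixP=> i j; rewrite mxE.
have [jS|jS] := boolP (j \in S).
  rewrite (bigD1 (enum_rank_in jS j)) //= mul_sel !mxE enum_rankK_in // eqxx mulr1.
  rewrite big1 ?addr0 // => a ha; rewrite !mxE; case: eqP => [e|_]; last by rewrite mulr0.
  by move: ha; rewrite {2}e enum_valK_in eqxx.
rewrite h // big1 // => a _; rewrite !mxE; case: eqP => [e|_]; last by rewrite mulr0.
by move: jS; rewrite e enum_valP.
Qed.

Lemma sel_id_tr q s (S : {set 'I_q}) (A : 'M[R]_(q, s)) :
  (forall i j, i \notin S -> A i j = 0) -> sel S *m ((sel S)^T *m A) = A.
Proof.
move=> h; apply/matrixP=> i j; rewrite mxE.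
have [iS|iS] := boolP (i \in S).
  rewrite (bigD1 (enum_rank_in iS i)) //= trsel_mul !mxE enum_rankK_in // eqxx mul1r.
  rewrite big1 ?addr0 // => a ha; rewrite !mxE; case: eqP => [e|_]; last by rewrite mul0r.
  by move: ha; rewrite {2}e enum_valK_in eqxx.
rewrite h // big1 // => a _; rewrite !mxE; case: eqP => [e|_]; last by rewrite mul0r.
by move: iS; rewrite e enum_valP.
Qed.

End Select.

Section SmithRank.
Local Open Scope ring_scope.

Lemma rank_sel (F : fieldType) q (S : {set 'I_q}) : \rank (sel F S) = #|S|.
Proof.
apply/eqP; rewrite eqn_leq rank_leq_col /=.
rewrite -[X in (X <= _)%N](mxrank1 F) -(sel_tr F S); exact: mxrankM_maxr.
Qed.

Definition smith_mx (R : nzRingType) p q (x : nat -> R) : 'M[R]_(p, q) :=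
  \matrix_(i, j) (if i == j :> nat then x i else 0).

Lemma rank_smith_mx (F : fieldType) p q (x : nat -> F) :
  \rank (smith_mx p q x) = #|[set j : 'I_q | (j < p)%N && (x j != 0)]|.
Proof.
set S := [set j | _]; set D := smith_mx p q x.
have eD : D *m sel F S *m (sel F S)^T = D.
  apply: sel_id => i j; rewrite inE mxE; case: (nat_of_ord i =P j) => [e|//].
  by rewrite -e ltn_ord /= negbK => /eqP ->.
pose E : 'M[F]_(#|S|, p) :=
  \matrix_(a, i) (let j : 'I_q := enum_val a in if j == i :> nat then (x j)^-1 else 0).
have eE : E *m D = (sel F S)^T.
  apply/matrixP=> a j; rewrite !mxE.
  have := enum_valP a; rewrite inE => /andP[lt nz].
  rewrite (bigD1 (Ordinal lt)) //= !mxE /= eqxx big1 ?addr0.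
    rewrite eq_sym -val_eqE /= eq_sym; case: eqP => [e|_]; last by rewrite mulr0.
    by rewrite mulVf.
  by move=> i; rewrite -val_eqE /= eq_sym => /negPf h; rewrite mxE /= h mul0r.
apply/eqP; rewrite eqn_leq; apply/andP; split.
  by rewrite -eD; apply: leq_trans (mxrankM_maxr _ _) _; rewrite mxrank_tr rank_sel.
by rewrite -(rank_sel F S) -mxrank_tr -eE mxrankM_maxr.
Qed.

Lemma rank_unit_conj (F : fieldType) p q (A : 'M[F]_(p, q)) L R :
  L \in unitmx -> R \in unitmx -> \rank (L *m A *m R) = \rank A.
Proof.
move=> uL uR; rewrite mxrankMfree ?row_free_unit // -mxrank_tr trmx_mul mxrankMfree ?mxrank_tr //.
by rewrite row_free_unit unitmx_tr.
Qed.

Definition field_rank (F : fieldType) p q (A : 'M[int]_(p, q)) : nat :=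
  \rank (map_mx (intr : int -> F) A).

Lemma field_rankM_unit (F : fieldType) p q (A : 'M[int]_(p, q)) L R :
  L \in unitmx -> R \in unitmx -> field_rank F (L *m A *m R) = field_rank F A.
Proof.
have u m (B : 'M[int]_m) : B \in unitmx -> map_mx (intr : int -> F) B \in unitmx.
  by rewrite !unitmxE det_map_mx; apply: rmorph_unit.
by move=> uL uR; rewrite /field_rank !map_mxM rank_unit_conj //; apply: u.
Qed.

Lemma field_rank_smith (F : fieldType) p q (x : nat -> int) :
  field_rank F (smith_mx p q x) = #|[set j : 'I_q | (j < p)%N && ((x j)%:~R != 0 :> F)]|.
Proof.
rewrite -(rank_smith_mx p q (fun j => (x j)%:~R : F)); congr (\rank _).
by apply/matrixP=> i j; rewrite !mxE; case: eqP.
Qed.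

Lemma field_rank_tr (F : fieldType) p q (A : 'M[int]_(p, q)) : field_rank F A^T = field_rank F A.
Proof.
by rewrite /field_rank -[RHS]mxrank_tr; congr (\rank _); apply/matrixP=> i j; rewrite !mxE.
Qed.

Lemma smith_form p q (A : 'M[int]_(p, q)) :
  exists L R (x : nat -> int), [/\ L \in unitmx, R \in unitmx & A = L *m smith_mx p q x *m R].
Proof.
have [L uL [R uR [d _ e]]] := int_Smith_normal_form A.
exists L, R, (fun i => d`_i); split=> //; rewrite e; congr (_ *m _ *m _).
by apply/matrixP=> i j; rewrite !mxE mulrb.
Qed.

(* If no prime divides a nonzero invariant factor they are all units. *)
Lemma smith_unit p q (x : nat -> int) rho :
    (forall F : fieldType, field_rank F (smith_mx p q x) = rho) ->
  forall j, (j < p)%N -> (j < q)%N -> x j != 0 -> (x j * x j = 1)%R.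
Proof.
move=> h j jp jq xj.
suff e : `|x j|%N = 1%N.
  by move: e; case: (x j) => [[|[|n]]|[|n]].
apply/eqP; apply: contraT => x1.
have pr := pdiv_prime (_ : (1 < `|x j|)%N).
have {}pr : prime (pdiv `|x j|) by apply: pr; rewrite ltn_neqAle eq_sym x1 absz_gt0.
set pp := pdiv _ in pr.
have chF : pp \in [pchar 'F_pp] by apply: pchar_Fp.
have := h rat; rewrite -(h 'F_pp) !field_rank_smith => /eqP.
rewrite eqn_leq => /andP[le _]; exfalso; move: le; apply/negP; rewrite -ltnNge.
apply: proper_card; apply/properP; split.
  apply/subsetP=> i; rewrite !inE => /andP[-> h1] /=; apply: contraNneq h1 => /eqP.
  by rewrite intr_eq0 => /eqP ->.
exists (Ordinal jq); rewrite inE /= jp ?intr_eq0 // negbK.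
have /dvdnP[c e] : (pp %| `|x j|)%N by apply: pdiv_dvd.
have : (`|x j|%N)%:~R = 0 :> 'F_pp by rewrite e PoszM intrM [pp%:~R]pcharf0 ?mulr0.
by move=> h0; rewrite (intEsg (x j)) intrM h0 mulr0.
Qed.

(** As the rank of [A] is the same over all fields, its invariant factors are units and its image is
    a direct summand, given by the coordinates in [S]. On the complementary coordinates [B] becomes
    [B''], whose kernel is cut out by the Smith form of [B'']; for it the rational rank suffices.
    The matrix [C] reads off the remaining coordinates. *)
Lemma homology_matrix p q s (A : 'M[int]_(p, q)) (B : 'M[int]_(q, s)) rA rB :
    A *m B = 0 -> (forall F : fieldType, field_rank F A = rA) -> field_rank rat B = rB ->
  exists C : 'M[int]_(q, q - rA - rB),
    (forall v : 'rV_q, v *m B = 0 -> (v *m C = 0 <-> exists u, v = u *m A)) /\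
    (forall w, exists2 v : 'rV_q, v *m B = 0 & v *m C = w).
Proof.
move=> AB hA hB.
have [L [R [x [uL uR eA]]]] := smith_form A.
pose D := smith_mx p q x.
have hD F : field_rank F D = rA by rewrite -(hA F) eA field_rankM_unit.
have xu := smith_unit hD.
pose S := [set j : 'I_q | (j < p)%N && (x j != 0)].
have cS : #|S| = rA.
  rewrite -(hD rat) field_rank_smith; apply: eq_card => j; rewrite !inE.
  by rewrite intr_eq0.
pose B' := R *m B.
have DB : D *m B' = 0.
  have : L *m (D *m B') = 0 by rewrite !mulmxA -eA.
  by move/(congr1 (mulmx (invmx L))); rewrite mulKmx // mulmx0.
have B'0 i j : i \in S -> B' i j = 0.
  rewrite inE => /andP[ip xi]; have /matrixP/(_ (Ordinal ip) j) := DB; rewrite !mxE.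
  rewrite (bigD1 i) //= mxE /= eqxx big1 ?addr0; last first.
    by move=> k; rewrite -val_eqE /= mxE /= eq_sym => /negPf ->; rewrite mul0r.
  by move/eqP; rewrite mulf_eq0 (negPf xi) /= !mxE => /eqP.
pose B'' := (sel int (~: S))^T *m B'.
have eB' : sel int (~: S) *m B'' = B'.
  by apply: sel_id_tr => i j; rewrite inE negbK; apply: B'0.
have rB'' : field_rank rat B'' = rB.
  have e1 : field_rank rat B' = rB by rewrite -hB -[RHS](field_rankM_unit rat B uR (unitmx1 _ _)) mulmx1.
  apply/eqP; rewrite -e1 eqn_leq /field_rank; apply/andP; split.
    by rewrite map_mxM mxrankM_maxr.
  by rewrite -{1}eB' map_mxM mxrankM_maxr.
have [L2 [R2 [y [uL2 uR2 eB]]]] := smith_form B''.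
pose S2 := [set i : 'I_#|~: S| | (i < s)%N && (y i != 0)].
have cS2 : #|S2| = rB.
  rewrite -rB'' eB field_rankM_unit // -field_rank_tr.
  have -> : (smith_mx #|~: S| s y)^T = smith_mx s #|~: S| y.
    apply/matrixP=> i j; by rewrite !mxE eq_sym; case: eqP => [->|].
  rewrite field_rank_smith; apply: eq_card => i; rewrite !inE.
  by rewrite intr_eq0.
have cE : #|~: S2| = (q - rA - rB)%N.
  by rewrite cardsCs setCK card_ord cS2 cardsCs setCK card_ord cS.
rewrite -cE; exists (invmx R *m sel int (~: S) *m L2 *m sel int (~: S2)).
have kerB (z : 'rV_#|~: S|) : z *m B'' = 0 <-> forall j, j \notin ~: S2 -> (z *m L2) 0 j = 0.
  split=> [h j|h].
    rewrite inE negbK inE => /andP[js yj].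
    have : z *m L2 *m smith_mx #|~: S| s y = 0.
      have : z *m L2 *m smith_mx #|~: S| s y *m R2 = 0 by rewrite -!mulmxA (mulmxA L2) -eB.
      by move/(congr1 (mulmx^~ (invmx R2))); rewrite mulmxK // mul0mx.
    move=> /matrixP/(_ 0 (Ordinal js)); rewrite mxE [RHS]mxE.
    rewrite (bigD1 j) //= [X in _ * X + _]mxE /= eqxx big1 ?addr0.
      by move/eqP; rewrite mulf_eq0 (negPf yj) orbF => /eqP.
    by move=> i; rewrite -val_eqE /= => /negPf ij; rewrite [X in _ * X]mxE /= ij mulr0.
  rewrite eB !mulmxA; suff -> : z *m L2 *m smith_mx #|~: S| s y = 0 by rewrite mul0mx.
  apply/matrixP=> i j; rewrite ord1 mxE [RHS]mxE big1 // => a _.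
  rewrite [X in _ * X]mxE; case: eqP => [e|]; last by rewrite mulr0.
  have [aS|aS] := boolP (a \in ~: S2); last by rewrite h // mul0r.
  move: aS; rewrite !inE negb_and negbK => /orP[|/eqP ->]; last by rewrite mulr0.
  by rewrite e ltn_ord.
split=> [v vB|w].
  pose z := v *m invmx R *m sel int (~: S).
  have zB : z *m B'' = 0.
    rewrite /z -mulmxA eB' /B' -!mulmxA (mulmxA (invmx R)) mulVmx // mul1mx //.
  have zs := proj1 (kerB z) zB.
  have zid : z *m L2 *m sel int (~: S2) *m (sel int (~: S2))^T = z *m L2.
    by apply: sel_id => i j; rewrite ord1; apply: zs.
  rewrite !mulmxA -/z; split=> [h|[u vu]].
    have z0 : z = 0.
      have : z *m L2 = 0 by rewrite -zid h mul0mx.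
      by move/(congr1 (mulmx^~ (invmx L2))); rewrite mulmxK // mul0mx.
    pose yy := v *m invmx R.
    have yS (j : 'I_q) : j \notin S -> yy 0 j = 0.
      move=> jS; have jS' : j \in ~: S by rewrite inE.
      have /matrixP/(_ 0 (enum_rank_in jS' j)) := z0; rewrite /z mul_sel enum_rankK_in // => ->.
      by rewrite mxE.
    (* A nonzero invariant factor is its own inverse, so multiplying by [x j] performs the
       division. *)
    pose u' : 'rV_p := \row_i (if insub (nat_of_ord i) is Some j then yy 0 (j : 'I_q) * x j else 0).
    exists (u' *m invmx L); rewrite eA -!mulmxA (mulmxA (invmx L)) mulVmx // mul1mx mulmxA.
    have -> : u' *m smith_mx p q x = yy; last by rewrite /yy mulmxKV.
    apply/matrixP=> i j; rewrite ord1 mxE.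
    have [jp|jp] := ltnP j p.
      have uE : u' 0 (Ordinal jp) = yy 0 j * x j by rewrite mxE /= valK.
      rewrite (bigD1 (Ordinal jp)) //= uE [smith_mx _ _ _ _ _]mxE /= eqxx big1 ?addr0; last first.
        by move=> a; rewrite -val_eqE /= [smith_mx _ _ _ _ _]mxE => /negPf ->; rewrite mulr0.
      have [x0|x0] := eqVneq (x j) 0.
        by rewrite x0 !mulr0 yS // inE x0 eqxx andbF.
      by rewrite -mulrA xu ?mulr1.
    rewrite yS; last by rewrite inE ltnNge jp.
    rewrite big1 // => a _; rewrite [X in _ * X]mxE; case: eqP => [e|]; last by rewrite mulr0.
    by have := ltn_ord a; rewrite e ltnNge jp.
  suff -> : z = 0 by rewrite !mul0mx.
  have -> : z = u *m L *m smith_mx p q x *m sel int (~: S) by rewrite /z vu eA !mulmxA mulmxK.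
  apply/matrixP=> i a; rewrite mul_sel mxE [RHS]mxE big1 // => j _; rewrite [X in _ * X]mxE.
  have := enum_valP a; rewrite !inE negb_and negbK -leqNgt => h.
  case: (nat_of_ord j =P _) => [e|_]; last by rewrite mulr0.
  by move: h; rewrite -e leqNgt ltn_ord => /eqP ->; rewrite mulr0.
pose z := w *m (sel int (~: S2))^T *m invmx L2.
exists (z *m (sel int (~: S))^T *m R).
  rewrite -mulmxA -/B' -mulmxA -/B''; apply/kerB => j jS.
  rewrite /z mulmxKV // mxE big1 // => a _; rewrite !mxE; case: eqP => [e|_]; last by rewrite mulr0.
  by move: jS; rewrite e enum_valP.
rewrite !mulmxA mulmxK // -[z *m _ *m _]mulmxA sel_tr mulmx1 /z mulmxKV //.
by rewrite -mulmxA sel_tr mulmx1.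
Qed.

End SmithRank.

(* From here on [inE] is that of finmap. *)
From mathcomp Require Import finmap.

(** * Complexes of natural numbers *)

Section Transfer.
Variables (T : finType) (f : T -> nat).
Hypothesis f_inj : injective f.
Local Open Scope fset_scope.

Definition img (t : {set T}) : {fset nat} := [fset f x | x in t].
Definition pre (s : {fset nat}) : {set T} := [set x | f x \in s].

Lemma imgP (t : {set T}) y : reflect (exists2 x, x \in t & y = f x) (y \in img t).
Proof. exact: (iffP (imfsetP _ _ _ _)). Qed.

Lemma mem_img (t : {set T}) x : (f x \in img t) = (x \in t).
Proof.
apply/imgP/idP => [[y yt /f_inj ->//]|xt].
by exists x.
Qed.

Lemma pre_img (t : {set T}) : pre (img t) = t.
Proof. by apply/setP=> x; rewrite inE mem_img. Qed.

Lemma img_pre (s : {fset nat}) : (forall x, x \in s -> x \in codom f) -> img (pre s) = s.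
Proof.
move=> h; apply/fsetP=> y; apply/imgP/idP.
  by case=> x; rewrite inE => xs ->.
by move=> ys; have /codomP[x e] := h _ ys; exists x; rewrite // inE -e.
Qed.

Lemma img_inj : injective img.
Proof. by move=> s t /(congr1 pre); rewrite !pre_img. Qed.

Lemma img_sub (t : {set T}) (s : {fset nat}) : (img t `<=` s) = (t \subset pre s).
Proof.
apply/fsubsetP/subsetP => h.
  by move=> x xt; rewrite inE; apply: h; rewrite mem_img.
by move=> y /imgP[x xt ->]; have := h x xt; rewrite inE.
Qed.

Lemma sub_img (t : {set T}) (s : {fset nat}) : (forall x, x \in s -> x \in codom f) ->
  (s `<=` img t) = (pre s \subset t).
Proof.
move=> hs; apply/fsubsetP/subsetP => h.
  by move=> x; rewrite inE => /h; rewrite mem_img.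
move=> y ys; have /codomP[x e] := hs _ ys; rewrite e mem_img; apply: h.
by rewrite inE -e.
Qed.

Lemma subset_img (t u : {set T}) : (img t `<=` img u) = (t \subset u).
Proof. by rewrite img_sub pre_img. Qed.

Lemma card_img (t : {set T}) : #|` img t| = #|t|.
Proof. by rewrite /img card_imfset //= cardE. Qed.

Lemma card_pre (s : {fset nat}) : (forall x, x \in s -> x \in codom f) -> #|pre s| = #|` s|.
Proof. by move=> hs; rewrite -[in RHS](img_pre hs) card_img. Qed.

Lemma preU (s t : {fset nat}) : pre (s `|` t) = pre s :|: pre t.
Proof. by apply/setP=> x; rewrite !inE. Qed.

End Transfer.

Section Joins.
Local Open Scope fset_scope.

Lemma in_bdry (V : choiceType) (alpha t : {fset V}) :
  (t \in bdry_complex alpha) = (t `<=` alpha) && ~~ (alpha `<=` t).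
Proof.
rewrite !inE fpowersetE andbC; case: (boolP (t `<=` alpha)) => //= h.
by rewrite eqEfsubset h.
Qed.

Lemma joinP (V : choiceType) (X Y : cplx V) t :
  reflect (exists a b, [/\ a \in X, b \in Y & t = a `|` b]) (t \in join X Y).
Proof.
apply: (iffP (imfset2P _ _ _ _ _)) => [[a aX [b bY e]]|[a [b [aX bY e]]]].
  by exists a, b.
by exists a => //; exists b.
Qed.

Lemma join_bdry_r (V : choiceType) (alpha beta t : {fset V}) : [disjoint alpha & beta] ->
  (t \in join (full_complex alpha) (bdry_complex beta)) =
  (t `<=` alpha `|` beta) && ~~ (beta `<=` t).
Proof.
move=> /fdisjointP dab; apply/joinP/andP.
  case=> a [b []]; rewrite fpowersetE in_bdry => sa /andP[sb nb] ->; split.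
    exact: fsetUSS.
  apply: contra nb => /fsubsetP h; apply/fsubsetP=> x xb; have := h x xb.
  rewrite inE => /orP[xa|//]; have := dab x (fsubsetP sa x xa); by rewrite xb.
case=> st nb; exists (t `&` alpha), (t `&` beta); split.
- by rewrite fpowersetE fsubsetIr.
- by rewrite in_bdry fsubsetIr /=; apply: contra nb => h; apply: fsubset_trans h (fsubsetIl _ _).
- by rewrite -fsetIUr; apply/esym/fsetIidPl.
Qed.

Lemma join_bdry_l (V : choiceType) (alpha beta t : {fset V}) : [disjoint alpha & beta] ->
  (t \in join (bdry_complex alpha) (full_complex beta)) =
  (t `<=` alpha `|` beta) && ~~ (alpha `<=` t).
Proof.
move=> dab; rewrite fsetUC -join_bdry_r; last by rewrite fdisjoint_sym.
by apply/joinP/joinP => -[a [b [h1 h2 ->]]]; exists b, a; rewrite fsetUC.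
Qed.

End Joins.

(** * Stellated spheres as boundaries of shelled balls *)

Section StellatedShelling.
Local Open Scope fset_scope.

(** A move from [alpha] to [beta] becomes the step adding the simplex [beta U alpha]. The type [T]
    is chosen for the last complex, but the earlier ones fit in it too: [alpha] always has at least
    two elements, so no move deletes a vertex. *)
Lemma stellated_shelling k e (S : cplx nat) : 0 < k -> 2 * k <= e.+1 -> stellated k e S ->
  forall (T : finType) (f : T -> nat), injective f ->
    (forall s x, s \in S -> x \in s -> x \in codom f) ->
  exists l : seq ({set T} * {set T}),
    [/\ shelling k e l, l <> [::] & forall t, (img f t \in S) = (t \in bnd l)].
Proof.
move=> k0 ke st; have ke' : k <= e by lia.
elim: st => {S} [alpha ca|X alpha beta stX IH adm cb] T f fi hS.
  have hc x : x \in alpha -> x \in codom f.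
    move=> xa; apply: (hS [fset x]); last by rewrite inE.
    rewrite in_bdry fsub1set xa /=; apply/negP=> /fsubset_leq_card.
    by rewrite cardfs1 ca.
  have sE (t : {set T}) : t \in seg set0 (set0 :|: pre f alpha) = (t \subset pre f alpha).
    by rewrite inE sub0set set0U.
  (* With empty minimal new face, all faces of the first simplex are new and only the simplex itself
     is interior. *)
  exists [:: (set0, pre f alpha)]; split => //=.
    split=> //; last by move=> t; rewrite /bnd ball_nil inE inE andbF.
    split; split=> /=; rewrite ?cards0 ?ball_nil ?inE //.
    - by rewrite -setI_eq0 set0I.
    - by rewrite (card_pre fi) // ca.
    - by move=> t _; rewrite sub0set.
  move=> t; rewrite in_bdry (img_sub fi) (sub_img fi _ hc) inE ball_cons inner_cons ball_nil inner_nil /=.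
  rewrite !setU0 sE inE set0U andbC; case: (boolP (t \subset _)); rewrite ?andbT ?andbF //.
have [[dX a0 b0 dab dims] link] := adm.
have ca : (#|` alpha| + #|` beta| = e.+2)%N.
  move: a0 b0; rewrite -!cardfs_gt0 -dims; case: #|` alpha| => // a; case: #|` beta| => // b _ _.
  by rewrite /= addSn addnS.
have {cb} cb : #|` beta| <= k by apply: leq_trans (leqSpred _) cb.
have ca2 : 2 <= #|` alpha| by lia.
have inX t : t `<=` alpha `|` beta -> (t \in X) = ~~ (beta `<=` t).
  move=> ts; have := congr1 (fun A : cplx nat => t \in A) link.
  by rewrite join_bdry_r // ts !inE /= ts andbT.
have inY t : (t \in bistellar_move X alpha beta) =
    if t `<=` alpha `|` beta then ~~ (alpha `<=` t) else t \in X.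
  rewrite !inE join_bdry_r // join_bdry_l //.
  case: (boolP (t `<=` _)) => ts /=; last by rewrite orbF.
  by rewrite inX // negbK andbN.
have hab x : x \in alpha `|` beta -> x \in codom f.
  move=> xs; apply: (hS [fset x]); last by rewrite inE.
  rewrite inY fsub1set xs; apply/negP=> /fsubset_leq_card.
  by rewrite cardfs1; move: ca2; lia.
have hal x : x \in alpha -> x \in codom f by move=> xa; apply: hab; rewrite inE xa.
have hbe x : x \in beta -> x \in codom f by move=> xa; apply: hab; rewrite inE xa orbT.
have [s x sX xs|l [sl l0 hl]] := IH T f fi.
  case: (boolP (s `<=` alpha `|` beta)) => h; first exact/hab/(fsubsetP h).
  by apply: (hS s) => //; rewrite inY (negPf h).
pose p := (pre f beta, pre f alpha).
have sp (t : {set T}) : (t \subset p.1 :|: p.2) = (img f t `<=` alpha `|` beta).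
  by rewrite (img_sub fi) fsetUC preU.
have bX (t : {set T}) : t \subset p.1 :|: p.2 -> (t \in bnd l) = ~~ (p.1 \subset t).
  by rewrite sp -hl => /inX ->; rewrite (sub_img fi).
have st : shelling_step k e l p.
  split; split=> /=.
  - rewrite -setI_eq0; apply/eqP/setP=> x; rewrite !inE; apply/negP=> /andP[xb xa].
    by move/fdisjointP: dab => /(_ _ xa); rewrite xb.
  - by rewrite (card_pre fi).
  - by rewrite !(card_pre fi) // addnC.
  (* Since [beta] is not a face of the old sphere, it could only be an interior face of the ball;
     but those have at least [e + 2 - k] elements, and [2 * k <= e.+1]. *)
  - apply/negP=> pb; have := bX (pre f beta) (subsetUl _ _); rewrite subxx inE pb andbT => /negbFE.
    by move/(inner_size ke' sl); rewrite (card_pre fi) //; lia.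
  - by move=> t ts nt; rewrite bX.
have spl : shelling k e (p :: l).
  split=> //.
  have rinj : injective (fun x : T => nat_of_ord (enum_rank x)).
    by move=> x y /val_inj/enum_rank_inj.
  exact: (shelling_star ke' rat rinj sl st).
exists (p :: l); split=> // t.
rewrite inY -sp (sub_img fi) // -/p.2 inE ball_cons inner_cons !in_setU ![t \in seg _ _]inE.
case: (boolP (t \subset p.1 :|: p.2)) => ts; last by rewrite !andbF /= hl inE.
have -> : t \in inner l = false.
  by apply: contraTF ts => /(inner_notsub sl st).
rewrite !andbT orbF; case: (p.2 \subset t) => //=.
case: (boolP (p.1 \subset t)) => //= pt.
by have := bX t ts; rewrite pt inE => /andP[_ ->].
Qed.

End StellatedShelling.

(** * Complexes on finite types realised by natural numbers *)

Section Realise.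
Local Open Scope fset_scope.

Definition iota_fset n : {fset nat} := [fset i | i in iota 0 n].

Lemma in_iota_fset n i : (i \in iota_fset n) = (i < n)%N.
Proof. by rewrite !inE /= mem_iota. Qed.

Lemma in_standard_sphere d s :
  (s \in standard_sphere d) = (s `<=` iota_fset d.+2) && (s != iota_fset d.+2).
Proof. by rewrite /standard_sphere /bdry_complex in_fsetD1 fpowersetE andbC. Qed.

Lemma vertices_standard_sphere d : vertices (standard_sphere d) = iota_fset d.+2.
Proof.
apply/fsetP=> i; rewrite /vertices /fcover; apply/bigfcupP/idP => [[s]|hi].
  by rewrite in_standard_sphere => /andP[/andP[/fsubsetP h _] _] /h.
exists [fset i]; last by rewrite inE.
rewrite in_standard_sphere fsub1set hi andbT /=; apply/eqP=> /fsetP e.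
have := e 0%N; have := e 1%N; rewrite !in_iota_fset !inE /= => /eqP <- /eqP //.
Qed.

Lemma fpowersetU_vertices (V : choiceType) (X : cplx V) s : s \in X -> s `<=` vertices X.
Proof. by move=> sX; apply/fsubsetP=> x xs; apply/bigfcupP; exists s; rewrite ?sX. Qed.

Definition realise (V : finType) (f : V -> nat) (X : {set {set V}}) : cplx nat :=
  [fset img f t | t in X].

Lemma realiseP (V : finType) (f : V -> nat) (X : {set {set V}}) s :
  reflect (exists2 t, t \in X & s = img f t) (s \in realise f X).
Proof. exact: (iffP (imfsetP _ _ _ _)). Qed.

Lemma mem_realise (V : finType) (f : V -> nat) (X : {set {set V}}) t : injective f ->
  (img f t \in realise f X) = (t \in X).
Proof.
move=> fi; apply/realiseP/idP => [[t' h /(img_inj fi) ->//]|h]; by exists t.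
Qed.

Lemma img_comp (V W : finType) (g : V -> W) (f : W -> nat) (t : {set V}) :
  img f (g @: t) = img (f \o g) t.
Proof.
apply/fsetP=> y; apply/imgP/imgP => [[z /imsetP[x xt ->] ->]|[x xt ->]]; first by exists x.
by exists (g x); rewrite ?imset_f.
Qed.

Lemma in_prod_complex X Y s : (s \in prod_complex X Y) =
  [&& s `<=` vertices X `*` vertices Y,
    all (fun p => all (fun q => prod_le p q || prod_le q p) (enum_fset s)) (enum_fset s),
    [fset p.1 | p in s] \in X & [fset p.2 | p in s] \in Y].
Proof. by rewrite -fpowersetE /prod_complex 2!inE. Qed.

Lemma img_standard_sphere n (c : {set 'I_n.+2}) :
  (img (@nat_of_ord n.+2) c \in standard_sphere n) = (c != setT).
Proof.
have eT : iota_fset n.+2 = img (@nat_of_ord n.+2) setT.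
  apply/fsetP=> y; rewrite in_iota_fset; apply/idP/imgP => [h1|[x _ ->]]; last exact: ltn_ord.
  by exists (Ordinal h1).
rewrite in_standard_sphere eT subset_img ?subsetT /=; last exact: ord_inj.
by rewrite (inj_eq (img_inj _)); last exact: ord_inj.
Qed.

Section GridSpheres.
Variables (k l : nat).
Local Notation T := ('I_k.+2 * 'I_l.+2)%type.

Let pv (p : T) : nat * nat := (val p.1, val p.2).
Let pv_inj : injective pv.
Proof. by move=> [x y] [x' y'] [/val_inj -> /val_inj ->]. Qed.

Let up (c : {set T}) : {fset (nat * nat)} := [fset pv p | p in c].
Let upP (c : {set T}) y : reflect (exists2 x, x \in c & y = pv x) (y \in up c).
Proof. exact: (iffP (imfsetP _ _ _ _)). Qed.

Let up_mem c p : (pv p \in up c) = (p \in c).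
Proof. by apply/upP/idP => [[q qc /pv_inj ->]//|h]; exists p. Qed.

Let proj_sphere n (I : finType) (g : I -> nat) (h : I -> 'I_n.+2) (c : {set I}) :
    (forall x, g x = h x) ->
  ([fset g p | p in c] \in standard_sphere n) = (h @: c != setT).
Proof.
move=> gh; rewrite -img_standard_sphere; rewrite (_ : imfset _ _ _ = img (@nat_of_ord n.+2) (h @: c)) //.
rewrite img_comp; apply/fsetP=> y; apply/imfsetP/imgP => [[x xc ->]|[x xc ->]].
  by exists x; rewrite //= gh.
by exists x; rewrite //= gh.
Qed.

Let up_sub c : up c `<=` vertices (standard_sphere k) `*` vertices (standard_sphere l).
Proof.
apply/fsubsetP=> p /upP[q qc ->].
by rewrite in_fsetM !vertices_standard_sphere !in_iota_fset !ltn_ord.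
Qed.

Lemma mem_up_prod (c : {set T}) :
  (up c \in prod_complex (standard_sphere k) (standard_sphere l)) = (c \in grid_prod k.+1 l.+1).
Proof.
rewrite in_prod_complex up_sub /= in_set.
have e1 : [fset p.1 | p in up c] = [fset val p.1 | p in c].
  apply/fsetP=> y; apply/imfsetP/imfsetP => [[p /upP[q qc ->] ->]|[q qc ->]]; first by exists q.
  by exists (pv q); rewrite // up_mem.
have e2 : [fset p.2 | p in up c] = [fset val p.2 | p in c].
  apply/fsetP=> y; apply/imfsetP/imfsetP => [[p /upP[q qc ->] ->]|[q qc ->]]; first by exists q.
  by exists (pv q); rewrite // up_mem.
rewrite e1 e2 (@proj_sphere _ _ _ fst) // (@proj_sphere _ _ _ snd) //; congr (_ && _).
apply/allP/grid_chainP => h p.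
  move=> q; rewrite -!up_mem => pc qc; have /allP h' := h _ pc; exact: h' _ qc.
move=> /upP[p' pc ->]; apply/allP=> q /upP[q' qc ->]; exact: h.
Qed.

Lemma prod_complexP s : reflect (exists2 c : {set T}, c \in grid_prod k.+1 l.+1 & s = up c)
  (s \in prod_complex (standard_sphere k) (standard_sphere l)).
Proof.
apply: (iffP idP) => [sP|[c cP ->]]; last by rewrite mem_up_prod.
have e : s = up [set p | pv p \in s].
  apply/fsetP=> p; apply/idP/upP => [ps|[q]]; last by rewrite inE => h ->.
  have : p \in vertices (standard_sphere k) `*` vertices (standard_sphere l).
    by move: sP; rewrite in_prod_complex => /andP[/fsubsetP h _]; apply: h.
  rewrite in_fsetM !vertices_standard_sphere !in_iota_fset => /andP[h1 h2].
  have ep : p = pv (Ordinal h1, Ordinal h2) by rewrite /pv /=; apply: surjective_pairing.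
  by exists (Ordinal h1, Ordinal h2); rewrite ?inE -?ep.
by exists [set p | pv p \in s]; rewrite // -mem_up_prod -e.
Qed.

Lemma isomorphic_grid (V : finType) (f : V -> nat) (phi : T -> V) : injective f -> injective phi ->
  isomorphic (prod_complex (standard_sphere k) (standard_sphere l))
    (realise f [set phi @: (c : {set T}) | c in grid_prod k.+1 l.+1]).
Proof.
move=> f_inj phi_inj; pose g (p : nat * nat) := f (phi (inord p.1, inord p.2)).
have gpv p : g (pv p) = f (phi p) by rewrite /g /= !inord_val; case: p.
have vP p : p \in vertices (prod_complex (standard_sphere k) (standard_sphere l)) -> exists q, p = pv q.
  by case/bigfcupP=> s /andP[/prod_complexP[c cP ->] _] /upP[q _ ->]; exists q.
have gup c : [fset g p | p in up c] = img f (phi @: c).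
  rewrite img_comp; apply/fsetP=> y; apply/imfsetP/imgP => [[p /upP[q qc ->] ->]|[q qc ->]].
    by exists q; rewrite //= gpv.
  by exists (pv q); rewrite ?up_mem //= gpv.
exists g; first by move=> x y /vP[p ->] /vP[q ->]; rewrite !gpv => /f_inj /phi_inj ->.
apply/fsetP=> s; apply/realiseP/imfsetP => /=.
  by case=> t /imsetP[c cP ->] ->; exists (up c); rewrite ?mem_up_prod // gup.
case=> t /prod_complexP[c cP ->] ->; rewrite gup; exists (phi @: c) => //.
by apply/imsetP; exists c.
Qed.

End GridSpheres.

End Realise.

(** * Construction of connected sums of products of spheres *)

Section ConnectedSums.
Variables (k l L : nat).
Hypotheses (k2 : 1 < k) (kl : k.+1 < l).
Local Notation T := ('I_k.+2 * 'I_l.+2)%type.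
Local Notation P := (grid_prod k.+1 l.+1).
Local Notation P0 := (prod_complex (standard_sphere k) (standard_sphere l)).
Local Notation D := #|{: T}|.

Let a1 : 1 < k.+1. Proof. by move: k2; clear; lia. Qed.
Let b1 : 1 < l.+1. Proof. by move: k2 kl; clear; lia. Qed.
Let a2 : 2 < k.+1. Proof. by []. Qed.
Let ab : k.+2 < l.+1. Proof. by []. Qed.

Definition grid_copy (phi : T -> 'I_L) : {set {set 'I_L}} := [set phi @: (c : {set T}) | c in P].

Section Copy.
Variables (phi : T -> 'I_L) (phi_inj : injective phi).

Lemma mem_grid_copy (c : {set T}) : (phi @: c \in grid_copy phi) = (c \in P).
Proof. by rewrite mem_imset //; apply: imset_inj. Qed.

Lemma grid_copy_down : down_closed (grid_copy phi).
Proof.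
move=> s t /imsetP[c cP ->] tc; apply/imsetP; exists (phi @^-1: t); last first.
  apply/setP=> y; apply/idP/imsetP => [yt|[x]]; last by rewrite inE => h ->.
  by have /imsetP[x xc e] := subsetP tc _ yt; exists x; rewrite // inE -e.
apply: grid_prod_down cP _; apply/subsetP=> x; rewrite inE => /(subsetP tc).
by rewrite mem_imset.
Qed.

Lemma grid_copy_facet x0 y0 : corner x0 y0 -> is_facet (grid_copy phi) (phi @: corner_facet x0 y0).
Proof.
move=> hc; split; first by rewrite mem_grid_copy corner_facet_prod.
move=> t /imsetP[c cP ->] h; rewrite (corner_max hc cP) //; apply/subsetP=> x xs.
by have := subsetP h _ (imset_f phi xs); rewrite mem_imset.
Qed.

Lemma betti_grid_copy (F : fieldType) n :
  betti (val : 'I_L -> nat) F (grid_copy phi :\ phi @: facet1 k.+1 l.+1) n =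
  (n == k.+1) + (n == l.+1).
Proof.
have r_inj : injective (fun p => val (phi p)) by move=> x y /val_inj /phi_inj.
have e := @betti_image _ _ (fun p => val (phi p)) val F phi (P :\ facet1 k.+1 l.+1) n phi_inj (fun x y => erefl).
have e2 := @betti_grid_D1 F k.+1 l.+1 a2 ab _ r_inj n.
suff -> : grid_copy phi :\ phi @: facet1 k.+1 l.+1 =
    [set phi @: (c : {set T}) | c in P :\ facet1 k.+1 l.+1] by apply: etrans e e2.
apply/setP=> t; apply/setD1P/imsetP.
  case=> h /imsetP[c cP e3]; exists c => //; apply/setD1P; split=> //.
  by apply: contraNneq h => e4; rewrite e3 e4.
case=> c /setD1P[h cP] ->; split; last by rewrite mem_grid_copy.
by apply: contraNneq h => /(imset_inj phi_inj) ->.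
Qed.

Lemma card_copy_facet x0 y0 : corner x0 y0 -> #|phi @: corner_facet x0 y0| = (k + l).+1 :> nat.
Proof. by move=> hc; rewrite card_imset // card_corner_facet //=; lia. Qed.

End Copy.

Lemma glueing_map n (s : {set 'I_L}) : (n.+1 * D <= L)%N -> #|s| = (k + l).+1 :> nat ->
    (forall x, x \in s -> x < n * D) ->
  exists phi : T -> 'I_L, [/\ injective phi, phi @: facet2 k.+1 l.+1 = s,
    forall x, x \notin facet2 k.+1 l.+1 -> n * D <= phi x & forall x, phi x < n.+1 * D].
Proof.
move=> hL cs sn; set s' := facet2 _ _.
have c2 := corner2 a1 b1.
have cs' : #|s'| = #|s| by rewrite cs card_corner_facet //=; lia.
have [x0 x0s] : exists x, x \in s' by apply/card_gt0P; rewrite cs' cs.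
have fresh (x : T) : n * D + enum_rank x < L.
  by apply: leq_trans hL; rewrite mulSn addnC ltn_add2r ltn_ord.
pose phi x := if x \in s' then enum_val (cast_ord cs' (enum_rank_in x0s x)) else Ordinal (fresh x).
have phi_s x : x \in s' -> phi x \in s by move=> h; rewrite /phi h enum_valP.
have phi_f x : x \notin s' -> phi x = n * D + enum_rank x :> nat by move=> h; rewrite /phi (negPf h).
have inj : injective phi.
  move=> x y; have [hx|hx] := boolP (x \in s'); have [hy|hy] := boolP (y \in s') => e.
  - move: e; rewrite /phi hx hy => /enum_val_inj /cast_ord_inj.
    by move/(congr1 enum_val); rewrite !enum_rankK_in.
  - by have := sn _ (phi_s _ hx); rewrite e phi_f // ltnNge leq_addr.
  - by have := sn _ (phi_s _ hy); rewrite -e phi_f // ltnNge leq_addr.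
  - by move: e => /(congr1 val); rewrite /= !phi_f // => /addnI /val_inj /enum_rank_inj.
exists phi; split=> //.
- apply/eqP; rewrite eqEcard card_imset // cs' leqnn andbT.
  by apply/subsetP=> y /imsetP[x xs ->]; apply: phi_s.
- by move=> x h; rewrite phi_f // leq_addr.
move=> x; have [h|h] := boolP (x \in s'); last by rewrite phi_f // mulSn addnC ltn_add2r ltn_ord.
by apply: leq_trans (sn _ (phi_s _ h)) _; rewrite leq_mul2r leqnSn orbT.
Qed.

(** The facet [s] is where the next copy is attached. Betti numbers are recorded without it, because
    the punctured sums have no top class and [betti_glue] then applies at every step. *)
Lemma connected_sum_exists n : n.+1 * D <= L ->
  exists (X : {set {set 'I_L}}) (s : {set 'I_L}),
    [/\ connected_sum (k + l) P0 n.+1 (realise val X), down_closed X, is_facet X s,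
        #|s| = (k + l).+1 :> nat /\ (forall t x, t \in X -> x \in t -> x < n.+1 * D) &
        forall (F : fieldType) m, betti (val : 'I_L -> nat) F (X :\ s) m =
          n.+1 * ((m == k.+1) + (m == l.+1))].
Proof.
have c1 := corner1 a1 b1; have c2 := corner2 a1 b1.
elim: n => [|n IH] hL.
  rewrite !mul1n in hL *.
  pose phi (x : T) : 'I_L := widen_ord hL (enum_rank x).
  have inj : injective phi by move=> x y /(congr1 val) /= /val_inj /enum_rank_inj.
  exists (grid_copy phi), (phi @: facet1 k.+1 l.+1); split.
  - by apply: connected_sum_one; apply: isomorphic_grid => //; apply: val_inj.
  - exact: grid_copy_down.
  - exact: grid_copy_facet.
  - split; first exact: card_copy_facet.
    by move=> t x /imsetP[c _ ->] /imsetP[y _ ->] /=; apply: ltn_ord.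
  - by move=> F m; rewrite mul1n betti_grid_copy.
have hL' : n.+1 * D <= L by apply: leq_trans hL; rewrite leq_mul2r leqnSn orbT.
have [X [s [cX Xd sX [cs Xn] bX]]] := IH hL'.
have [sX1 sXm] := sX.
have sn x : x \in s -> x < n.+1 * D by apply: Xn.
have [phi [inj phis phif phin]] := glueing_map hL cs sn.
have sY : is_facet (grid_copy phi) s by rewrite -phis; apply: grid_copy_facet.
have uY : is_facet (grid_copy phi) (phi @: facet1 k.+1 l.+1) by apply: grid_copy_facet.
have us : phi @: facet1 k.+1 l.+1 != s.
  by rewrite -phis (inj_eq (imset_inj inj)) facet12.
have XY t : t \in X -> t \in grid_copy phi -> t \subset s.
  move=> tX /imsetP[c _ ec]; rewrite ec -phis; apply: imsetS; apply/subsetP=> x xc.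
  apply/negPn/negP=> /phif; rewrite leqNgt (Xn t) // ec imset_f //.
have Yd := grid_copy_down inj.
exists ((X :|: grid_copy phi) :\ s), (phi @: facet1 k.+1 l.+1); split.
- have -> : realise val ((X :|: grid_copy phi) :\ s) =
      ((realise val X `|` realise val (grid_copy phi)) `\ img val s)%fset.
    apply/fsetP=> z; rewrite in_fsetD1 in_fsetU; apply/realiseP/andP.
      case=> t /setD1P[ts]; rewrite inE => tXY ->; rewrite (inj_eq (img_inj val_inj)) ts.
      by rewrite !mem_realise //; exact: val_inj.
    case=> zs /orP[/realiseP[t tX e]|/realiseP[t tX e]]; exists t => //; apply/setD1P;
      by rewrite inE tX ?orbT; split=> //; apply: contraNneq zs => <-; rewrite e.
  apply: connected_sum_succ => //.
  - by apply: isomorphic_grid => //; apply: val_inj.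
  - by rewrite card_img // ; apply: val_inj.
  apply/fsetP=> z; rewrite in_fsetI fpowersetE; apply/andP/idP.
    case=> /realiseP[t tX ->] ; rewrite mem_realise; last exact: val_inj.
    by move=> tY; rewrite subset_img ?XY //; apply: val_inj.
  move=> zs; have hz x : x \in z -> x \in codom (val : 'I_L -> nat).
    by move=> /(fsubsetP zs) /imgP[y _ ->]; apply: codom_f.
  have ez := img_pre hz; rewrite -ez subset_img in zs; last exact: val_inj.
  rewrite -ez !mem_realise; try exact: val_inj.
  by split; [apply: Xd sX1 zs | apply: Yd zs; case: sY].
- exact: glue_down.
- exact: glue_facet.
- split; first exact: card_copy_facet.
  move=> t x /setD1P[_]; rewrite inE => /orP[tX|/imsetP[c _ ->]] xt.
    by apply: leq_trans (Xn _ _ tX xt) _; rewrite leq_mul2r leqnSn orbT.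
  by case/imsetP: xt => y _ ->.
move=> F m; have s0 : s != set0 by rewrite -card_gt0 cs.
have e := @betti_glue _ val val_inj X (grid_copy phi) s (phi @: facet1 k.+1 l.+1) Xd Yd sX sY uY us XY F m s0.
rewrite {}e => [|j].
  by rewrite bX betti_grid_copy // [in RHS]mulSn addnC.
have [h|h] := boolP ((j == k.+1) || (j == l.+1)); [right | left].
  by rewrite betti_grid_copy //; move: h k2 kl; clear; lia.
by rewrite bX; move: h; rewrite negb_or => /andP[/negPf -> /negPf ->]; rewrite muln0.
Qed.

End ConnectedSums.

(** * Integral homology in coordinates *)

Section QuotientIso.
Local Open Scope ring_scope.
Local Open Scope quotient_scope.

Definition quot_map (R : zmodType) (I : zmodClosed R) (V : zmodType) (p : R -> V)
  (q : Quotient.quot I) : V := p (repr q).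

Section OneSide.
Variables (R : zmodType) (I : zmodClosed R) (V : zmodType) (p : R -> V).
Hypothesis pB : forall x y, p (x - y) = p x - p y.
Hypothesis pI : forall x, (p x == 0) = (x \in I).
Hypothesis pS : forall v, exists x, p x = v.
Local Notation Q := (Quotient.quot I).
Local Notation psi := (quot_map (I := I) p).

Lemma quot_map_pi x : psi (\pi_Q x) = p x.
Proof.
apply/eqP; rewrite -subr_eq0 -pB pI Quotient.idealrBE reprK; exact: eqxx.
Qed.

Lemma quot_mapB : {morph psi : x y / x - y}.
Proof.
move=> x y; rewrite -[x in LHS]reprK -[y in LHS]reprK.
have -> : \pi_Q (repr x) - \pi_Q (repr y) = \pi_Q (repr x - repr y) :> Q by rewrite !piE.
by rewrite quot_map_pi pB.
Qed.

Lemma quot_map_inj : injective psi.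
Proof.
move=> x y /eqP; rewrite -subr_eq0 -pB pI Quotient.idealrBE !reprK.
by move/eqP.
Qed.

Lemma quot_map_surj v : exists q, psi q = v.
Proof. by have [x <-] := pS v; exists (\pi_Q x); rewrite quot_map_pi. Qed.

End OneSide.

(** Both quotients are identified with the same group [V]. *)
Lemma quot_iso (R R' : zmodType) (I : zmodClosed R) (I' : zmodClosed R') (V : zmodType)
    (p : R -> V) (p' : R' -> V) :
    (forall x y, p (x - y) = p x - p y) -> (forall x, (p x == 0) = (x \in I)) ->
    (forall v, exists x, p x = v) ->
    (forall x y, p' (x - y) = p' x - p' y) -> (forall x, (p' x == 0) = (x \in I')) ->
    (forall v, exists x, p' x = v) ->
  exists f : {additive Quotient.quot I -> Quotient.quot I'}, bijective f.
Proof.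
move=> pB pI pS p'B p'I p'S.
pose g q := projT1 (cid (quot_map_surj p'B p'I p'S (quot_map (I := I) p q))).
pose h q := projT1 (cid (quot_map_surj pB pI pS (quot_map (I := I') p' q))).
have gE q : quot_map p' (g q) = quot_map p q by rewrite /g; case: cid.
have hE q : quot_map p (h q) = quot_map p' q by rewrite /h; case: cid.
have gB : zmod_morphism g.
  move=> x y; apply: (quot_map_inj p'B p'I).
  by rewrite (quot_mapB p'B p'I) !gE (quot_mapB pB pI).
pose G : {additive Quotient.quot I -> Quotient.quot I'} :=
  HB.pack g (GRing.isZmodMorphism.Build _ _ g gB).
exists G; exists h => q.
  by apply: (quot_map_inj pB pI); rewrite hE gE.
by apply: (quot_map_inj p'B p'I); rewrite gE hE.
Qed.

End QuotientIso.

Section HomologyMatrices.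
Local Open Scope ring_scope.
Variables (T : finType) (f : T -> nat) (X : cplx nat) (Xt : {set {set T}}).
Hypothesis f_inj : injective f.
Hypothesis X_codom : forall s x, s \in X -> x \in s -> x \in codom f.
Hypothesis XE : forall t, (img f t \in X) = (t \in Xt).
Hypothesis X_down : forall s t : {set T}, s \in Xt -> t \subset s -> t \in Xt.
Hypothesis X0 : set0 \in Xt.

Definition chain_row i (c : chain X i) : 'rV[int]_#|{: ifaces X i}| := \row_j c (enum_val j).

Definition row_chain i (v : 'rV[int]_#|{: ifaces X i}|) : chain X i := [ffun s => v 0 (enum_rank s)].

Lemma chain_rowK i : cancel (@chain_row i) (@row_chain i).
Proof. by move=> c; apply/ffunP=> s; rewrite ffunE mxE enum_rankK. Qed.

Lemma row_chainK i : cancel (@row_chain i) (@chain_row i).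
Proof. by move=> v; apply/rowP=> j; rewrite mxE ffunE enum_valK. Qed.

Lemma chain_rowB i (c e : chain X i) : chain_row (c - e) = chain_row c - chain_row e.
Proof. by apply/rowP=> j; rewrite !mxE !ffunE. Qed.

Lemma chain_row0 i : chain_row (0 : chain X i) = 0.
Proof. by apply/rowP=> j; rewrite !mxE ffunE. Qed.

Lemma face_img i (s : ifaces X i) : img f (pre f (val s)) = val s.
Proof.
apply: img_pre => x xs; apply: X_codom xs.
by have := fsvalP s; rewrite !inE => /andP[].
Qed.

Lemma face_pre i (s : ifaces X i) : pre f (val s) \in Xt /\ #|pre f (val s)| = i.+1.
Proof.
have := fsvalP s; rewrite !inE => /andP[sX /eqP cs]; split; first by rewrite -XE face_img.
rewrite (card_pre f_inj) // => x xs; exact: X_codom xs.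
Qed.

Definition bd_mx i : 'M[int]_(#|{: ifaces X i.+1}|, #|{: ifaces X i}|) :=
  \matrix_(a, c) incid f (pre f (val (enum_val a))) (pre f (val (enum_val c))).

(** Matches the sign convention of [boundary] with that of [incid] for the ranking [f]. *)
Lemma boundary_coef (s t : {set T}) :
  \sum_(v <- enum_fset (img f s) | (img f s `\ v)%fset == img f t)
     (-1) ^+ #|` [fset u in img f s | (u < v)%N]%fset| = incid f s t :> int.
Proof.
have rem x : (img f s `\ f x)%fset = img f (s :\ x).
  apply/fsetP=> y; rewrite in_fsetD1; apply/andP/imgP.
    case=> yx /imgP[z zs e]; exists z => //; rewrite !inE zs andbT.
    by apply: contraNneq yx => <-; rewrite e.
  case=> z; rewrite !inE => /andP[zx zs] ->; rewrite mem_img //.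
  by rewrite (inj_eq f_inj).
rewrite /incid big_mkcond /= /img big_imfset /=; last by move=> x y _ _; apply: f_inj.
rewrite big_enum_cond /= [RHS]big_mkcond /= big_mkcond /=; apply: eq_bigr => x _.
case: (boolP (x \in s)) => //= xs.
rewrite -/(img f s) -/(img f t) rem (inj_eq (img_inj f_inj)); case: eqP => // _.
rewrite /vsign; congr (_ ^+ _).
have -> : [fset u in img f s | (u < f x)%N]%fset = img f [set u in s | (f u < f x)%N].
  apply/fsetP=> y; rewrite !inE /=; apply/andP/imgP.
    by case=> /imgP[z zs ->] h; exists z; rewrite // inE zs.
  by case=> z; rewrite inE => /andP[zs h] ->; rewrite mem_img.
by rewrite card_img.
Qed.

Lemma chain_row_boundary i (c : chain X i.+1) :
  chain_row (boundary c) = chain_row c *m bd_mx i.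
Proof.
apply/rowP=> j; rewrite !mxE ffunE.
rewrite [RHS](eq_bigr (fun a => (fun s => c s * incid f (pre f (val s)) (pre f (val (enum_val j)))) (enum_val a))); last first.
  by move=> a _; rewrite !mxE.
rewrite -[RHS](big_enum_val (fun s => c s * incid f (pre f (val s)) (pre f (val (enum_val j))))) /=.
apply: eq_bigr => s _; rewrite -mulr_suml mulrC; congr (_ * _).
by rewrite -boundary_coef !face_img.
Qed.

Lemma bd_mx_mul i : bd_mx i.+1 *m bd_mx i = 0.
Proof.
apply/matrixP=> a j; rewrite !mxE.
rewrite (eq_bigr (fun b => (fun t => incid f (pre f (val (enum_val a))) (pre f (val t)) *
    incid f (pre f (val t)) (pre f (val (enum_val j)))) (enum_val b))); last first.
  by move=> b _; rewrite !mxE.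
rewrite -(big_enum_val (fun t => incid f (pre f (val (enum_val a))) (pre f (val t)) *
    incid f (pre f (val t)) (pre f (val (enum_val j))))) /=.
set s := pre f _; set u := pre f _.
have [sX cs] := face_pre (enum_val a).
rewrite -[RHS](incid_sq f_inj s u).
have fc (t : {set T}) : (t \in Xt) && (#|t| == i.+2) -> img f t \in ifaces X i.+1.
  by case/andP=> tX ct; rewrite !inE XE tX card_img.
rewrite [RHS](bigID (fun t : {set T} => (t \in Xt) && (#|t| == i.+2))) /= [X in _ = _ + X]big1 ?addr0; last first.
  move=> t nt; case: (eqVneq (incid f s t) 0) => [->|h]; first by rewrite mul0r.
  case/negP: nt; rewrite (X_down sX (incid_sub h)).
  by have := incid_card h; rewrite cs => -[<-] /=.
rewrite [RHS](reindex_omap (fun t : ifaces X i.+1 => pre f (val t)) (fun t => insub (img f t))) /=.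
  apply: eq_bigl => t; have [h1 h2] := face_pre t; rewrite h1 h2 eqxx /=.
  by rewrite face_img valK eqxx.
move=> t ht; have h := fc t ht; rewrite insubT /=; congr Some.
exact: pre_img.
Qed.

(** The boundary starts from faces of dimension [i + 1], which have [i + 2] vertices. *)
Lemma bd_mx_rank (F : fieldType) i : field_rank F (bd_mx i) = rk F (incid f) (fun s : {set T} => #|s|) Xt i.+2.
Proof.
rewrite rkE /field_rank.
have -> : map_mx (intr : int -> F) (bd_mx i) = fun_mx (fun (s : ifaces X i.+1) (t : ifaces X i) =>
    (incid f (pre f (val s)) (pre f (val t)))%:~R).
  by apply/matrixP=> a b; rewrite !mxE.
apply/esym/(@rank_fun_mx_embed _ _ _ _ _ predT predT _ _ (fun s => pre f (val s)) (fun s => pre f (val s)) (fun=> 1) (fun=> 1)).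
- by move=> s; rewrite mulr1.
- by move=> s; rewrite mulr1.
- by move=> s t _ _ e; apply/val_inj; rewrite -(face_img s) e face_img.
- by move=> s t _ _ e; apply/val_inj; rewrite -(face_img s) e face_img.
- by [].
- move=> s t; case: ifP; rewrite ?eqxx // => /and3P[sX /eqP cs tX] h.
  have h' : incid f s t != 0 by apply: contraNneq h => ->.
  have ct : #|t| = i.+1 by have := incid_card h'; rewrite cs => -[].
  have sF : img f s \in ifaces X i.+1 by rewrite !inE XE sX card_img // cs eqxx.
  have tF : img f t \in ifaces X i by rewrite !inE XE tX card_img // ct eqxx.
  by exists [` sF]%fset, [` tF]%fset; split; rewrite //= pre_img.
move=> s t _ _; have [s1 s2] := face_pre s; have [t1 t2] := face_pre t.
by rewrite s1 s2 t1 eqxx mul1r mulr1.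
Qed.

Lemma card_ifaces i : #|{: ifaces X i}| = #|level (fun s : {set T} => #|s|) Xt i.+1|.
Proof.
rewrite -(card_codom (f := fun s : ifaces X i => pre f (val s))); last first.
  by move=> s t e; apply/val_inj; rewrite -(face_img s) e face_img.
apply: eq_card => t; rewrite inE; apply/codomP/andP.
  by case=> s ->; have [h1 h2] := face_pre s; rewrite h1 h2.
case=> tX /eqP ct; have tF : img f t \in ifaces X i by rewrite !inE XE tX card_img // ct eqxx.
by exists [` tF]%fset; rewrite /= pre_img.
Qed.

Variable g : nat -> nat.
Hypothesis bg : forall (F : fieldType) n, betti f F Xt n = g n.

Let down_cpx F : is_cpx F (incid f) Xt.
Proof. by apply: cpx_convex => // s t u sX _ _ ts; apply: X_down sX ts. Qed.

(** Betti numbers and face numbers determine the ranks recursively, so independence of the field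
    passes to the ranks, as [homology_matrix] requires. *)
Lemma rk_const (F : fieldType) n : rk F (incid f) (fun s : {set T} => #|s|) Xt n =
  rk rat (incid f) (fun s : {set T} => #|s|) Xt n.
Proof.
elim: n => [|n IH]; first by rewrite !rk0 //; exact: incid_card.
have e1 := bt_rk (@incid_card _ f) n (down_cpx F).
have e2 := bt_rk (@incid_card _ f) n (down_cpx rat).
have b1 := bg F n; have b2 := bg rat n; rewrite /betti in b1 b2.
rewrite b1 IH in e1; rewrite b2 in e2.
by apply: (addnI (etrans e1 (esym e2))).
Qed.

(** The function [g] is reduced and indexed by size, homology is unreduced and indexed by dimension.
    In dimension 0 one class is added, except for the complex whose only face is empty, where
    [g 0 = 1]. *)
Definition homology_rank i := if i is j.+1 then g j.+2 else (g 1 + (1 - g 0))%N.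

Let arith0 a b c g0 g1 : (g0 + 0 + a = 1 -> g1 + a + b = c -> g1 + (1 - g0) = c - b - 0)%N.
Proof. by move=> h1 h2; lia. Qed.

Let arith1 a b c g1 : (g1 + a + b = c -> g1 = c - b - a)%N.
Proof. by move=> h1; lia. Qed.

Lemma homology_coordinates i : exists C : 'M[int]_(#|{: ifaces X i}|, homology_rank i),
  (forall c : chain X i, is_cycle c ->
     (chain_row c *m C = 0 <-> exists u : chain X i.+1, boundary u = c)) /\
  (forall w, exists2 c : chain X i, is_cycle c & chain_row c *m C = w).
Proof.
have bnd (c : chain X i) : (exists u, chain_row c = u *m bd_mx i) <-> (exists u : chain X i.+1, boundary u = c).
  split=> [[u e]|[u <-]].
    exists (row_chain u); rewrite -[LHS]chain_rowK chain_row_boundary row_chainK -e.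
    exact: chain_rowK.
  by exists (chain_row u); rewrite chain_row_boundary.
case: i bnd => [|i] bnd.
  (* Every 0-chain is a cycle, so a zero matrix, with an arbitrary number of columns, takes the
     place of the next boundary. *)
  have AB : bd_mx 0 *m (0 : 'M[int]_(#|{: ifaces X 0}|, 1)) = 0 by rewrite mulmx0.
  have rB : field_rank rat (0 : 'M[int]_(#|{: ifaces X 0}|, 1)) = 0%N.
    by rewrite /field_rank map_mx0 mxrank0.
  have hA F : field_rank F (bd_mx 0) = rk rat (incid f) (fun s : {set T} => #|s|) Xt 2.
    by rewrite bd_mx_rank rk_const.
  have [C [h1 h2]] := homology_matrix AB hA rB.
  have e : homology_rank 0 = (#|{: ifaces X 0}| - rk rat (incid f) (fun s : {set T} => #|s|) Xt 2 - 0)%N.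
    have e0 := bt_rk (@incid_card _ f) 0 (down_cpx rat).
    have e1 := bt_rk (@incid_card _ f) 1 (down_cpx rat).
    have b0 := bg rat 0; have b1 := bg rat 1; rewrite /betti in b0 b1.
    rewrite b1 -card_ifaces in e1.
    rewrite b0 (@rk0 rat _ _ _ (@incid_card _ f)) in e0.
    have c0 : #|level (fun s : {set T} => #|s|) Xt 0| = 1%N.
      rewrite (_ : level _ _ _ = [set set0]) ?cards1 //; apply/setP=> t; rewrite !inE cards_eq0.
      by case: eqP => [->|_]; rewrite ?X0 ?andbF.
    rewrite c0 in e0; exact: (arith0 e0 e1).
  rewrite e; exists C; split=> [c _|w].
    by rewrite -bnd; apply: h1; rewrite mulmx0.
  have [v _ vw] := h2 w; exists (row_chain v) => //.
  by rewrite row_chainK.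
have hA F : field_rank F (bd_mx i.+1) = rk rat (incid f) (fun s : {set T} => #|s|) Xt i.+3.
  by rewrite bd_mx_rank rk_const.
have [C [h1 h2]] := homology_matrix (bd_mx_mul i) hA (bd_mx_rank rat i).
have e : homology_rank i.+1 = (#|{: ifaces X i.+1}| - rk rat (incid f) (fun s : {set T} => #|s|) Xt i.+3 - rk rat (incid f) (fun s : {set T} => #|s|) Xt i.+2)%N.
  have e1 := bt_rk (@incid_card _ f) i.+2 (down_cpx rat).
  have b1 := bg rat i.+2; rewrite /betti in b1.
  rewrite b1 -card_ifaces in e1; exact: (arith1 e1).
have cyc (c : chain X i.+1) : is_cycle c <-> chain_row c *m bd_mx i = 0.
  rewrite -chain_row_boundary; split=> [/eqP ->|h]; first by rewrite chain_row0.
  by apply/eqP; rewrite -[LHS]chain_rowK h; apply/ffunP=> s; rewrite !ffunE mxE.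
rewrite e; exists C; split=> [c /cyc hc|w].
  by rewrite -bnd; apply: h1.
have [v vB vw] := h2 w; exists (row_chain v); last by rewrite row_chainK.
by apply/cyc; rewrite row_chainK.
Qed.

End HomologyMatrices.

(** In each dimension both groups are free of the rank prescribed by [g], with explicit coordinates
    in the same row space. *)
Lemma same_homology_betti (T T' : finType) (f : T -> nat) (f' : T' -> nat)
    (X Y : cplx nat) (Xt : {set {set T}}) (Yt : {set {set T'}}) (g : nat -> nat) :
    injective f -> (forall s x, s \in X -> x \in s -> x \in codom f) ->
    (forall t, (img f t \in X) = (t \in Xt)) ->
    (forall s t : {set T}, s \in Xt -> t \subset s -> t \in Xt) -> set0 \in Xt ->
    (forall (F : fieldType) n, betti f F Xt n = g n) ->
    injective f' -> (forall s x, s \in Y -> x \in s -> x \in codom f') ->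
    (forall t, (img f' t \in Y) = (t \in Yt)) ->
    (forall s t : {set T'}, s \in Yt -> t \subset s -> t \in Yt) -> set0 \in Yt ->
    (forall (F : fieldType) n, betti f' F Yt n = g n) ->
  same_homology X Y.
Proof.
move=> f1 f2 f3 f4 f5 f6 g1 g2 g3 g4 g5 g6 i.
have [C [c1 c2]] := homology_coordinates f1 f2 f3 f4 f5 f6 i.
have [D [d1 d2]] := homology_coordinates g1 g2 g3 g4 g5 g6 i.
apply: (@quot_iso _ _ _ _ _ (fun z : cycle X i => (chain_row (cycle_chain z) *m C)%R)
   (fun z : cycle Y i => (chain_row (cycle_chain z) *m D)%R)).
- by move=> x y; rewrite -mulmxBl -chain_rowB.
- move=> z; apply/eqP/asboolP => [/c1 h|[u e]]; first by case: z h => c hc h; have [u e] := h hc; exists u.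
  by apply/c1; [case: z {e} | exists u].
- by move=> w; have [c hc e] := c2 w; exists (Cycle hc).
- by move=> x y; rewrite -mulmxBl -chain_rowB.
- move=> z; apply/eqP/asboolP => [/d1 h|[u e]]; first by case: z h => c hc h; have [u e] := h hc; exists u.
  by apply/d1; [case: z {e} | exists u].
- by move=> w; have [c hc e] := d2 w; exists (Cycle hc).
Qed.

Lemma betti_simplex_boundary n (r : 'I_n -> nat) (F : fieldType) m : injective r -> 0 < n ->
  betti r F [set t : {set 'I_n} | t != setT] m = (m.+1 == n).
Proof.
move=> r_inj n0.
have lo : lower_in (seg set0 setT) [set t : {set 'I_n} | t != setT].
  split; first by apply/subsetP=> t _; rewrite inE sub0set subsetT.
  by move=> s t; rewrite !inE => sn _ ts; apply: contraNneq sn => e; rewrite -subTset -e.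
have ac j : betti r F (seg set0 setT) j = 0.
  apply: betti_seg => //; rewrite properEneq subsetT andbT.
  by apply/eqP=> /setP /(_ (Ordinal n0)); rewrite !inE.
have e := betti_acyclic_total r_inj (F := F) (@convex_seg _ set0 setT) lo ac m.
rewrite {}e (_ : _ :\: _ = [set setT]) ?betti_single ?cardsT ?card_ord //.
apply/setP=> t; have ts : t \in seg set0 setT by rewrite inE sub0set subsetT.
by rewrite in_setD in_set1 ts andbT in_set negbK.
Qed.

Lemma in_link (V : choiceType) (X : cplx V) x s :
  (s \in link X x) = [&& s \in X, x \notin s & (x |` s \in X)%fset].
Proof. by rewrite !inE. Qed.

(** * The given complex over its own vertex set *)

Section Realisation.
Variables (k d : nat) (M : cplx nat).
Hypotheses (k2 : 1 < k) (kd : 2 * k + 2 <= d) (MW : classWstar k d M).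
Local Open Scope fset_scope.
Local Notation T := (vertices M).
Let f (x : T) : nat := val x.
Let f_inj : injective f. Proof. exact: val_inj. Qed.

Definition vertex_complex : {set {set T}} := [set t : {set T} | img f t \in M].
Local Notation Mt := vertex_complex.

Let M_codom s x : s \in M -> x \in s -> x \in codom f.
Proof.
move=> sM xs; have xv : x \in vertices M by apply: (fsubsetP (fpowersetU_vertices sM)).
by apply/codomP; exists [` xv].
Qed.

Let MtE t : (img f t \in M) = (t \in Mt). Proof. by rewrite inE. Qed.

Lemma vertex_complex_down (s t : {set T}) : s \in Mt -> t \subset s -> t \in Mt.
Proof.
have [[[_ h] _ _ _] _] := MW; rewrite -!MtE => sM ts; apply: h sM _.
by rewrite subset_img.
Qed.

Lemma vertex_complex0 : set0 \in Mt.
Proof.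
have [[[h _] _ _ _] _] := MW; rewrite -MtE (_ : img f set0 = fset0) //.
by apply/fsetP=> y; apply/imgP; case=> x; rewrite inE.
Qed.

Lemma vertex_complex_neighbourly (t : {set T}) : #|t| = k.+1 -> t \in Mt.
Proof.
have [_ h] := MW => ct; rewrite -MtE; apply: h; last by rewrite card_img.
by apply/fsubsetP=> y /imgP[x _ ->]; apply: fsvalP.
Qed.

Lemma vertex_complex_card : k < #|{: T}|.
Proof.
have [[_ dM _ _] _] := MW.
have [s sM cs] : exists2 s, s \in M & d < #|` s|.
  apply: contrapT => h; move: dM; rewrite /dimension_is => e.
  suff : (\max_(s <- enum_fset M) #|` s| <= d)%N by rewrite e ltnn.
  apply/bigmax_leqP_seq=> s sM _; rewrite leqNgt; apply/negP=> cs; apply: h.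
  by exists s.
have := fsubset_leq_card (fpowersetU_vertices sM); rewrite (cardfE (vertices M)) => h.
by apply: leq_trans (leq_trans cs h); move: kd; clear; lia.
Qed.

Lemma vertex_shellings : exists lv : T -> seq ({set T} * {set T}), forall v,
  [/\ shelling k d.-1 (lv v), lv v <> [::] &
    forall t : {set T}, (t \in bnd (lv v)) = (v \notin t) && (v |: t \in Mt)].
Proof.
have [[_ _ _ hl] _] := MW.
have h (v : T) : exists l : seq ({set T} * {set T}), [/\ shelling k d.-1 l, l <> [::] &
    forall t : {set T}, (t \in bnd l) = (v \notin t) && (v |: t \in Mt)].
  have k0 : 0 < k by move: k2; clear; lia.
  have ke : 2 * k <= d.-1.+1 by move: kd; clear; lia.
  have [|l [l1 l2 l3]] := stellated_shelling k0 ke (hl _ (fsvalP v)) f_inj.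
    by move=> s x; rewrite in_link => /andP[sM _]; apply: M_codom.
  exists l; split=> // t; rewrite -l3 in_link.
  have <- : img f (v |: t) = f v |` img f t.
    apply/fsetP=> y; apply/imgP/fset1UP => [[x /setU1P[->|xt] ->]|[->|/imgP[x xt ->]]].
    - by left.
    - by right; rewrite mem_img.
    - by exists v; rewrite ?setU11.
    - by exists x; rewrite // inE xt orbT.
  rewrite (mem_img f_inj t v) !MtE; case: (boolP (v \notin t)) => nv /=; last by rewrite andbF.
  apply/andP/idP => [[]//|h]; split=> //.
  exact: vertex_complex_down h (subsetUr _ _).
have [lv hlv] := fin_all_exists h.
by exists lv.
Qed.

(** The formula determines the Betti number of the filling over every field, so its rational value
    can serve as [beta] for all of them. *)
Lemma betti_vertex_complex : exists beta : nat,
  [/\ d + 2 <= #|` vertices M|,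
      (beta%:R = 'C(#|` vertices M| + k - d - 2, k.+1)%:R / 'C(d + 2, k.+1)%:R :> rat)%R &
      forall (F : fieldType) n, betti f F Mt n =
        (beta * ((n == k.+1) + (n == (d - k).+1)) + (n == d.+1))%N].
Proof.
have [lv hlv] := vertex_shellings.
have sh v : shelling k d.-1 (lv v) by have [] := hlv v.
have nil v : lv v <> [::] by have [] := hlv v.
have link v t : (t \in bnd (lv v)) = (v \notin t) && (v |: t \in Mt) by have [_ _] := hlv v.
have ke : 2 * k < d.-1 by move: kd; clear; lia.
have kT := vertex_complex_card.
have cv : d.-1.+3 <= #|{: T}|.
  exact: (card_vertices ke vertex_complex_down vertex_complex_neighbourly kT sh nil link).
have cv' : d + 2 <= #|` vertices M| by rewrite (cardfE (vertices M)); move: cv kd; clear; lia.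
have fo F := betti_filling_formula ke vertex_complex_down vertex_complex_neighbourly kT sh nil link F f_inj.
have io F := betti_interior_formula k2 ke vertex_complex_down vertex_complex_neighbourly kT sh nil link F f_inj.
have bM F := betti_M k2 ke vertex_complex_down vertex_complex_neighbourly kT sh nil link F f_inj.
exists (betti f rat (filling k Mt) k.+1); split=> //.
  rewrite (fo rat) -(cardfE (vertices M)); congr (_%:R / _%:R)%R; congr 'C(_, _); by move: cv' kd; clear; lia.
move=> F n; rewrite bM io.
have -> : betti f F (filling k Mt) k.+1 = betti f rat (filling k Mt) k.+1.
  by apply/eqP; rewrite -(eqr_nat rat) fo fo.
set b := betti _ _ _ _; have -> : d.-1.+2 - k = (d - k).+1 by move: kd; clear; lia.
have -> : d.-1.+2 = d.+1 by move: kd; clear; lia.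
by rewrite mulnDr [b * (n == k.+1)]mulnC [b * (n == (d - k).+1)]mulnC.
Qed.

End Realisation.

Section SameHomology.
Variables (k d : nat) (M : cplx nat).
Hypotheses (k2 : 1 < k) (kd : 2 * k + 2 <= d) (MW : classWstar k d M).

Let M_same (V : finType) (f : V -> nat) (X : {set {set V}}) (Y : cplx nat) beta :
    (forall (F : fieldType) n, betti (val : vertices M -> nat) F (vertex_complex M) n =
        beta * ((n == k.+1) + (n == (d - k).+1)) + (n == d.+1)) ->
    injective f -> (forall s x, s \in Y -> x \in s -> x \in codom f) ->
    (forall t, (img f t \in Y) = (t \in X)) -> down_closed X -> set0 \in X ->
    (forall (F : fieldType) n, betti f F X n =
        beta * ((n == k.+1) + (n == (d - k).+1)) + (n == d.+1)) ->
  same_homology M Y.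
Proof.
move=> bM f_inj Y_codom YE Yd Y0 bY.
apply: (@same_homology_betti _ V val f M Y (vertex_complex M) X _ _ _ _ _ _ bM) => //.
- exact: val_inj.
- move=> s x sM xs; have xv := fsubsetP (fpowersetU_vertices sM) x xs.
  by apply/codomP; exists [` xv]%fset.
- by move=> t; rewrite inE.
- exact: vertex_complex_down MW.
- exact: vertex_complex0 MW.
Qed.

Lemma homology_sphere_betti :
    (forall (F : fieldType) n, betti (val : vertices M -> nat) F (vertex_complex M) n = (n == d.+1)) ->
  homology_sphere d M.
Proof.
move=> bM; apply: (@M_same _ (@nat_of_ord d.+2) [set t | t != setT] (standard_sphere d) 0) => //.
- exact: ord_inj.
- move=> s x; rewrite in_standard_sphere => /andP[/fsubsetP h _] /h; rewrite in_iota_fset => xd.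
  by apply/codomP; exists (Ordinal xd).
- by move=> t; rewrite img_standard_sphere inE.
- by move=> s t; rewrite !inE => sn ts; apply: contraNneq sn => e; rewrite -subTset -e.
- by rewrite inE; apply/eqP=> /setP /(_ ord0); rewrite !inE.
- by move=> F n; rewrite betti_simplex_boundary //; apply: ord_inj.
Qed.

Lemma same_homology_connected_sum beta :
    (forall (F : fieldType) n, betti (val : vertices M -> nat) F (vertex_complex M) n =
        beta.+1 * ((n == k.+1) + (n == (d - k).+1)) + (n == d.+1)) ->
  exists2 N : cplx nat,
    connected_sum d (prod_complex (standard_sphere k) (standard_sphere (d - k))) beta.+1 N &
    same_homology M N.
Proof.
move=> bM; have kl : k.+1 < d - k by move: kd; clear; lia.
have [X [s [cX Xd sX [cs _] bX]]] := @connected_sum_exists k (d - k) _ k2 kl beta (leqnn _).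
have kdk : (k + (d - k) = d)%N by apply: subnKC; move: kd; clear; lia.
rewrite kdk in cX cs; have [sX1 _] := sX.
exists (realise val X) => //; apply: (M_same bM val_inj _ _ Xd).
- by move=> z x /realiseP[t _ ->] /imgP[y _ ->]; apply: codom_f.
- by move=> t; rewrite mem_realise //; apply: val_inj.
- by apply: Xd sX1 _; apply: sub0set.
(* Closing the last open facet, of size [d + 1], only adds a fundamental class: as [k] is at least
   2, the sizes [d] and [d + 1] differ from [k + 1] and [d - k + 1]. *)
have z c : (c == d.+1) || (c == d) -> beta.+1 * ((c == k.+1) + (c == (d - k).+1)) = 0.
  move=> h; apply/eqP; rewrite muln_eq0 /=; move: h k2 kd; clear; lia.
move=> F n; rewrite (betti_facet val_inj n Xd sX) ?bX cs //; apply: z.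
  by rewrite eqxx.
by rewrite eqxx orbT.
Qed.

End SameHomology.

Theorem proposition5p12 (k d : nat) (M : cplx nat)
    (hk : (2 <= k)%N) (hd : (2 * k + 2 <= d)%N)
    (hM : classWstar k d M) (hns : ~ homology_sphere d M) :
  let m := #|` vertices M|%fset in
  [/\ exists beta : nat,
        [/\ (0 < beta)%N,
            (beta%:R = 'C(m + k - d - 2, k.+1)%:R / 'C(d + 2, k.+1)%:R :> rat)%R &
            exists2 N : cplx nat,
              connected_sum d
                (prod_complex (standard_sphere k) (standard_sphere (d - k))) beta N &
              same_homology M N],
      (2 * d + 4 - k <= m)%N &
      ('C(d + 2, k.+1) %| 'C(m + k - d - 2, k.+1))%N].
Proof.
move=> m; have [[|beta] [dm bE bM]] := betti_vertex_complex hk hd hM.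
  (* When [beta] is 0 the Betti numbers are those of a sphere over every field. *)
  by case: hns; apply: (homology_sphere_betti hM) => F n; rewrite bM.
rewrite -/m in dm bE.
have C0 : (0 < 'C(d + 2, k.+1))%N by rewrite bin_gt0; move: hk hd; clear; lia.
have E : (beta.+1 * 'C(d + 2, k.+1) = 'C(m + k - d - 2, k.+1))%N.
  apply/eqP; rewrite -(eqr_nat rat) natrM bE divfK //.
  by rewrite pnatr_eq0 -lt0n.
split; last by rewrite -E dvdn_mull.
  exists beta.+1; split=> //; exact: same_homology_connected_sum.
(* For smaller [m] the numerator would be at most ['C(d.+1, k.+1)], which is less than
   ['C(d + 2, k.+1)], although it is a positive multiple of the latter. *)
rewrite leqNgt; apply/negP=> hm.
have h1 : (m + k - d - 2 <= d.+1)%N by move: hm; clear; lia.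
have h2 := leq_bin2l k.+1 h1.
have h3 : ('C(d + 2, k.+1) = 'C(d.+1, k.+1) + 'C(d.+1, k))%N by rewrite addn2 binS.
have h4 : (0 < 'C(d.+1, k))%N by rewrite bin_gt0; move: hd; clear; lia.
by move: E h2 h3 h4; rewrite mulSn; move: (binomial _ _) (binomial _ _) (binomial _ _) (binomial _ _) => A B C D; clear; lia.
Qed.
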